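(* Let $1\le p\le\infty$, let $X$ be a convenient measure space (one that either has no atoms or has infinitely many atoms), let $\mathbf{L}:=L_p(X)$, and let $E$, $F$ be $\mathbf{L}$-spaces. For $U\in\mathbf{L}\otimes(E\otimes F)$ put $$\|U\|_{p\mathbf{L}}:=\inf\Big\{\|a\|\Big(\sum_{k=1}^n\|u_k\|^p\|v_k\|^p\Big)^{1/p}\Big\},$$ the infimum being over all representations $U=a\cdot\sum_{k=1}^n I_k\cdot(u_k\diamond v_k)$ with $n\in\mathbb{N}$, $a\in\mathcal{B}(\mathbf{L})$, $u_k\in\mathbf{L}E$, $v_k\in\mathbf{L}F$ and $I_1,\dots,I_n$ pairwise disjoint proper isometries on $\mathbf{L}$. Let $E\otimes_{p\mathbf{L}}F$ denote the linear space $E\otimes F$ endowed with $\|\cdot\|_{p\mathbf{L}}$, and let $\vartheta:E\times F\to E\otimes_{p\mathbf{L}}F$, $(x,y)\mapsto x\otimes y$. Then the pair $(E\otimes_{p\mathbf{L}}F,\vartheta)$ is a non-completed $p$-convex $\mathbf{L}$-tensor product of $E$ and $F$.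
   Context: Spaces are over $\mathbb{C}$; $\otimes$ is the algebraic tensor product. All measures are assumed to have a countable basis, i.e. they are $\sigma$-finite and there is a countable family of measurable sets approximating every set of finite measure in the metric $\mu(A\triangle B)$ (so there are at most countably many atoms); $X$ has positive measure. For $p=\infty$, $(\sum_k\lambda_k^p)^{1/p}$ means $\max_k\lambda_k$. $\diamond$-operation: fix an arbitrary isometric isomorphism $i:L_p(X\times X)\to L_p(X)$ (it exists under the conditions on $X$) and put $\xi\diamond\eta:=i(\xi(s)\eta(t))$ for $\xi,\eta\in L_p(X)$. $\mathcal{B}(\mathbf{L})$ is the algebra of bounded operators on $\mathbf{L}$. For a linear space $E$, $\mathbf{L}E:=\mathbf{L}\otimes E$, with elementary tensors written $\xi x$, is a left $\mathcal{B}(\mathbf{L})$-module via $a\cdot(\xi x)=a(\xi)x$. An $\mathbf{L}$-seminorm on $E$ is a seminorm on $\mathbf{L}E$ with $\|a\cdot u\|\le\|a\|\|u\|$ for all $a\in\mathcal{B}(\mathbf{L})$, $u\in\mathbf{L}E$. A seminormed $\mathbf{L}$-space is a linear space with an $\mathbf{L}$-seminorm; it is an $\mathbf{L}$-space if this seminorm is a norm. For $u\in\mathbf{L}E$, $v\in\mathbf{L}F$, the element $u\diamond v\in\mathbf{L}(E\otimes F)$ is defined by bilinear extension of $\xi x\diamond\eta y:=(\xi\diamond\eta)(x\otimes y)$. For measurable $X'\subseteq X$, $P_{X'}$ is the projection on $L_p(X)$ multiplying functions by the characteristic function of $X'$; its image is identified with $L_p(X')$. Such projections are called proper. An isometric operator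 on $L_p(X)$ is a proper isometry if its image is $L_p(X')$ for some measurable $X'\subseteq X$; two proper isometries are disjoint if their images intersect in $\{0\}$. (Every $U\in\mathbf{L}(E\otimes F)$ has a representation of the form used to define $\|U\|_{p\mathbf{L}}$.) A seminormed $\mathbf{L}$-space $G$ is $p$-convex if $\|u+v\|\le(\|u\|^p+\|v\|^p)^{1/p}$ whenever $u,v\in\mathbf{L}G$ and there are proper projections $P,Q$ with $PQ=QP=0$, $P\cdot u=u$, $Q\cdot v=v$. For a linear operator $\varphi:E\to F$, $\varphi_\infty:\mathbf{L}E\to\mathbf{L}F$, $\xi x\mapsto\xi\varphi(x)$; $\varphi$ is $\mathbf{L}$-bounded if $\varphi_\infty$ is bounded, and $\|\varphi\|_{\mathbf{L}b}:=\|\varphi_\infty\|$. For a bilinear operator $\mathcal{R}:E\times F\to G$, $\mathcal{R}_\infty:\mathbf{L}E\times\mathbf{L}F\to\mathbf{L}G$ is the bilinear operator with $\mathcal{R}_\infty(\xi x,\eta y)=(\xi\diamond\eta)\mathcal{R}(x,y)$; $\mathcal{R}$ is $\mathbf{L}$-bounded (respectively, $\mathbf{L}$-contractive) if $\mathcal{R}_\infty$ is bounded (respectively, contractive), and $\|\mathcal{R}\|_{\mathbf{L}b}:=\|\mathcal{R}_\infty\|$. A non-completed $p$-convex $\mathbf{L}$-tensor product of $E$ and $F$ is a pair $(\Theta,\theta)$ where $\Theta$ is a $p$-convex (normed) $\mathbf{L}$-space and $\theta:E\times F\to\Theta$ is an $\mathbf{L}$-contractive bilinear operator such that, for every $p$-convex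 (normed) $\mathbf{L}$-space $G$ and every $\mathbf{L}$-bounded bilinear operator $\mathcal{R}:E\times F\to G$, there is a unique $\mathbf{L}$-bounded linear operator $R:\Theta\to G$ with $R\theta=\mathcal{R}$, and moreover $\|R\|_{\mathbf{L}b}=\|\mathcal{R}\|_{\mathbf{L}b}$. *)

(* Defs.v *)
From HB Require Import structures.
From mathcomp Require Import all_boot all_order all_algebra sesquilinear.
From mathcomp Require Import generic_quotient.
From mathcomp Require Import all_classical all_reals all_analysis.
From mathcomp Require Import measurable_realfun ess_sup_inf hoelder complex.

Set Implicit Arguments.
Unset Strict Implicit.
Unset Printing Implicit Defensive.
Import Order.TTheory GRing.Theory Num.Theory.
Import numFieldNormedType.Exports.

Local Open Scope classical_set_scope.
Local Open Scope ring_scope.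
Local Open Scope quotient_scope.

Section TensorProduct.
Context {K : comNzRingType} (E F : lmodType K).

(* A sequence [:: (x1, y1); ..; (xn, yn)] stands for the formal sum of the
   elementary tensors x_i (x) y_i; scalars are absorbed in the first factor. *)
Inductive tens_eq : seq (E * F) -> seq (E * F) -> Prop :=
| tens_eq_refl s : tens_eq s s
| tens_eq_sym s t : tens_eq s t -> tens_eq t s
| tens_eq_trans s t r : tens_eq s t -> tens_eq t r -> tens_eq s r
| tens_eq_cat s s' t t' :
    tens_eq s s' -> tens_eq t t' -> tens_eq (s ++ t) (s' ++ t')
| tens_eq_catC s t : tens_eq (s ++ t) (t ++ s)
| tens_eq_0 y : tens_eq [:: (0, y)] [::]
| tens_eq_Dl x x' y : tens_eq [:: (x + x', y)] [:: (x, y); (x', y)]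
| tens_eq_Dr x y y' : tens_eq [:: (x, y + y')] [:: (x, y); (x, y')]
| tens_eq_Z c x y : tens_eq [:: (c *: x, y)] [:: (x, c *: y)].

Definition tens_eqb s t := `[< tens_eq s t >].

Let tens_eqb_refl : reflexive tens_eqb.
Proof. by move=> s; apply/asboolP; exact: tens_eq_refl. Qed.

Let tens_eqb_sym : symmetric tens_eqb.
Proof.
by move=> s t; apply/asboolP/asboolP => h; exact: tens_eq_sym.
Qed.

Let tens_eqb_trans : transitive tens_eqb.
Proof.
by move=> t s r /asboolP st /asboolP tr; apply/asboolP; exact: tens_eq_trans tr.
Qed.

Canonical tens_eqb_equiv :=
  EquivRel tens_eqb tens_eqb_refl tens_eqb_sym tens_eqb_trans.

Definition tensor : Type := {eq_quot tens_eqb}.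
HB.instance Definition _ := Choice.on tensor.
HB.instance Definition _ := EqQuotient.on tensor.

Lemma tens_piP s t : \pi_tensor s = \pi_tensor t <-> tens_eq s t.
Proof. by split=> [/eqmodP/asboolP|h]; [|apply/eqmodP/asboolP]. Qed.

Lemma tens_eq_repr s : tens_eq (repr (\pi_tensor s)) s.
Proof. by apply/tens_piP; rewrite reprK. Qed.

Lemma tens_reprK (u : tensor) : \pi_tensor (repr u) = u.
Proof. exact: reprK. Qed.

Let scalel (c : K) (q : E * F) := (c *: q.1, q.2).

Let tens_eq_map c s t :
  tens_eq s t -> tens_eq (map (scalel c) s) (map (scalel c) t).
Proof.
elim=> /= {s t}.
- by move=> s; exact: tens_eq_refl.
- by move=> s t _ ?; exact: tens_eq_sym.
- by move=> s t r _ ? _; exact: tens_eq_trans.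
- by move=> s s' t t' _ ? _ ?; rewrite !map_cat; exact: tens_eq_cat.
- by move=> s t; rewrite !map_cat; exact: tens_eq_catC.
- by move=> y; rewrite /scalel/= scaler0; exact: tens_eq_0.
- by move=> x x' y; rewrite /scalel/= scalerDr; exact: tens_eq_Dl.
- by move=> x y y'; rewrite /scalel/=; exact: tens_eq_Dr.
- move=> b x y; rewrite /scalel/= scalerA mulrC -scalerA.
  exact: tens_eq_Z.
Qed.

Let tens_add (u v : tensor) : tensor := \pi_tensor (repr u ++ repr v).
Let tens_zero : tensor := \pi_tensor [::].
Let tens_scale c (u : tensor) : tensor :=
  \pi_tensor (map (scalel c) (repr u)).
Let tens_opp (u : tensor) : tensor := tens_scale (-1) u.

Let tens_addE s t :
  tens_add (\pi_tensor s) (\pi_tensor t) = \pi_tensor (s ++ t).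
Proof. by apply/tens_piP/tens_eq_cat; exact: tens_eq_repr. Qed.

Let tens_scaleE c s :
  tens_scale c (\pi_tensor s) = \pi_tensor (map (scalel c) s).
Proof. by apply/tens_piP/tens_eq_map; exact: tens_eq_repr. Qed.

Let tens_addA : associative tens_add.
Proof.
move=> u v w; rewrite -(tens_reprK u) -(tens_reprK v) -(tens_reprK w).
by rewrite !tens_addE catA.
Qed.

Let tens_addC : commutative tens_add.
Proof.
move=> u v; rewrite -(tens_reprK u) -(tens_reprK v) !tens_addE.
exact/tens_piP/tens_eq_catC.
Qed.

Let tens_add0 : left_id tens_zero tens_add.
Proof. by move=> u; rewrite -(tens_reprK u) tens_addE. Qed.

Let tens_scaleDl a b u :
  tens_scale (a + b) u = tens_add (tens_scale a u) (tens_scale b u).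
Proof.
rewrite -(tens_reprK u) !tens_scaleE tens_addE; apply/tens_piP.
elim: (repr u) => [|q s IHs] /=; first exact: tens_eq_refl.
apply: (@tens_eq_trans _ ((scalel a q :: [:: scalel b q]) ++
  (map (scalel a) s ++ map (scalel b) s))).
  rewrite -cat1s; apply: tens_eq_cat => //.
  by rewrite /scalel scalerDl; exact: tens_eq_Dl.
rewrite /= -(cat1s (scalel a q)) -(cat1s (scalel a q) (_ ++ _)).
apply: tens_eq_cat; first exact: tens_eq_refl.
rewrite -cat1s -(cat1s (scalel b q) (map _ _)) !catA.
apply: tens_eq_cat; last exact: tens_eq_refl.
exact: tens_eq_catC.
Qed.

Let tens_scale0 u : tens_scale 0 u = tens_zero.
Proof.
rewrite -(tens_reprK u) tens_scaleE; apply/tens_piP.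
elim: (repr u) => [|q s IHs] /=; first exact: tens_eq_refl.
rewrite -cat1s -[X in tens_eq _ X]cat0s; apply: tens_eq_cat => //.
by rewrite /scalel scale0r; exact: tens_eq_0.
Qed.

Let tens_scale1 : left_id 1 tens_scale.
Proof.
move=> u; rewrite -[RHS]tens_reprK /tens_scale; congr (\pi_tensor _).
by rewrite -[RHS]map_id; apply: eq_map => -[x y]; rewrite /scalel/= scale1r.
Qed.

Let tens_addN : left_inverse tens_zero tens_opp tens_add.
Proof.
move=> u; rewrite /tens_opp -[X in tens_add _ X]tens_scale1 -tens_scaleDl.
by rewrite addNr tens_scale0.
Qed.

HB.instance Definition _ := GRing.isZmodule.Build tensor
  tens_addA tens_addC tens_add0 tens_addN.

Let tens_scaleA a b u : tens_scale a (tens_scale b u) = tens_scale (a * b) u.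
Proof.
rewrite -(tens_reprK u) !tens_scaleE -map_comp; congr (\pi_tensor _).
by apply: eq_map => q; rewrite /scalel/= scalerA.
Qed.

Let tens_scaleDr : right_distributive tens_scale +%R.
Proof.
move=> c u v; rewrite -(tens_reprK u) -(tens_reprK v).
by rewrite -[_ + _]/(tens_add _ _) -[RHS]/(tens_add _ _)
  !(tens_addE, tens_scaleE) map_cat.
Qed.

HB.instance Definition _ := GRing.Zmodule_isLmodule.Build K tensor
  tens_scaleA tens_scale1 tens_scaleDr (fun v a b => tens_scaleDl a b v).

Definition tens (x : E) (y : F) : tensor := \pi_tensor [:: (x, y)].

Lemma tens_piD s t : \pi_tensor (s ++ t) = \pi_tensor s + \pi_tensor t.
Proof. by rewrite -[RHS]/(tens_add _ _) tens_addE. Qed.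

Lemma tens_piE s : \pi_tensor s = \sum_(q <- s) tens q.1 q.2.
Proof.
elim: s => [|[x y] s IHs]; first by rewrite big_nil.
by rewrite big_cons -cat1s tens_piD IHs.
Qed.

Lemma tensDl x x' y : tens (x + x') y = tens x y + tens x' y.
Proof. by rewrite /tens -tens_piD; exact/tens_piP/tens_eq_Dl. Qed.

Lemma tensDr x y y' : tens x (y + y') = tens x y + tens x y'.
Proof. by rewrite /tens -tens_piD; exact/tens_piP/tens_eq_Dr. Qed.

Lemma tensZl c x y : tens (c *: x) y = c *: tens x y.
Proof. by rewrite -[RHS]/(tens_scale _ _) tens_scaleE. Qed.

Lemma tensZr c x y : tens x (c *: y) = c *: tens x y.
Proof. by rewrite -tensZl; apply/esym/tens_piP; exact: tens_eq_Z. Qed.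

Let tens_bilinear : bilinear_for
  (GRing.Scale.Law.clone _ _ *:%R _) (GRing.Scale.Law.clone _ _ *:%R _) tens.
Proof.
by split=> [y|x] c u v; rewrite /= ?(tensDl, tensDr) ?(tensZl, tensZr).
Qed.

HB.instance Definition _ :=
  bilinear_isBilinear.Build K E F tensor _ _ tens tens_bilinear.

(* The linear map on the tensor product given by a bilinear B. It is defined
   for every function B, but depends on the chosen formal sum unless B is
   bilinear; see [tlift_tens] and [tlift_linear]. *)
Definition tlift (G : lmodType K) (B : E -> F -> G) (u : tensor) : G :=
  \sum_(q <- repr u) B q.1 q.2.

Section Lift.
Context (G : lmodType K) (B : {bilinear E -> F -> G}).

Lemma tlift_pi s : tlift B (\pi_tensor s) = \sum_(q <- s) B q.1 q.2.
Proof.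
rewrite /tlift; move: (repr _) (tens_eq_repr s) => r rs.
elim: rs => {r s} //.
- by move=> s t r _ -> _ ->.
- by move=> s s' t t' _ h _ h'; rewrite !big_cat /= h h'.
- by move=> s t; rewrite !big_cat /= addrC.
- by move=> y; rewrite big_seq1 big_nil linear0l.
- by move=> x x' y; rewrite !big_cons !big_nil !addr0 linearDl.
- by move=> x y y'; rewrite !big_cons !big_nil !addr0 linearDr.
- by move=> c x y; rewrite !big_seq1 linearZl_LR linearZr_LR.
Qed.

Lemma tlift_tens x y : tlift B (tens x y) = B x y.
Proof. by rewrite tlift_pi big_seq1. Qed.

Lemma tlift_linear : linear (tlift B).
Proof.
move=> c u v; rewrite -(tens_reprK u) -(tens_reprK v).
rewrite -[_ *: _]/(tens_scale _ _) tens_scaleE -tens_piD !tlift_pi big_cat /=.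
congr (_ + _); rewrite big_map scaler_sumr; apply: eq_bigr => q _ /=.
by rewrite linearZl_LR.
Qed.

End Lift.

End TensorProduct.

Arguments tens {K E F} x y.

Local Notation normc := (@ComplexField.Normc.normc _).

Section LpFunctions.
Context d (T : measurableType d) (R : realType).
Variables (mu : {measure set T -> \bar R}) (p : \bar R) (p1 : (1 <= p)%E).
Implicit Types f g : T -> R[i].
Local Notation creal := (@complex.Re R).
Local Notation cimag := (@complex.Im R).

(* Complex-valued measurable functions with finite p-norm; the proof p1 is
   carried along because the sum of two such functions is such only then. *)
Definition Lpfun_pred of (1 <= p)%E : {pred T -> R[i]} := mem [set f : T -> R[i] |
  [/\ measurable_fun setT (creal \o f),
      measurable_fun setT (cimag \o f) &
      finite_norm mu p (normc \o f)]].

Lemma Lpfun_predP f : reflect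
  [/\ measurable_fun setT (creal \o f),
      measurable_fun setT (cimag \o f) &
      finite_norm mu p (normc \o f)] (f \in Lpfun_pred p1).
Proof. by apply: (iffP idP) => [/set_mem//|h]; exact/mem_set. Qed.

Lemma measurable_normc d' (T' : measurableType d') (f : T' -> R[i]) :
  measurable_fun setT (creal \o f) ->
  measurable_fun setT (cimag \o f) ->
  measurable_fun setT (normc \o f).
Proof.
move=> mr mi; rewrite (_ : _ \o _ = fun x =>
  ((creal (f x)) ^+ 2 + (cimag (f x)) ^+ 2) `^ 2^-1).
  apply: (@measurableT_comp _ _ _ _ _ _ (@powR R ^~ 2^-1)) => //.
  by apply: measurable_funD; exact: measurable_funX.
apply/funext => x /=; rewrite powR12_sqrt ?addr_ge0 ?sqr_ge0//.
by case: (f x).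
Qed.

Lemma normc_ge0 (z : R[i]) : 0 <= normc z.
Proof. by case: z => a b; exact: sqrtr_ge0. Qed.

Lemma le_Lnorm d' (T' : measurableType d') (nu : {measure set T' -> \bar R})
    (f g : T' -> R) :
  measurable_fun setT f -> measurable_fun setT g ->
  (forall x, 0 <= f x) -> (\forall x \ae nu, f x <= g x) ->
  ('N[nu]_p[EFin \o f] <= 'N[nu]_p[EFin \o g])%E.
Proof.
move=> mf mg f0 fg; rewrite unlock /Lnorm; case: p p1 => [r| |]//; last first.
  move=> _; case: ifPn => // _; apply: le_ess_sup.
  apply: filterS fg => x fgx /=; rewrite lee_fin ger0_norm//.
  by rewrite (le_trans fgx)// ler_norm.
rewrite lee_fin => r1; have r0 : 0 <= r by rewrite (le_trans _ r1).
apply: gt0_ler_poweR.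
- by rewrite invr_ge0.
- by rewrite in_itv/= leey andbT; apply: integral_ge0 => x _; exact: powR_ge0.
- by rewrite in_itv/= leey andbT; apply: integral_ge0 => x _; exact: powR_ge0.
apply: ae_ge0_le_integral => //.
- by move=> x _; exact: poweR_ge0.
- apply: (@measurableT_comp _ _ _ _ _ _ (fun x => x `^ r)%E).
    exact: measurable_poweR.
  by apply: measurableT_comp => //; exact/measurable_EFinP.
- by move=> x _; exact: poweR_ge0.
- apply: (@measurableT_comp _ _ _ _ _ _ (fun x => x `^ r)%E).
    exact: measurable_poweR.
  by apply: measurableT_comp => //; exact/measurable_EFinP.
apply: filterS fg => x fgx _ /=; rewrite lee_fin.
apply: ge0_ler_powR => //; rewrite ?nnegrE//.
by rewrite ger0_norm// (le_trans fgx)// ler_norm.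
Qed.

Lemma Lpfun_submod_closed : submod_closed (Lpfun_pred p1).
Proof.
split=> [|c f g /Lpfun_predP[fr fi fN] /Lpfun_predP[gr gi gN]].
  apply/Lpfun_predP; split; [exact: measurable_cst|exact: measurable_cst|].
  rewrite (_ : _ \o _ = cst 0); first exact: finite_norm_cst0.
  by apply/funext => x /=; rewrite expr0n/= addr0 sqrtr0.
have hr : measurable_fun setT (creal \o (c *: f + g)).
  rewrite (_ : _ \o _ = (creal c \*: (creal \o f)) \-
      (cimag c \*: (cimag \o f)) \+ (creal \o g)).
    apply: measurable_funD => //; apply: measurable_funB.
      exact: measurable_funM.
    exact: measurable_funM.
  by apply/funext => x /=; rewrite -[(c *: f + g) x]/(c * f x + g x);
    case: c (f x) (g x) => [? ?] [? ?] [? ?].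
have hi : measurable_fun setT (cimag \o (c *: f + g)).
  rewrite (_ : _ \o _ = (creal c \*: (cimag \o f)) \+
      (cimag c \*: (creal \o f)) \+ (cimag \o g)).
    apply: measurable_funD => //; apply: measurable_funD.
      exact: measurable_funM.
    exact: measurable_funM.
  by apply/funext => x /=; rewrite -[(c *: f + g) x]/(c * f x + g x);
    case: c {hr} (f x) (g x) => [? ?] [? ?] [? ?].
apply/Lpfun_predP; split => //.
have mf : measurable_fun setT (normc \o f) by exact: measurable_normc.
have mg : measurable_fun setT (normc \o g) by exact: measurable_normc.
have fL : (normc \o f) \in Lfun mu p by apply/andP; rewrite !inE.
have gL : (normc \o g) \in Lfun mu p by apply/andP; rewrite !inE.
have : (normc c *: (normc \o f) + (normc \o g)) \in Lfun mu p.
  by have [_ ] := Lfun_submod_closed mu p1; apply.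
move=> /andP[/[!inE] mh hN].
apply: le_lt_trans hN; apply: le_Lnorm => //.
- exact: measurable_normc.
- by move=> x; exact: normc_ge0.
- apply/nearW => x /=; rewrite -[(c *: f + g) x]/(c * f x + g x).
  by rewrite (le_trans (le_normcD _ _))// ComplexField.Normc.normcM.
Qed.

HB.instance Definition _ :=
  GRing.isSubmodClosed.Build _ _ (Lpfun_pred p1) Lpfun_submod_closed.

Record Lpfun : Type :=
  MkLpfun { Lpfun_fun :> T -> R[i] ; _ : Lpfun_fun \in Lpfun_pred p1 }.
HB.instance Definition _ := [isSub for Lpfun_fun].
HB.instance Definition _ := [Choice of Lpfun by <:].
HB.instance Definition _ := [SubChoice_isSubLmodule of Lpfun by <:].

Definition Lp_eqb (f g : Lpfun) := `[< (f : T -> R[i]) = g %[ae mu] >].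

Let Lp_eqb_refl : reflexive Lp_eqb.
Proof. by move=> f; apply/asboolP; exact: ae_eq_refl. Qed.

Let Lp_eqb_sym : symmetric Lp_eqb.
Proof. by move=> f g; apply/asboolP/asboolP => h; exact: ae_eq_sym. Qed.

Let Lp_eqb_trans : transitive Lp_eqb.
Proof.
by move=> g f h /asboolP fg /asboolP gh; apply/asboolP; exact: ae_eq_trans gh.
Qed.

Canonical Lp_eqb_equiv :=
  EquivRel Lp_eqb Lp_eqb_refl Lp_eqb_sym Lp_eqb_trans.

Definition Lp : Type := {eq_quot Lp_eqb}.
HB.instance Definition _ := Choice.on Lp.
HB.instance Definition _ := EqQuotient.on Lp.

Lemma Lp_piP (f g : Lpfun) :
  \pi_Lp f = \pi_Lp g <-> (f : T -> R[i]) = g %[ae mu].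
Proof. by split=> [/eqmodP/asboolP|h]; [|apply/eqmodP/asboolP]. Qed.

Definition Lp_repr (xi : Lp) : T -> R[i] := repr xi : Lpfun.
Definition Lp_class f (fL : f \in Lpfun_pred p1) : Lp := \pi_Lp (MkLpfun fL).

Let Lp_pi_repr (f : Lpfun) :
  (repr (\pi_Lp f) : T -> R[i]) = f %[ae mu].
Proof. by apply/Lp_piP; rewrite reprK. Qed.

Let Lp_reprK (xi : Lp) : \pi_Lp (repr xi) = xi.
Proof. exact: reprK. Qed.

Let Lp_add (xi eta : Lp) : Lp := \pi_Lp (repr xi + repr eta).
Let Lp_scale (c : R[i]) (xi : Lp) : Lp := \pi_Lp (c *: repr xi).
Let Lp_opp (xi : Lp) : Lp := \pi_Lp (- repr xi).

Let Lp_addE (f g : Lpfun) : Lp_add (\pi_Lp f) (\pi_Lp g) = \pi_Lp (f + g).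
Proof.
apply/Lp_piP; apply: filterS2 (Lp_pi_repr f) (Lp_pi_repr g) => x h h' _.
by rewrite -[LHS]/(Lpfun_fun _ x + Lpfun_fun _ x) h// h'.
Qed.

Let Lp_scaleE c (f : Lpfun) : Lp_scale c (\pi_Lp f) = \pi_Lp (c *: f).
Proof.
apply/Lp_piP; apply: filterS (Lp_pi_repr f) => x h _.
by rewrite -[LHS]/(c *: Lpfun_fun _ x) h.
Qed.

Let Lp_addA : associative Lp_add.
Proof.
move=> u v w; rewrite -(Lp_reprK u) -(Lp_reprK v) -(Lp_reprK w).
by rewrite !Lp_addE addrA.
Qed.

Let Lp_addC : commutative Lp_add.
Proof. by move=> u v; rewrite -(Lp_reprK u) -(Lp_reprK v) !Lp_addE addrC. Qed.

Let Lp_add0 : left_id (\pi_Lp 0) Lp_add.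
Proof. by move=> u; rewrite -(Lp_reprK u) !Lp_addE add0r. Qed.

Let Lp_addN : left_inverse (\pi_Lp 0) Lp_opp Lp_add.
Proof. by move=> u; rewrite -[X in Lp_add _ X]Lp_reprK Lp_addE addNr. Qed.

HB.instance Definition _ := GRing.isZmodule.Build Lp
  Lp_addA Lp_addC Lp_add0 Lp_addN.

Let Lp_scaleA a b u : Lp_scale a (Lp_scale b u) = Lp_scale (a * b) u.
Proof. by rewrite -(Lp_reprK u) !Lp_scaleE scalerA. Qed.

Let Lp_scale1 : left_id 1 Lp_scale.
Proof. by move=> u; rewrite -(Lp_reprK u) !Lp_scaleE scale1r. Qed.

Let Lp_scaleDr : right_distributive Lp_scale +%R.
Proof.
move=> c u v; rewrite -[_ + _]/(Lp_add _ _) -[RHS]/(Lp_add _ _).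
by rewrite -(Lp_reprK u) -(Lp_reprK v) !(Lp_addE, Lp_scaleE) scalerDr.
Qed.

Let Lp_scaleDl u : {morph Lp_scale^~ u : a b / a + b}.
Proof.
move=> a b; rewrite -[RHS]/(Lp_add _ _).
by rewrite -(Lp_reprK u) !(Lp_addE, Lp_scaleE) scalerDl.
Qed.

HB.instance Definition _ := GRing.Zmodule_isLmodule.Build R[i] Lp
  Lp_scaleA Lp_scale1 Lp_scaleDr Lp_scaleDl.

Definition Lp_norm (xi : Lp) : R :=
  fine 'N[mu]_p[EFin \o (normc \o Lp_repr xi)].

Lemma Lp_reprP (xi : Lp) : Lp_repr xi \in Lpfun_pred p1.
Proof. by rewrite /Lp_repr; case: (repr xi). Qed.

Lemma Lp_class_repr (xi : Lp) : Lp_class (Lp_reprP xi) = xi.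
Proof.
rewrite -[RHS]Lp_reprK /Lp_class; congr (\pi_Lp _); exact/val_inj.
Qed.

Lemma Lp_repr_class f (fL : f \in Lpfun_pred p1) :
  Lp_repr (Lp_class fL) = f %[ae mu].
Proof. exact: Lp_pi_repr. Qed.

Lemma Lp_class_eq f g (fL : f \in Lpfun_pred p1) (gL : g \in Lpfun_pred p1) :
  Lp_class fL = Lp_class gL <-> f = g %[ae mu].
Proof. exact: Lp_piP. Qed.

Lemma Lp_classD f g (fL : f \in Lpfun_pred p1) (gL : g \in Lpfun_pred p1) :
  Lp_class fL + Lp_class gL = Lp_class (rpredD fL gL).
Proof.
rewrite -[LHS]/(Lp_add _ _) Lp_addE; congr (\pi_Lp _); exact/val_inj.
Qed.

Lemma Lp_classZ c f (fL : f \in Lpfun_pred p1) :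
  c *: Lp_class fL = Lp_class (rpredZ c fL).
Proof.
rewrite -[LHS]/(Lp_scale _ _) Lp_scaleE; congr (\pi_Lp _); exact/val_inj.
Qed.

Lemma Lp_norm_class f (fL : f \in Lpfun_pred p1) :
  Lp_norm (Lp_class fL) = fine 'N[mu]_p[EFin \o (normc \o f)].
Proof.
congr fine; have /Lpfun_predP[fr fi _] := fL.
have /Lpfun_predP[hr hi _] := Lp_reprP (Lp_class fL).
have /= fh := Lp_repr_class fL.
by apply/eqP; rewrite eq_le; apply/andP; split; apply: le_Lnorm;
  rewrite -?compA; do ?[exact: measurable_normc | by move=> x; exact: normc_ge0];
  apply: filterS fh => x /= ->.
Qed.

Lemma Lpfun_restrict (A : set T) f : measurable A -> f \in Lpfun_pred p1 ->
  (fun x => if x \in A then f x else 0) \in Lpfun_pred p1.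
Proof.
move=> mA /Lpfun_predP[fr fi fN].
pose g x := if x \in A then f x else 0.
have gE (h : R[i] -> R) : h 0 = 0 -> h \o g = (h \o f) \* \1_A.
  move=> h0; apply/funext => x; rewrite /g /= indicE.
  by case: (x \in A); rewrite ?mulr1// mulr0.
have gr : measurable_fun setT (creal \o g).
  rewrite gE//; apply: measurable_funM => //; exact: measurable_indic.
have gi : measurable_fun setT (cimag \o g).
  rewrite gE//; apply: measurable_funM => //; exact: measurable_indic.
apply/Lpfun_predP; split => //.
apply: le_lt_trans fN; apply: le_Lnorm.
- exact: measurable_normc.
- exact: measurable_normc.
- by move=> x; exact: normc_ge0.
- apply/nearW => x /=; case: (x \in A) => //.
  by rewrite ComplexField.Normc.normc0 normc_ge0.
Qed.

Definition Lp_proj (A : set T) (mA : measurable A) (xi : Lp) : Lp :=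
  Lp_class (Lpfun_restrict mA (Lp_reprP xi)).

Lemma Lp_proj_linear (A : set T) (mA : measurable A) : linear (Lp_proj mA).
Proof.
move=> c xi eta; rewrite -(Lp_class_repr xi) -(Lp_class_repr eta).
rewrite Lp_classZ Lp_classD /Lp_proj Lp_classZ Lp_classD; apply/Lp_class_eq.
apply: filterS3 (Lp_repr_class (Lp_reprP xi)) (Lp_repr_class (Lp_reprP eta))
  (Lp_repr_class (rpredD (rpredZ c (Lp_reprP xi)) (Lp_reprP eta))) => x h h' h'' _.
rewrite -[RHS]/(c * (if x \in A then _ else 0) + (if x \in A then _ else 0)).
by case: ifP => _; rewrite ?(h'' I) ?(h I) ?(h' I) // mulr0 addr0.
Qed.

End LpFunctions.

Section LpProduct.
Context d (T : measurableType d) (R : realType).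
Variables (mu : {sigma_finite_measure set T -> \bar R}).
Variables (p : \bar R) (p1 : (1 <= p)%E).
Implicit Types f g : T -> R[i].
Local Notation creal := (@complex.Re R).
Local Notation cimag := (@complex.Im R).

Lemma ae_fst (P : set T) :
  (\forall x \ae mu, P x) -> \forall z \ae (mu \x mu)%E, P z.1.
Proof.
move=> [N [mN N0 PN]]; exists (N `*` setT); split.
- exact: measurableX.
- transitivity (mu N * mu setT)%E; first exact: product_measure1E.
  by rewrite (N0 : mu N = 0%E) mul0e.
- by move=> z /= Pz; split => //; exact: PN.
Qed.

Lemma ae_snd (P : set T) :
  (\forall x \ae mu, P x) -> \forall z \ae (mu \x mu)%E, P z.2.
Proof.
move=> [N [mN N0 PN]]; exists (setT `*` N); split.
- exact: measurableX.
- transitivity (mu setT * mu N)%E; first exact: product_measure1E.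
  by rewrite (N0 : mu N = 0%E) mule0.
- by move=> z /= Pz; split => //; exact: PN.
Qed.

Lemma finite_norm_prod (F G : T -> R) :
  measurable_fun setT F -> measurable_fun setT G ->
  finite_norm mu p F -> finite_norm mu p G ->
  finite_norm (mu \x mu)%E p (fun z => F z.1 * G z.2).
Proof.
move=> mF mG; rewrite /finite_norm unlock /Lnorm; case: p p1 => [r| |]// hr.
  have r0 : r != 0 by rewrite gt_eqF// (lt_le_trans ltr01)// -lee_fin.
  move=> /(lty_poweRy (invr_neq0 r0)) FN /(lty_poweRy (invr_neq0 r0)) GN.
  apply: poweR_lty.
  have mpow d' (S : measurableType d') (h : S -> R) : measurable_fun setT h ->
      measurable_fun setT (fun x => (`|h x| `^ r)%:E).
    move=> mh; apply/measurable_EFinP.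
    apply: (@measurableT_comp _ _ _ _ _ _ (@powR R ^~ r)) => //.
    exact: measurableT_comp.
  have mFG : measurable_fun setT (fun z : T * T => F z.1 * G z.2).
    apply: measurable_funM.
      exact: (measurableT_comp mF measurable_fst).
    exact: (measurableT_comp mG measurable_snd).
  have -> : (\int[mu \x mu]_z (`|F z.1 * G z.2| `^ r)%:E =
      \int[mu]_x ((`|F x| `^ r)%:E * \int[mu]_y (`|G y| `^ r)%:E))%E.
    rewrite (@fubini_tonelli1 _ _ _ _ _ mu mu); last 2 first.
    - exact: mpow mFG.
    - by move=> z; exact: powR_ge0.
    apply: eq_integral => x _; rewrite /fubini_F.
    rewrite -ge0_integralZl//; last exact: mpow.
    by apply: eq_integral => y _; rewrite normrM powRM.
  rewrite ge0_integralZr//.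
  - apply: lte_mul_pinfty => //.
    + by apply: integral_ge0 => x _; rewrite lee_fin powR_ge0.
    + rewrite ge0_fin_numE//.
      by apply: integral_ge0 => x _; rewrite lee_fin powR_ge0.
  - exact: mpow.
  - by apply: integral_ge0 => x _; rewrite lee_fin powR_ge0.
have [muT|] := boolP (0 < mu setT)%E; last first.
  rewrite lt0e measure_ge0 andbT negbK => /eqP muT _ _.
  rewrite [X in (0 < X)%E](_ : _ = 0%E) ?ltxx// -setXTT.
  transitivity (mu setT * mu setT)%E; first exact: product_measure1E.
  by rewrite muT mul0e.
have absE (h : T -> R) : abse \o (EFin \o h) = EFin \o (Num.norm \o h) by [].
rewrite !absE => /ess_supr_bounded[M FM] /ess_supr_bounded[N GN].
case: ifP => // _; apply: (@le_lt_trans _ _ (M * N)%:E); last exact: ltry.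
apply/ess_supP; apply: filterS2 (ae_fst FM) (ae_snd GN) => z /= hF hG.
by rewrite lee_fin normrM ler_pM.
Qed.

Lemma Lpfun_prod f g : f \in Lpfun_pred mu p1 -> g \in Lpfun_pred mu p1 ->
  (fun z : T * T => f z.1 * g z.2) \in Lpfun_pred (mu \x mu)%E p1.
Proof.
move=> /Lpfun_predP[fr fi fN] /Lpfun_predP[gr gi gN].
have m1 h : measurable_fun setT h -> measurable_fun setT (h \o @fst T T : _ -> R).
  by move=> mh; exact: (measurableT_comp mh measurable_fst).
have m2 h : measurable_fun setT h -> measurable_fun setT (h \o @snd T T : _ -> R).
  by move=> mh; exact: (measurableT_comp mh measurable_snd).
apply/Lpfun_predP; split.
- rewrite (_ : _ \o _ =
    (((creal \o f) \o fst) \* ((creal \o g) \o snd)) \-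
    (((cimag \o f) \o fst) \* ((cimag \o g) \o snd))).
    by apply: measurable_funB; apply: measurable_funM; rewrite ?(m1, m2)//;
      do ?[exact: m1|exact: m2].
  by apply/funext => z /=; case: (f z.1) (g z.2) => [? ?] [? ?].
- rewrite (_ : _ \o _ =
    (((creal \o f) \o fst) \* ((cimag \o g) \o snd)) \+
    (((cimag \o f) \o fst) \* ((creal \o g) \o snd))).
    by apply: measurable_funD; apply: measurable_funM; do ?[exact: m1|exact: m2].
  by apply/funext => z /=; case: (f z.1) (g z.2) => [? ?] [? ?].
- rewrite (_ : _ \o _ = fun z => (normc \o f) z.1 * (normc \o g) z.2).
    by apply: finite_norm_prod => //; exact: measurable_normc.
  by apply/funext => z /=; rewrite ComplexField.Normc.normcM.
Qed.

Definition Lp_prod (xi eta : Lp mu p1) : Lp (mu \x mu)%E p1 :=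
  Lp_class (Lpfun_prod (Lp_reprP xi) (Lp_reprP eta)).

Lemma Lp_prodE f g (fL : f \in Lpfun_pred mu p1) (gL : g \in Lpfun_pred mu p1) :
  Lp_prod (Lp_class fL) (Lp_class gL) = Lp_class (Lpfun_prod fL gL).
Proof.
apply/Lp_class_eq.
apply: filterS2 (ae_fst (Lp_repr_class fL)) (ae_snd (Lp_repr_class gL)).
by move=> z /= h h' _; rewrite h// h'.
Qed.

Lemma Lp_prod_bilinear : bilinear_for
  (GRing.Scale.Law.clone _ _ *:%R _) (GRing.Scale.Law.clone _ _ *:%R _) Lp_prod.
Proof.
split=> [eta|xi] c u v.
  rewrite -(Lp_class_repr u) -(Lp_class_repr v) -(Lp_class_repr eta) /=.
  rewrite Lp_classZ Lp_classD !Lp_prodE Lp_classZ Lp_classD.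
  apply/Lp_class_eq/nearW => z _ /=.
  rewrite -[LHS]/((c * Lp_repr u z.1 + Lp_repr v z.1) * Lp_repr eta z.2).
  by rewrite mulrDl -mulrA.
rewrite -(Lp_class_repr u) -(Lp_class_repr v) -(Lp_class_repr xi) /=.
rewrite Lp_classZ Lp_classD !Lp_prodE Lp_classZ Lp_classD.
apply/Lp_class_eq/nearW => z _ /=.
rewrite -[LHS]/(Lp_repr xi z.1 * (c * Lp_repr u z.2 + Lp_repr v z.2)).
by rewrite mulrDr mulrCA.
Qed.

HB.instance Definition _ := bilinear_isBilinear.Build R[i] (Lp mu p1)
  (Lp mu p1) (Lp (mu \x mu)%E p1) _ _ Lp_prod Lp_prod_bilinear.

End LpProduct.

Section TensorMaps.
Context {K : comNzRingType}.

Definition tmap (E E' F F' : lmodType K) (f : E -> E') (g : F -> F') :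
    tensor E F -> tensor E' F' :=
  tlift (fun x y => tens (f x) (g y)).

Section Map.
Context (E E' F F' : lmodType K).
Context (f : {linear E -> E'}) (g : {linear F -> F'}).

Let B x y := tens (f x) (g y).
Let B_bilinear : bilinear_for
  (GRing.Scale.Law.clone _ _ *:%R _) (GRing.Scale.Law.clone _ _ *:%R _) B.
Proof. by split=> [y|x] c u v; rewrite /B/= linearP ?(tensDl, tensDr) ?(tensZl, tensZr). Qed.
HB.instance Definition _ := bilinear_isBilinear.Build K E F _ _ _ B B_bilinear.

Lemma tmap_tens x y : tmap f g (tens x y) = tens (f x) (g y).
Proof. exact: (tlift_tens B). Qed.

Lemma tmap_linear : linear (tmap f g).
Proof. exact: (tlift_linear B). Qed.

End Map.

Definition tmap2 (E1 E2 E3 F1 F2 F3 : lmodType K)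
    (D : E1 -> E2 -> E3) (B : F1 -> F2 -> F3)
    (u : tensor E1 F1) (v : tensor E2 F2) : tensor E3 F3 :=
  tlift (fun x1 y1 => tlift (fun x2 y2 => tens (D x1 x2) (B y1 y2)) v) u.

Section Map2.
Context (E1 E2 E3 F1 F2 F3 : lmodType K).
Context (D : {bilinear E1 -> E2 -> E3}) (B : {bilinear F1 -> F2 -> F3}).

Section Inner.
Context (x1 : E1) (y1 : F1).
Let C x2 y2 := tens (D x1 x2) (B y1 y2).
Let C_bilinear : bilinear_for
  (GRing.Scale.Law.clone _ _ *:%R _) (GRing.Scale.Law.clone _ _ *:%R _) C.
Proof.
by split=> [y|x] c u v; rewrite /C/= linearPr ?(tensDl, tensDr) ?(tensZl, tensZr).
Qed.
HB.instance Definition _ := bilinear_isBilinear.Build K E2 F2 _ _ _ C C_bilinear.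

Lemma tmap2_inner_tens x2 y2 : tlift C (tens x2 y2) = tens (D x1 x2) (B y1 y2).
Proof. exact: (tlift_tens C). Qed.

Lemma tmap2_inner_linear : linear (tlift C).
Proof. exact: (tlift_linear C). Qed.
End Inner.

Let C x1 y1 x2 y2 := tens (D x1 x2) (B y1 y2).
Let G v x1 y1 := tlift (C x1 y1) v.
Let G_bilinear v : bilinear_for
  (GRing.Scale.Law.clone _ _ *:%R _) (GRing.Scale.Law.clone _ _ *:%R _) (G v).
Proof.
split=> [y|x] c u w; rewrite /G /tlift/= scaler_sumr -big_split;
  by apply: eq_bigr => q _;
    rewrite /C/= linearPl ?(tensDl, tensDr) ?(tensZl, tensZr).
Qed.
HB.instance Definition _ v :=
  bilinear_isBilinear.Build K E1 F1 _ _ _ (G v) (G_bilinear v).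

Lemma tmap2_tens x1 y1 x2 y2 :
  tmap2 D B (tens x1 y1) (tens x2 y2) = tens (D x1 x2) (B y1 y2).
Proof.
by rewrite -[LHS]/(tlift (G _) _) (tlift_tens (G _)); exact: tmap2_inner_tens.
Qed.

Lemma tmap2_bilinear : bilinear_for
  (GRing.Scale.Law.clone _ _ *:%R _) (GRing.Scale.Law.clone _ _ *:%R _)
  (tmap2 D B).
Proof.
split=> [v|u]; first exact: (tlift_linear (G v)).
move=> c v w /=.
rewrite -[LHS]/(\sum_(q <- repr u) tlift (C q.1 q.2) (c *: v + w)).
rewrite -[tmap2 _ _ _ v]/(\sum_(q <- repr u) tlift (C q.1 q.2) v).
rewrite -[tmap2 _ _ _ w]/(\sum_(q <- repr u) tlift (C q.1 q.2) w).
rewrite scaler_sumr -big_split; apply: eq_bigr => q _.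
exact: tmap2_inner_linear.
Qed.

End Map2.
End TensorMaps.

Section Operators.
Context {R : realType}.

Definition is_seminorm (V : lmodType R[i]) (N : V -> R) :=
  (forall u v, N (u + v) <= N u + N v) /\
  (forall c u, N (c *: u) = normc c * N u).

Definition bounded_op (U V : Type) (NU : U -> R) (NV : V -> R) (f : U -> V) :=
  exists M : R, forall u, NV (f u) <= M * NU u.

Definition op_norm (U V : Type) (NU : U -> R) (NV : V -> R) (f : U -> V) : R :=
  sup [set NV (f u) | u in [set u | NU u <= 1]].

Definition bounded_biop (U V W : Type) (NU : U -> R) (NV : V -> R)
    (NW : W -> R) (f : U -> V -> W) :=
  exists M : R, forall u v, NW (f u v) <= M * NU u * NV v.

Definition contractive_biop (U V W : Type) (NU : U -> R) (NV : V -> R)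
    (NW : W -> R) (f : U -> V -> W) :=
  forall u v, NW (f u v) <= NU u * NV v.

Definition biop_norm (U V W : Type) (NU : U -> R) (NV : V -> R)
    (NW : W -> R) (f : U -> V -> W) : R :=
  sup [set NW (f u v) | u in [set u | NU u <= 1] & v in [set v | NV v <= 1]].

(* (sum_k lambda_k ^ p) ^ (1/p), resp. the maximum for p = +oo; only used for
   nonnegative lambda_k and 1 <= p, so that p = -oo does not occur *)
Definition lp_sum (p : \bar R) (s : seq R) : R :=
  match p with
  | r%:E => (\sum_(x <- s) x `^ r) `^ r^-1
  | _ => \big[Num.max/0]_(x <- s) x
  end.

End Operators.

Section MeasureSpaces.
Context d (T : measurableType d) (R : realType).
Variable mu : {measure set T -> \bar R}.

(* A `+` B is the symmetric difference; sigma-finiteness is required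
   separately, through the type of the measure *)
Definition countable_basis :=
  exists B : nat -> set T, (forall n, measurable (B n)) /\
    forall (A : set T) (e : R), measurable A -> (mu A < +oo)%E -> 0 < e ->
      exists n, (mu (A `+` B n) < e%:E)%E.

Definition atom (A : set T) :=
  [/\ measurable A, (0 < mu A)%E &
      forall B, measurable B -> B `<=` A -> mu B = 0%E \/ mu (A `\` B) = 0%E].

(* no atoms, or infinitely many of them; atoms that differ by a null set count
   as one *)
Definition convenient :=
  (forall A, ~ atom A) \/
  exists A : nat -> set T, (forall n, atom (A n)) /\
    forall m n, m <> n -> mu (A m `+` A n) <> 0%E.

End MeasureSpaces.

Section LSpaces.
Context d (T : measurableType d) (R : realType).
Variables (mu : {measure set T -> \bar R}) (p : \bar R) (p1 : (1 <= p)%E).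
Local Notation L := (Lp mu p1).
Local Notation normL := (@Lp_norm _ _ _ mu p p1).
Implicit Types E F : lmodType R[i].

Definition is_proper_isometry (I : {linear L -> L}) :=
  (forall xi, normL (I xi) = normL xi) /\
  exists (A : set T) (mA : measurable A), range I = range (Lp_proj mA : L -> L).

Definition disjoint_isometries (I J : {linear L -> L}) :=
  range I `&` range J = [set 0].

Definition Lact E (a : L -> L) : tensor L E -> tensor L E := tmap a idfun.

(* written phi_oo in the literature *)
Definition ampl E F (phi : E -> F) : tensor L E -> tensor L F :=
  tmap idfun phi.

Definition is_Lseminorm E (N : tensor L E -> R) :=
  is_seminorm N /\
  forall a : {linear L -> L}, bounded_op normL normL a ->
    forall u, N (Lact a u) <= op_norm normL normL a * N u.

Definition is_Lnorm E (N : tensor L E -> R) :=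
  is_Lseminorm N /\ forall u, N u = 0 -> u = 0.

Definition p_convex E (N : tensor L E -> R) :=
  forall (A B : set T) (mA : measurable A) (mB : measurable B),
  let P : L -> L := Lp_proj mA in
  let Q : L -> L := Lp_proj mB in
  (forall xi, P (Q xi) = 0) -> (forall xi, Q (P xi) = 0) ->
  forall u v, Lact P u = u -> Lact Q v = v ->
    N (u + v) <= lp_sum p [:: N u; N v].

Definition Lbounded E F (NE : tensor L E -> R) (NF : tensor L F -> R)
    (phi : E -> F) := bounded_op NE NF (ampl phi).

Definition Lb_norm E F (NE : tensor L E -> R) (NF : tensor L F -> R)
    (phi : E -> F) : R := op_norm NE NF (ampl phi).

End LSpaces.

Section LTensor.
Context d (T : measurableType d) (R : realType).
Variables (mu : {sigma_finite_measure set T -> \bar R}).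
Variables (p : \bar R) (p1 : (1 <= p)%E).
Local Notation L := (Lp mu p1).
Local Notation L2 := (Lp (mu \x mu)%E p1).
Local Notation normL := (@Lp_norm _ _ _ mu p p1).
Implicit Types E F : lmodType R[i].

Definition isometric_isomorphism (i : {linear L2 -> L}) :=
  (forall zeta, Lp_norm (i zeta) = Lp_norm zeta) /\ bijective i.

Variable i : {linear L2 -> L}.

Definition diamond (xi eta : L) : L := i (Lp_prod xi eta).

Lemma diamond_bilinear : bilinear_for
  (GRing.Scale.Law.clone _ _ *:%R _) (GRing.Scale.Law.clone _ _ *:%R _) diamond.
Proof.
by split=> [eta|xi] c u v; rewrite /diamond/= ?linearPl ?linearPr linearP.
Qed.

HB.instance Definition _ :=
  bilinear_isBilinear.Build R[i] L L L _ _ diamond diamond_bilinear.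

(* written B_oo in the literature *)
Definition biampl E F (G : lmodType R[i]) (B : E -> F -> G) :
  tensor L E -> tensor L F -> tensor L G := tmap2 diamond B.

Definition ldiamond E F (u : tensor L E) (v : tensor L F) :
  tensor L (tensor E F) := biampl tens u v.

Definition Lbounded2 E F (G : lmodType R[i]) (NE : tensor L E -> R)
    (NF : tensor L F -> R) (NG : tensor L G -> R) (B : E -> F -> G) :=
  bounded_biop NE NF NG (biampl B).

Definition Lcontractive2 E F (G : lmodType R[i]) (NE : tensor L E -> R)
    (NF : tensor L F -> R) (NG : tensor L G -> R) (B : E -> F -> G) :=
  contractive_biop NE NF NG (biampl B).

Definition Lb_norm2 E F (G : lmodType R[i]) (NE : tensor L E -> R)
    (NF : tensor L F -> R) (NG : tensor L G -> R) (B : E -> F -> G) : R :=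
  biop_norm NE NF NG (biampl B).

Section PLnorm.
Variables (E F : lmodType R[i]) (NE : tensor L E -> R) (NF : tensor L F -> R).

Definition pL_representation (U : tensor L (tensor E F)) (n : nat)
    (a : {linear L -> L}) (I : 'I_n -> {linear L -> L})
    (u : 'I_n -> tensor L E) (v : 'I_n -> tensor L F) :=
  [/\ bounded_op normL normL a,
      forall k, is_proper_isometry (I k),
      forall k l, k != l -> disjoint_isometries (I k) (I l) &
      U = Lact a (\sum_(k < n) Lact (I k) (ldiamond (u k) (v k)))].

(* ||u_k||^p ||v_k||^p is written (||u_k|| ||v_k||)^p. The empty representation
   n = 0 only represents U = 0, with value 0, which u_k = 0 also gives. *)
Definition pLnorm (U : tensor L (tensor E F)) : R :=
  inf [set r : R | exists n a (I : 'I_n -> {linear L -> L}) u v,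
    pL_representation U a I u v /\
    r = op_norm normL normL a * lp_sum p [seq NE (u k) * NF (v k) | k : 'I_n]].

Definition is_pconvex_tensor_product (Theta : lmodType R[i])
    (NTheta : tensor L Theta -> R) (theta : {bilinear E -> F -> Theta}) :=
  [/\ is_Lnorm NTheta,
      p_convex NTheta,
      Lcontractive2 NE NF NTheta theta &
      forall (G : lmodType R[i]) (NG : tensor L G -> R),
        is_Lnorm NG -> p_convex NG ->
        forall B : {bilinear E -> F -> G}, Lbounded2 NE NF NG B ->
        exists phi : {linear Theta -> G},
          [/\ Lbounded NTheta NG phi,
              forall x y, phi (theta x y) = B x y,
              Lb_norm NTheta NG phi = Lb_norm2 NE NF NG B &
              forall psi : {linear Theta -> G}, Lbounded NTheta NG psi ->
                (forall x y, psi (theta x y) = B x y) -> psi =1 phi]].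

End PLnorm.

End LTensor.

(* Main.v *)
(* If U and V have representations a.sum_k I_k.(u_k <> v_k) and
   b.sum_l J_l.(u'_l <> v'_l), compress the isometries I_k and J_l by isometries
   S and T of L with disjoint images, so that all of them become pairwise
   disjoint, and act with one operator that undoes S and T and weighs the two
   halves so that Hoelder's inequality is sharp: this gives the triangle
   inequality, and p-convexity in the same way. For the S I_k to be proper, S has
   to map each L_p(A) onto some L_p(B). Such S and T come from measurable maps.
   A countable basis yields f : X -> R that generates the measurable sets up to
   null sets; its values of positive mass are the atoms. On the rest, the
   distribution function of f is uniformly distributed, hence so are, after
   rescaling, its restrictions to the two halves of its range; infinitely many
   atoms are split into those of even and of odd index.

   The norm is nondegenerate because L = L (x) C is a p-convex L-space: bounded
   functionals on E and F give an L-bounded bilinear form, which is dominated by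
   ||.||_pL, and such forms separate the points of L (x) (E (x) F). *)
Require Import Defs.
From HB Require Import structures.
From mathcomp Require Import all_boot all_order all_algebra sesquilinear.
From mathcomp Require Import all_classical all_reals all_analysis.
From mathcomp Require Import measurable_realfun ess_sup_inf hoelder complex.
From mathcomp Require Import generic_quotient ring lra.

Set Implicit Arguments.
Unset Strict Implicit.
Unset Printing Implicit Defensive.
Import Order.TTheory GRing.Theory Num.Theory.
Import numFieldNormedType.Exports.

Local Open Scope classical_set_scope.
Local Open Scope ring_scope.
Local Open Scope quotient_scope.

Local Notation normc := (@ComplexField.Normc.normc _).

(** * The Hahn-Banach theorem for complex seminorms *)

(** The value of a representation is the product of an operator norm and an l_p-size. Replacing a by
    t a and every u_k by u_k / t moves a scalar between the two factors, so a representation of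
    value below al * s can be given an operator of norm at most al and a size at most s. The
    operator that undoes S and T sees its argument through two disjoint bands; hence its norm is
    that of the row (a1, a2) on the l_p-sum of two copies of L, and the choice of al and s decides
    which estimate comes out.

    S and T are not composition operators of point maps from X into X, since no such map need invert
    f. Each part of X is compared instead with a model, the real line with a uniform measure or the
    natural numbers with counting measure, by a map phi that identifies only the measure algebras.
    The operator h -> weight * (h o phi) is then an isometry of L_p of the model onto L_p of the
    part, and inverting one such operator and applying another moves a part into one of its halves.
    The weight also absorbs the passage to an equivalent finite measure, which makes distribution
    functions available. *)

Section HahnBanach.
Context {R : realType} (V : lmodType R[i]).
Implicit Types (q : V -> R) (u v : V) (t : R).
Local Notation rc := (@real_complex R).

Definition sublinear q :=
  (forall u v, q (u + v) <= q u + q v) /\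
  (forall t v, 0 <= t -> q (rc t *: v) = t * q v).

Lemma sublinear0 q : sublinear q -> q 0 = 0.
Proof. by move=> [_ /(_ 0 0 (lexx _))]; rewrite mul0r scaler0. Qed.

Lemma sublinearN q v : sublinear q -> - q (- v) <= q v.
Proof.
by move=> qs; have := qs.1 v (- v); rewrite subrr sublinear0//; lra.
Qed.

(** The largest sublinear functional below a sublinear q whose value at -y is at most - q y; where q
    is already additive along y, nothing changes. *)
Definition reduce q (y v : V) : R :=
  inf [set q (v + rc t *: y) - t * q y | t in [set t | 0 <= t]].

Lemma reduce_lb q y v : sublinear q ->
  lbound [set q (v + rc t *: y) - t * q y | t in [set t | 0 <= t]] (- q (- v)).
Proof.
move=> qs _ [t /= t0 <-].
have := qs.1 (v + rc t *: y) (- v).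
by rewrite addrC addKr qs.2//; lra.
Qed.

Lemma reduce_le q y v t : sublinear q -> 0 <= t ->
  reduce q y v <= q (v + rc t *: y) - t * q y.
Proof.
move=> qs t0; apply: ge_inf; last by exists t.
by exists (- q (- v)); exact: reduce_lb.
Qed.

Lemma le_reduce q y v (r : R) :
  (forall t, 0 <= t -> r <= q (v + rc t *: y) - t * q y) -> r <= reduce q y v.
Proof.
move=> h; apply: lb_le_inf; first by exists (q (v + rc 0 *: y) - 0 * q y), 0 => /=.
by move=> _ [t /= t0 <-]; exact: h.
Qed.

Lemma reduce_le_id q y v : sublinear q -> reduce q y v <= q v.
Proof. by move=> qs; have := reduce_le y v qs (lexx 0); rewrite mul0r scale0r addr0 subr0. Qed.

Lemma reduceN q y : sublinear q -> reduce q y (- y) <= - q y.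
Proof.
move=> qs; have := reduce_le y (- y) qs ler01.
by rewrite scale1r addNr mul1r sublinear0// add0r.
Qed.

Lemma reduce_sublinear q y : sublinear q -> sublinear (reduce q y).
Proof.
move=> qs; split=> [u v|t v].
  rewrite -lerBlDr; apply: le_reduce => t t0.
  rewrite lerBlDr -lerBlDl; apply: le_reduce => s s0.
  rewrite lerBlDl; apply: (le_trans (reduce_le y (u + v) qs (addr_ge0 t0 s0))).
  have := qs.1 (u + rc t *: y) (v + rc s *: y).
  have -> : u + rc t *: y + (v + rc s *: y) = u + v + rc (t + s) *: y.
    by rewrite addrACA -scalerDl -rmorphD.
  lra.
rewrite le_eqVlt => /predU1P[<-|t0].
  rewrite mul0r scale0r; apply/le_anti/andP; split.
    by rewrite -[leRHS](sublinear0 qs) reduce_le_id.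
  by apply: le_reduce => s s0; rewrite add0r qs.2// subrr.
apply/le_anti/andP; split.
  rewrite -ler_pdivrMl//; apply: le_reduce => s s0; rewrite ler_pdivrMl//.
  apply: (le_trans (reduce_le y _ qs (mulr_ge0 (ltW t0) s0))).
  by rewrite (rmorphM rc) -scalerA -scalerDr (qs.2 _ _ (ltW t0)) mulrBr mulrA.
apply: le_reduce => s s0; rewrite -ler_pdivlMl//.
have st : 0 <= t^-1 * s by rewrite mulr_ge0// invr_ge0 ltW.
apply: (le_trans (reduce_le y _ qs st)).
have tn0 : t != 0 by rewrite gt_eqF.
rewrite -(ler_pM2l t0) mulrBr -(qs.2 _ _ (ltW t0)).
rewrite scalerDr scalerA -(rmorphM rc) (mulVKf tn0 s).
by rewrite !mulrA divff// !mul1r.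
Qed.

Definition sublinear_below N := {q : V -> R | sublinear q /\ forall v, q v <= N v}.

(** Zorn's lemma. A chain is bounded below by its pointwise infimum, which is finite because every
    sublinear q below N satisfies - N (- v) <= q v, and subadditive because two members of a chain
    are comparable. *)
Lemma minimal_sublinear N : sublinear N -> exists q, [/\ sublinear q,
  (forall v, q v <= N v) &
  forall q', sublinear q' -> (forall v, q' v <= q v) -> q' = q].
Proof.
move=> Ns; pose T := sublinear_below N.
pose Q (x : T) := sval x.
have QN (x : T) v : - N (- v) <= Q x v.
  apply: le_trans (sublinearN v (svalP x).1); rewrite lerN2.
  exact: (svalP x).2.
(* The order is reversed, so that a maximal element is a minimal functional. *)
pose Rel (x y : T) := `[< forall v, Q y v <= Q x v >].
have [||||m mmax] := @Zorn T Rel.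
- by move=> x; apply/asboolP.
- move=> y x z /asboolP xy /asboolP yz; apply/asboolP => v.
  exact: le_trans (yz v) (xy v).
- move=> x y /asboolP xy /asboolP yx; case: x y xy yx => [x hx] [y hy] /= xy yx.
  apply: eq_exist; apply/funext => v.
  by apply/le_anti; rewrite xy yx.
- move=> A totA; have [[a Aa]|A0] := pselect (A !=set0); last first.
    exists (exist _ N (conj Ns (fun=> lexx _))) => s As.
    by exfalso; apply: A0; exists s.
  pose q v := inf [set Q x v | x in A].
  have qle x v : A x -> q v <= Q x v.
    move=> Ax; apply: ge_inf; last by exists x.
    by exists (- N (- v)) => _ [z _ <-].
  have le_q v r : (forall x, A x -> r <= Q x v) -> r <= q v.
    move=> h; apply: lb_le_inf; first by exists (Q a v), a.
    by move=> _ [x Ax <-]; exact: h.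
  have qs : sublinear q.
    split=> [u v|t v t0].
      rewrite -lerBlDr; apply: (le_q _ _) => x Ax; rewrite lerBlDr -lerBlDl.
      apply: (le_q v) => y Ay; rewrite lerBlDl.
      have [/asboolP xy|/asboolP yx] := totA _ _ Ax Ay.
        apply: (le_trans (qle y _ Ay)); apply: (le_trans ((svalP y).1.1 _ _)).
        by rewrite lerD2r; exact: xy.
      apply: (le_trans (qle x _ Ax)); apply: (le_trans ((svalP x).1.1 _ _)).
      by rewrite lerD2l; exact: yx.
    move: t0; rewrite le_eqVlt => /predU1P[<-|t0].
      rewrite mul0r scale0r; apply/le_anti/andP; split.
        by apply: (le_trans (qle a _ Aa)); rewrite /Q sublinear0//; have [[]] := svalP a.
      by apply: (le_q _ _) => x Ax; rewrite /Q sublinear0//; have [[]] := svalP x.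
    have E x : Q x (rc t *: v) = t * Q x v by rewrite /Q (svalP x).1.2// ltW.
    apply/le_anti/andP; split.
      rewrite -ler_pdivrMl//; apply: (le_q _ _) => x Ax.
      by rewrite ler_pdivrMl// -E; exact: qle.
    by apply: (le_q _ _) => x Ax; rewrite E ler_pM2l//; exact: qle.
  have qN v : q v <= N v by apply: (le_trans (qle a _ Aa)); exact: (svalP a).2.
  exists (exist _ q (conj qs qN)) => s As; apply/asboolP => v /=.
  exact: qle.
- exists (Q m); split; [exact: (svalP m).1|exact: (svalP m).2|].
move=> q' q's q'm.
have q'N v : q' v <= N v by apply: le_trans (q'm v) _; exact: (svalP m).2.
have /asboolP := mmax (exist _ q' (conj q's q'N)).
have h : Rel m (exist _ q' (conj q's q'N)) by apply/asboolP.
by move=> _; rewrite -[q']/(Q (exist _ q' (conj q's q'N))) (mmax _ h).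
Qed.

(** A minimal sublinear functional equals its own reduction along every v, which forces additivity.
    Reducing N along v0 beforehand pins the value at v0, since it leaves at most - N v0 at - v0. *)
Lemma real_hahn_banach N v0 : sublinear N -> exists r : V -> R,
  [/\ forall u v, r (u + v) = r u + r v,
      forall t v, r (rc t *: v) = t * r v,
      forall v, r v <= N v & r v0 = N v0].
Proof.
move=> Ns; have N's := reduce_sublinear v0 Ns.
have [q [qs qN' qmin]] := minimal_sublinear N's.
have qN v : q v <= N v by apply: le_trans (qN' v) (reduce_le_id _ _ Ns).
have qD u v : q (u + v) = q u + q v.
  apply/le_anti/andP; split; first exact: qs.1.
  have qE := qmin _ (reduce_sublinear v qs) (fun u => reduce_le_id v u qs).
  have := reduce_le v u qs ler01; rewrite qE scale1r mul1r; lra.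
have qNN v : q (- v) = - q v.
  by apply/eqP; rewrite eq_sym -subr_eq0 -opprD -qD subrr sublinear0// oppr0.
exists q; split => //.
- move=> t v; have [/qs.2->//|t0] := leP 0 t.
  by rewrite -[in LHS](opprK t) rmorphN scaleNr qNN qs.2 ?oppr_ge0 ?ltW// mulNr opprK.
- apply/le_anti/andP; split => //.
  have := le_trans (qN' (- v0)) (reduceN v0 Ns); rewrite qNN; lra.
Qed.

Lemma normc_rc t : 0 <= t -> normc (rc t) = t.
Proof. by move=> t0; rewrite /= expr0n/= addr0 sqrtr_sqr ger0_norm. Qed.

Lemma normcN1 : normc (-1 : R[i]) = 1.
Proof. by rewrite /= oppr0 expr0n/= addr0 sqrrN expr1n sqrtr1. Qed.

Lemma is_seminorm_sublinear N : is_seminorm N -> sublinear N.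
Proof. by move=> [ND NZ]; split=> // t v t0; rewrite NZ normc_rc. Qed.

Theorem hahn_banach N v0 : is_seminorm N -> exists phi : {linear V -> R[i]^o},
  (forall v, normc (phi v) <= N v) /\ phi v0 = rc (N v0).
Proof.
move=> Nsn; have [r [rD rZ rN r0]] := real_hahn_banach v0 (is_seminorm_sublinear Nsn).
(* The complex-linear functional with real part r. *)
pose f (v : V) : R[i]^o := (r v +i* - r ('i%C *: v))%C.
have rNN v : r (- v) = - r v by rewrite -mulN1r -(rZ (-1)) rmorphN rmorph1 scaleN1r.
have flin : linear f.
  move=> [a b] u v.
  have cE : (a +i* b)%C = rc a + rc b * 'i%C.
    by rewrite mulrC; exact: complexE.
  have -> : (a +i* b)%C *: u + v = rc a *: u + rc b *: ('i%C *: u) + v.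
    by rewrite cE scalerDl -scalerA.
  have iE : 'i%C *: (rc a *: u + rc b *: ('i%C *: u) + v) =
     rc a *: ('i%C *: u) + rc (- b) *: u + 'i%C *: v.
    rewrite !scalerDr; congr (_ + _ + _).
      by rewrite !scalerA mulrC.
    rewrite !scalerA mulrAC -expr2 sqr_i (rmorphN rc).
    by rewrite mulN1r.
  rewrite /f iE !rD !rZ.
  rewrite -[RHS]/((_ +i* _)%C * (_ +i* _)%C + (_ +i* _)%C).
  by apply/eqP; rewrite eq_complex /=; apply/andP; split; apply/eqP; ring.
pose F : {linear V -> R[i]^o} := HB.pack f (GRing.isLinear.Build _ _ _ _ f flin).
have FN v : normc (F v) <= N v.
  have [Fv0|Fv0] := eqVneq (F v) 0.
    rewrite Fv0 ComplexField.Normc.normc0.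
    have := Nsn.1 v (- v); rewrite subrr -scaleN1r Nsn.2.
    rewrite (sublinear0 (is_seminorm_sublinear Nsn)) normcN1; lra.
  have n0 : normc (F v) != 0.
    by apply: contra Fv0 => /eqP/ComplexField.Normc.eq0_normc ->.
  (* A unimodular c rotates F v onto the positive axis, where F coincides with its real part and the
     real bound applies. *)
  pose c : R[i] := rc (normc (F v)) / F v.
  have cF : F (c *: v) = rc (normc (F v)).
    by rewrite linearZ; exact: divfK.
  have c1 : normc c = 1.
    rewrite /c ComplexField.Normc.normcM ComplexField.Normc.normcV.
    by rewrite normc_rc ?normc_ge0// divff.
  have := rN (c *: v); rewrite Nsn.2 c1 mul1r.
  have -> : r (c *: v) = complex.Re (F (c *: v)) by [].
  by rewrite cF.
exists F; split=> //.
have := FN v0; rewrite /= r0 => h.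
(* The real part at v0 is already N v0 and the modulus is at most N v0, so no imaginary part is
   left. *)
rewrite /f r0; suff -> : r ('i%C *: v0) = 0 by rewrite oppr0.
have N0 : 0 <= N v0 by apply: le_trans h; exact: sqrtr_ge0.
have : N v0 ^+ 2 + (- r ('i%C *: v0)) ^+ 2 <= N v0 ^+ 2.
  rewrite -ler_sqrt ?sqr_ge0// (sqrtr_sqr (N v0)) ger0_norm//.
move=> h2; have : (r ('i%C *: v0)) ^+ 2 <= 0 by rewrite sqrrN in h2; lra.
by move=> h3; apply/eqP; rewrite -sqrf_eq0 eq_le sqr_ge0 andbT.
Qed.

End HahnBanach.

(** * Hoelder's inequality for finite sums *)

Section LpSum.
Context {R : realType}.
Implicit Types (p : \bar R) (s t : seq R).

Lemma powRVK (r z : R) : r != 0 -> 0 <= z -> (z `^ r^-1) `^ r = z.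
Proof. by move=> r0 z0; rewrite -powRrM mulVf// powRr1. Qed.

Lemma powRKV (r z : R) : r != 0 -> 0 <= z -> (z `^ r) `^ r^-1 = z.
Proof. by move=> r0 z0; rewrite -powRrM mulfV// powRr1. Qed.

Lemma powR_div (r x y : R) : 0 <= x -> 0 <= y -> (x / y) `^ r = x `^ r / y `^ r.
Proof.
move=> x0 y0; rewrite powRM ?invr_ge0// -(powR_inv1 y0) -powRrM mulN1r powRN//.
Qed.

Lemma lp_sum_ge0 p s : 0 <= lp_sum p s.
Proof.
case: p => [r||]; first exact: powR_ge0;
  by rewrite /lp_sum; elim: s => [|x s IHs]; rewrite ?big_nil// big_cons le_max IHs orbT.
Qed.

Lemma lp_sum_nil p : (1 <= p)%E -> lp_sum p [::] = 0.
Proof.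
case: p => [r||] p1; rewrite /lp_sum ?big_nil// powR0// invr_neq0//.
by rewrite gt_eqF// (lt_le_trans ltr01)// -lee_fin.
Qed.

Lemma lp_sum_seq1 p (x : R) : (1 <= p)%E -> 0 <= x -> lp_sum p [:: x] = x.
Proof.
case: p => [r||] p1 x0; rewrite /lp_sum ?big_cons ?big_nil ?(max_l x0)//.
have r0 : r != 0 by rewrite gt_eqF// (lt_le_trans ltr01)// -lee_fin.
by rewrite addr0 -powRrM mulfV// powRr1.
Qed.

Lemma lp_sum2r (r : R) (x y : R) :
  lp_sum r%:E [:: x; y] = (x `^ r + y `^ r) `^ r^-1.
Proof. by rewrite /lp_sum !big_cons big_nil addr0. Qed.

Lemma lp_sum2y (x y : R) : 0 <= y ->
  lp_sum +oo%E [:: x; y] = Num.max x y.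
Proof. by move=> y0; rewrite /lp_sum !big_cons big_nil (max_l y0). Qed.

Lemma lp_sum_cat p s t : (1 <= p)%E ->
  lp_sum p (s ++ t) = lp_sum p [:: lp_sum p s; lp_sum p t].
Proof.
case: p => [r||] p1; last by have := p1; rewrite leeNy_eq.
  have r0 : r != 0 by rewrite gt_eqF// (lt_le_trans ltr01)// -lee_fin.
  have K u : (lp_sum r%:E u) `^ r = \sum_(x <- u) x `^ r.
    by rewrite /lp_sum -powRrM mulVf// powRr1// sumr_ge0// => x _; exact: powR_ge0.
  by rewrite lp_sum2r !K /lp_sum big_cat.
have h u : 0 <= \big[Num.max/0]_(x <- u) x := lp_sum_ge0 +oo u.
rewrite lp_sum2y ?lp_sum_ge0// /lp_sum.
elim: s => [|x s IHs]; first by rewrite big_nil max_r// h.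
by rewrite /= !big_cons IHs maxA.
Qed.

Lemma lp_sum2_mono p (x y x' y' : R) : (1 <= p)%E ->
  0 <= x <= x' -> 0 <= y <= y' -> lp_sum p [:: x; y] <= lp_sum p [:: x'; y'].
Proof.
move=> p1 /andP[x0 xx] /andP[y0 yy].
case: p p1 => [r||] p1; rewrite /lp_sum !big_cons big_nil; last first.
- by have := p1; rewrite leeNy_eq.
- rewrite ge_max le_max xx/= ge_max !le_max yy/= lexx !orbT.
  by [].
have r1 : 1 <= r by rewrite -lee_fin.
have r0 : 0 <= r by rewrite (le_trans ler01).
rewrite !addr0; apply: ge0_ler_powR; rewrite ?nnegrE ?addr_ge0 ?powR_ge0 ?invr_ge0//.
by apply: lerD; apply: ge0_ler_powR; rewrite ?nnegrE ?(le_trans x0 xx) ?(le_trans y0 yy).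
Qed.

Lemma lp_sumZ p (c : R) s : (1 <= p)%E -> 0 <= c -> all (>= 0) s ->
  lp_sum p [seq c * x | x <- s] = c * lp_sum p s.
Proof.
case: p => [r||] p1 c0 s0; last by have := p1; rewrite leeNy_eq.
  have r0 : r != 0 by rewrite gt_eqF// (lt_le_trans ltr01)// -lee_fin.
  rewrite /lp_sum big_map.
  have -> : \sum_(x <- s) (c * x) `^ r = c `^ r * \sum_(x <- s) x `^ r.
    rewrite mulr_sumr !big_seq; apply: eq_bigr => x xs.
    by rewrite powRM//; exact: (allP s0).
  rewrite powRM ?powR_ge0//; last by apply: sumr_ge0 => x _; exact: powR_ge0.
  by rewrite -powRrM mulfV// powRr1.
rewrite /lp_sum; elim: s s0 => [|x s IHs] /= s0; first by rewrite !big_nil mulr0.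
by move/andP: s0 => [x0 s0]; rewrite !big_cons IHs// maxr_pMr.
Qed.

(* Split r = alpha * s so that the dual weights alpha and the masses s give
   equality in Hoelder's inequality: s = r^(1/p), alpha = r^(1-1/p). *)
Lemma lp_sum_hoelder p (r1 r2 : R) : (1 <= p)%E -> 0 < r1 -> 0 < r2 ->
  exists a1 s1 a2 s2 : R, [/\ [/\ 0 < a1, 0 < s1, 0 < a2 & 0 < s2],
    a1 * s1 = r1, a2 * s2 = r2 &
    forall x y, 0 <= x -> 0 <= y ->
    (a1 * x + a2 * y) * lp_sum p [:: s1; s2] <= (r1 + r2) * lp_sum p [:: x; y]].
Proof.
move=> p1 h1 h2; case: p p1 => [r||] p1; last by have := p1; rewrite leeNy_eq.
  have re1 : 1 <= r by rewrite -lee_fin.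
  have rgt0 : 0 < r by rewrite (lt_le_trans ltr01).
  have r0 : r != 0 by rewrite gt_eqF.
  have s10 : 0 < r1 `^ r^-1 by rewrite powR_gt0.
  have s20 : 0 < r2 `^ r^-1 by rewrite powR_gt0.
  exists (r1 / r1 `^ r^-1), (r1 `^ r^-1), (r2 / r2 `^ r^-1), (r2 `^ r^-1).
  split; rewrite ?divfK ?gt_eqF//; first by rewrite !divr_gt0.
  move=> x y x0 y0; rewrite !lp_sum2r.
  rewrite (powRVK r0 (ltW h1)) (powRVK r0 (ltW h2)).
  set s := r1 + r2; have s0 : 0 < s by rewrite addr_gt0.
  set X := x / r1 `^ r^-1; set Y := y / r2 `^ r^-1.
  have X0 : 0 <= X by rewrite divr_ge0// ltW.
  have Y0 : 0 <= Y by rewrite divr_ge0// ltW.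
  have -> : r1 / r1 `^ r^-1 * x + r2 / r2 `^ r^-1 * y = r1 * X + r2 * Y.
    by rewrite /X /Y; ring.
  have XE : r1 * X `^ r = x `^ r.
    rewrite /X (powR_div r x0 (powR_ge0 _ _)) (powRVK r0 (ltW h1)).
    by rewrite mulrCA mulfV ?gt_eqF// mulr1.
  have YE : r2 * Y `^ r = y `^ r.
    rewrite /Y (powR_div r y0 (powR_ge0 _ _)) (powRVK r0 (ltW h2)).
    by rewrite mulrCA mulfV ?gt_eqF// mulr1.
  have rE (u v : R) : (r1 * u + r2 * v) / s = r1 / s * u + r2 / s * v.
    by rewrite mulrDl !(mulrAC _ _ s^-1).
  (* Jensen's inequality for t -> t^r with the weights r1 / s and r2 / s. *)
  have cvx : ((r1 * X + r2 * Y) / s) `^ r <= (r1 * X `^ r + r2 * Y `^ r) / s.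
    have t01 : 0 <= r1 / s <= 1.
      by rewrite divr_ge0 ?(ltW h1) ?(ltW s0)//= ler_pdivrMr// mul1r lerDl ltW.
    have := convex_powR re1 (Itv01 (andP t01).1 (andP t01).2).
    move=> /(_ X Y); rewrite !inE/= !in_itv/= !andbT => /(_ X0 Y0).
    rewrite !convRE /unstable.onem /=.
    have tE : 1 - r1 / s = r2 / s by rewrite -{1}(divff (lt0r_neq0 s0)) -mulrBl /s addrC addKr.
    rewrite tE rE [X in X `^ _ <= _ -> _](_ : _ = r1 / s * X + r2 / s * Y) ?rE//.
    by rewrite -[r2 / s]tE -[LHS]convRE.
  rewrite XE YE in cvx.
  set W := (x `^ r + y `^ r) `^ r^-1; have W0 : 0 <= W by exact: powR_ge0.
  set A := (r1 * X + r2 * Y) / s in cvx.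
  have A0 : 0 <= A by rewrite divr_ge0 ?(ltW s0)// addr_ge0// mulr_ge0// ltW.
  have : A <= W / s `^ r^-1.
    rewrite -(powRKV r0 A0).
    have -> : W / s `^ r^-1 = ((x `^ r + y `^ r) / s) `^ r^-1.
      by rewrite (powR_div r^-1 (addr_ge0 (powR_ge0 x r) (powR_ge0 y r)) (ltW s0)).
    have h0 : 0 <= (x `^ r + y `^ r) / s by rewrite divr_ge0 ?(ltW s0)// addr_ge0 ?powR_ge0.
    by apply: ge0_ler_powR; rewrite ?nnegrE ?invr_ge0 ?powR_ge0 ?(ltW rgt0).
  by rewrite /A ler_pdivlMr ?powR_gt0// (mulrAC _ s^-1) ler_pdivrMr// (mulrC W).
(* For p = oo both masses are 1 and the dual weights carry r1 and r2. *)
exists r1, 1, r2, 1; rewrite !mulr1; split => // x y x0 y0.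
rewrite /lp_sum !big_cons !big_nil (max_l ler01) maxxx mulr1 (max_l y0) mulrDl.
by apply: lerD; rewrite ler_pM2l// le_max lexx// orbT.
Qed.

End LpSum.

(** * The space Lp *)

Section LpNorm.
Context d (T : measurableType d) (R : realType) (mu : {measure set T -> \bar R}).

Section AnyExponent.
Variables (p : \bar R) (p1 : (1 <= p)%E).
Local Notation L := (Lp mu p1).
Implicit Types xi eta : L.

Lemma Lp_eqP xi eta :
  xi = eta <-> Lp_repr xi = Lp_repr eta %[ae mu].
Proof.
rewrite -{1}(Lp_class_repr xi) -{1}(Lp_class_repr eta).
exact: Lp_class_eq.
Qed.

Lemma Lp_reprD xi eta :
  \forall x \ae mu, Lp_repr (xi + eta) x = Lp_repr xi x + Lp_repr eta x.
Proof.
have := Lp_repr_class (rpredD (Lp_reprP xi) (Lp_reprP eta)).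
by rewrite -Lp_classD !Lp_class_repr; apply: filterS => x /(_ I) ->.
Qed.

Lemma Lp_reprZ c xi : \forall x \ae mu, Lp_repr (c *: xi) x = c * Lp_repr xi x.
Proof.
have := Lp_repr_class (rpredZ c (Lp_reprP xi)).
by rewrite -Lp_classZ !Lp_class_repr; apply: filterS => x /(_ I) ->.
Qed.

Lemma Lp_repr0 : \forall x \ae mu, Lp_repr (0 : L) x = 0.
Proof.
rewrite -(scale0r (0 : L)); apply: filterS (Lp_reprZ 0 0) => x ->.
by rewrite mul0r.
Qed.

Lemma Lp_repr_proj (A : set T) (mA : measurable A) xi :
  \forall x \ae mu, Lp_repr (Lp_proj mA xi) x = if x \in A then Lp_repr xi x else 0.
Proof.
by apply: filterS (Lp_repr_class (Lpfun_restrict mA (Lp_reprP xi))) => x /(_ I).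
Qed.

Lemma Lp_projI (A B : set T) (mA : measurable A) (mB : measurable B)
    (mAB : measurable (A `&` B)) xi :
  Lp_proj mA (Lp_proj mB xi) = Lp_proj mAB xi.
Proof.
apply/Lp_eqP; apply: filterS3 (Lp_repr_proj mA (Lp_proj mB xi))
  (Lp_repr_proj mB xi) (Lp_repr_proj mAB xi) => x -> -> -> _.
by rewrite in_setI; case: (x \in A).
Qed.

Lemma Lp_proj_ext (A B : set T) (mA : measurable A) (mB : measurable B) xi :
  A = B -> Lp_proj mA xi = Lp_proj mB xi.
Proof.
move=> AB; subst B; apply/Lp_eqP.
by apply: filterS2 (Lp_repr_proj mA xi) (Lp_repr_proj mB xi) => x -> -> _.
Qed.

Lemma Lp_proj_idem (A : set T) (mA : measurable A) xi :
  Lp_proj mA (Lp_proj mA xi) = Lp_proj mA xi.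
Proof.
rewrite (Lp_projI mA mA (measurableI _ _ mA mA)).
by apply: Lp_proj_ext; rewrite setIid.
Qed.

Lemma Lp_projT xi : Lp_proj measurableT xi = xi.
Proof.
apply/Lp_eqP; apply: filterS (Lp_repr_proj measurableT xi) => x -> _.
by rewrite in_setT.
Qed.

Lemma Lp_proj0 (A : set T) (mA : measurable A) : mu A = 0%E ->
  forall xi, Lp_proj mA xi = 0.
Proof.
move=> A0 xi; apply/Lp_eqP.
have nA : \forall x \ae mu, ~ A x.
  exists A; split => // x /= /contrapT.
  exact.
apply: filterS3 nA (Lp_repr_proj mA xi) Lp_repr0 => x nAx -> -> _.
by rewrite memNset.
Qed.

Lemma measurable_Lp_repr xi : measurable_fun setT (normc \o Lp_repr xi).
Proof.
by have /Lpfun_predP[mr mi _] := Lp_reprP xi; apply: measurable_normc.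
Qed.

Lemma Lp_normE xi :
  (Lp_norm xi)%:E = ('N[mu]_p[EFin \o (normc \o Lp_repr xi)])%E.
Proof.
have /Lpfun_predP[_ _ h] := Lp_reprP xi.
by rewrite fineK// ge0_fin_numE ?Lnorm_ge0.
Qed.

Lemma Lp_norm_ge0 xi : 0 <= Lp_norm xi.
Proof. by rewrite -lee_fin Lp_normE Lnorm_ge0. Qed.

Lemma Lp_norm_mono xi eta :
  (\forall x \ae mu, normc (Lp_repr xi x) <= normc (Lp_repr eta x)) ->
  Lp_norm xi <= Lp_norm eta.
Proof.
move=> h; rewrite -lee_fin !Lp_normE; apply: le_Lnorm => //.
- exact: measurable_Lp_repr.
- exact: measurable_Lp_repr.
- by move=> x; exact: normc_ge0.
Qed.

Lemma Lp_proj_norm (A : set T) (mA : measurable A) xi :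
  Lp_norm (Lp_proj mA xi) <= Lp_norm xi.
Proof.
apply: Lp_norm_mono; apply: filterS (Lp_repr_proj mA xi) => x ->.
by case: ifP => // _; rewrite ComplexField.Normc.normc0 normc_ge0.
Qed.

Lemma Lp_normcL xi : (normc \o Lp_repr xi) \in Lfun mu p.
Proof.
have /Lpfun_predP[_ _ h] := Lp_reprP xi.
by apply/andP; rewrite !inE; split => //; exact: measurable_Lp_repr.
Qed.

Lemma Lp_norm_seminorm : is_seminorm (@Lp_norm _ _ _ mu p p1).
Proof.
split=> [xi eta|c xi].
  rewrite -lee_fin EFinD !Lp_normE.
  apply: (@le_trans _ _ ('N[mu]_p[EFin \o ((normc \o Lp_repr xi) \+ (normc \o Lp_repr eta))%R])%E).
    apply: le_Lnorm => //.
    - exact: measurable_Lp_repr.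
    - by apply: measurable_funD; exact: measurable_Lp_repr.
    - by move=> x; exact: normc_ge0.
    - by apply: filterS (Lp_reprD xi eta) => x /= ->; exact: le_normcD.
  exact: (eminkowski mu (measurable_Lp_repr xi) (measurable_Lp_repr eta) p1).
apply/EFin_inj; rewrite EFinM !Lp_normE.
have E : ('N[mu]_p[EFin \o (normc \o Lp_repr (c *: xi))] =
  'N[mu]_p[EFin \o (fun x => normc c * (normc \o Lp_repr xi) x)%R])%E.
  apply/le_anti/andP; split; apply: le_Lnorm => //;
    do ?[exact: measurable_Lp_repr | by move=> x; rewrite ?mulr_ge0// normc_ge0
     | by apply: measurable_funM => //; exact: measurable_Lp_repr];
    by apply: filterS (Lp_reprZ c xi) => x /= ->; rewrite ComplexField.Normc.normcM.
rewrite E.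
pose f : LfunType mu p1 := Lfun_Sub p1 (Lp_normcL xi).
have := LnormZ f (normc c); rewrite ger0_norm ?normc_ge0// => <-.
Qed.

Lemma Lp_norm_eq0 xi : Lp_norm xi = 0 -> xi = 0.
Proof.
move=> h; have := Lp_normE xi; rewrite h => /esym.
have p0 : (0 < p)%E by rewrite (lt_le_trans _ p1)// lte01.
have mr := measurable_Lp_repr xi.
move=> /(Lnorm_eq0_eq0 (iffRL (measurable_EFinP _ _) mr) p0) h0; apply/Lp_eqP; apply: filterS2 h0 Lp_repr0 => x /(_ I)/= + -> _.
by move=> [/ComplexField.Normc.eq0_normc].
Qed.

End AnyExponent.

Lemma Lp_norm_powR (r : R) (p1 : (1 <= r%:E)%E) (xi : Lp mu p1) :
  ((Lp_norm xi `^ r)%:E = \int[mu]_x (normc (Lp_repr xi x) `^ r)%:E)%E.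
Proof.
have r0 : r != 0 by rewrite gt_eqF// (lt_le_trans ltr01)// -lee_fin.
rewrite -(poweR_EFin (Lp_norm xi) r) Lp_normE (poweR_Lnorm mu _ r0); apply: eq_integral => x _ /=.
by rewrite ger0_norm ?normc_ge0.
Qed.

Lemma Lp_norm_ley (p1 : (1 <= +oo :> \bar R)%E) (xi : Lp mu p1) (M : R) :
  0 <= M -> Lp_norm xi <= M <-> \forall x \ae mu, normc (Lp_repr xi x) <= M.
Proof.
move=> M0; rewrite -lee_fin Lp_normE unlock; case: ifPn => [muT|].
  split=> [/ess_supP|h].
    by apply: filterS => x /=; rewrite lee_fin ger0_norm ?normc_ge0.
  apply/ess_supP; apply: filterS h => x /=.
  by rewrite lee_fin ger0_norm ?normc_ge0.
(* On a null space the L_oo-norm is 0 by convention, and every property holds almost everywhere. *)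
rewrite lee_fin M0 -leNgt measure_le0 => /eqP muT; split => // _.
by exists setT; split.
Qed.

(** At almost every point one of the two functions vanishes. Hence the r-th powers of the moduli add
    pointwise, and for p = oo the essential suprema over A and over its complement are compared
    separately. *)
Lemma Lp_norm_split (p : \bar R) (p1 : (1 <= p)%E) (A : set T)
    (mA : measurable A) (xi eta : Lp mu p1) :
  Lp_proj mA xi = xi -> Lp_proj mA eta = 0 ->
  Lp_norm (xi + eta) = lp_sum p [:: Lp_norm xi; Lp_norm eta].
Proof.
case: p p1 xi eta => [r||] p1 xi eta Axi Aeta; [| |by have := p1; rewrite leeNy_eq].
- have r1 : 1 <= r by rewrite -lee_fin.
  have r0 : r != 0 by rewrite gt_eqF// (lt_le_trans ltr01).
  have D := Lp_reprD xi eta.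
  have := Lp_repr_proj mA xi; rewrite Axi => hx.
  have := Lp_repr_proj mA eta; rewrite Aeta => hy.
  have {}hy : \forall x \ae mu, (if x \in A then Lp_repr eta x else 0) = 0.
    by apply: filterS2 hy (Lp_repr0 p1) => x <- ->.
  rewrite lp_sum2r.
  suff -> : Lp_norm xi `^ r + Lp_norm eta `^ r = Lp_norm (xi + eta) `^ r.
    by rewrite -powRrM mulfV// powRr1// Lp_norm_ge0.
  apply/EFin_inj; rewrite EFinD !Lp_norm_powR.
  have mf (z : Lp mu p1) : measurable_fun setT (fun x => (normc (Lp_repr z x) `^ r)%:E).
    apply/measurable_EFinP; apply: (@measurableT_comp _ _ _ _ _ _ (@powR R ^~ r)) => //.
    exact: measurable_Lp_repr.
  rewrite -ge0_integralD//.
  - apply: ae_eq_integral => //.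
    + by apply: emeasurable_funD; exact: mf.
    + apply: filterS3 D hx hy => x -> hx1 hy1 _.
      rewrite -EFinD; congr EFin.
      by move: hx1 hy1; case: ifP => _; [move=> _ ->|move=> -> _];
        rewrite ?addr0 ?add0r ComplexField.Normc.normc0 powR0// ?addr0 ?add0r.
  - by move=> x _; rewrite lee_fin powR_ge0.
  - by move=> x _; rewrite lee_fin powR_ge0.
- have D := Lp_reprD xi eta.
  have := Lp_repr_proj mA xi; rewrite Axi => hx.
  have := Lp_repr_proj mA eta; rewrite Aeta => hy.
  have {}hy : \forall x \ae mu, (if x \in A then Lp_repr eta x else 0) = 0.
    by apply: filterS2 hy (Lp_repr0 p1) => x <- ->.
  rewrite lp_sum2y ?Lp_norm_ge0//; apply/le_anti/andP; split.
    apply/Lp_norm_ley; first by rewrite le_max Lp_norm_ge0.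
    have /Lp_norm_ley := lexx (Lp_norm xi) => /(_ (Lp_norm_ge0 _)) nx.
    have /Lp_norm_ley := lexx (Lp_norm eta) => /(_ (Lp_norm_ge0 _)) ny.
    have nxy : \forall x \ae mu, normc (Lp_repr xi x) <= Lp_norm xi /\
        normc (Lp_repr eta x) <= Lp_norm eta.
      by apply: filterS2 nx ny => x.
    have dxy : \forall x \ae mu, Lp_repr (xi + eta) x = if x \in A then
        Lp_repr xi x else Lp_repr eta x.
      apply: filterS3 D hx hy => x -> ; case: ifP => _; last by move=> ->; rewrite add0r.
      by move=> _ ->; rewrite addr0.
    apply: filterS2 dxy nxy => x -> [nx1 ny1].
    by rewrite le_max; case: ifP => _; rewrite ?nx1// ny1 orbT.
  rewrite ge_max; apply/andP; split; apply: Lp_norm_mono;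
    apply: filterS3 D hx hy => x -> hx1 hy1; move: hx1 hy1; case: ifP => _;
    by [move=> _ ->; rewrite ?addr0 ?ComplexField.Normc.normc0 ?normc_ge0
       |move=> -> _; rewrite ?add0r ?ComplexField.Normc.normc0 ?normc_ge0].
Qed.

End LpNorm.

(** * Algebraic tensor products *)

Section TensorFacts.
Context {K : comNzRingType}.
Implicit Types E F : lmodType K.

HB.instance Definition _ (E E' F F' : lmodType K) (f : {linear E -> E'})
    (g : {linear F -> F'}) :=
  GRing.isLinear.Build K (tensor E F) (tensor E' F') _ (tmap f g) (tmap_linear f g).

HB.instance Definition _ (E F G : lmodType K) (B : {bilinear E -> F -> G}) :=
  GRing.isLinear.Build K (tensor E F) G _ (tlift B) (tlift_linear B).

HB.instance Definition _ (E1 E2 E3 F1 F2 F3 : lmodType K)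
    (D : {bilinear E1 -> E2 -> E3}) (B : {bilinear F1 -> F2 -> F3}) :=
  bilinear_isBilinear.Build K (tensor E1 F1) (tensor E2 F2) (tensor E3 F3) _ _
    (tmap2 D B) (tmap2_bilinear D B).

Lemma tensor_ind E F (P : tensor E F -> Prop) : P 0 ->
  (forall x y, P (tens x y)) -> (forall u v, P u -> P v -> P (u + v)) ->
  forall u, P u.
Proof.
move=> P0 Pt PD u; rewrite -(tens_reprK u) tens_piE.
by elim: (repr u) => [|q s IHs]; rewrite ?big_nil// big_cons; apply: PD.
Qed.

Lemma tens0l E F (y : F) : tens (0 : E) y = 0.
Proof. by rewrite -(scale0r 0) tensZl scale0r. Qed.

Lemma tens0r E F (x : E) : tens x (0 : F) = 0.
Proof. by rewrite -(scale0r 0) tensZr scale0r. Qed.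

Lemma tensor_ext E F (G : lmodType K) (f g : {linear tensor E F -> G}) :
  (forall x y, f (tens x y) = g (tens x y)) -> f =1 g.
Proof.
move=> fg; apply: tensor_ind => [|//|u v fu fv]; first by rewrite !linear0.
by rewrite !linearD fu fv.
Qed.

Section Contract.
Context (V W : lmodType K) (phi : {linear V -> K^o}).
Let B (x : V) (y : W) : W := (phi x : K) *: y.
Let B_bilinear : bilinear_for
  (GRing.Scale.Law.clone _ _ *:%R _) (GRing.Scale.Law.clone _ _ *:%R _) B.
Proof.
split=> [y|x] c u v; rewrite /B/=.
  by rewrite linearP scalerDl scalerA.
by rewrite scalerDr !scalerA mulrC.
Qed.
HB.instance Definition _ := bilinear_isBilinear.Build K V W W _ _ B B_bilinear.

(** The slice map of [phi], that is phi (x) id followed by K (x) W = W. *)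
Definition tcontract : tensor V W -> W := tlift B.
HB.instance Definition _ := GRing.Linear.on tcontract.

Lemma tcontract_tens x y : tcontract (tens x y) = (phi x : K) *: y.
Proof. exact: (tlift_tens B). Qed.
End Contract.

End TensorFacts.

Section Separation.
Context {K : fieldType} (V W : lmodType K).

(* A representation of u of minimal length has v_1 <> 0, and phi(v_1) <> 0 with
   sum_k phi(v_k) w_k = 0 would eliminate w_1. *)
Lemma tcontract_separates (Phi : {linear V -> K^o} -> Prop) :
  (forall v, v != 0 -> exists2 phi, Phi phi & phi v != 0) ->
  forall u : tensor V W, (forall phi, Phi phi -> tcontract phi u = 0) -> u = 0.
Proof.
move=> sepPhi u; rewrite -(tens_reprK u).
move: {2}(size _) (leqnn (size (repr u))) => n.
elim: n (repr u) => [|n IHn] [|[v w] s] //=; do ?by rewrite tens_piE big_nil.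
rewrite ltnS => sn h; have [v0|v0] := eqVneq v 0.
  have E : \pi_(tensor V W) ((v, w) :: s) = \pi_(tensor V W) s.
    by rewrite !tens_piE big_cons v0 tens0l add0r.
  by rewrite E in h *; exact: IHn.
have [phi Pphi phiv] := sepPhi v v0.
pose c (q : V * W) : V * W := (q.1 - ((phi q.1 : K) / phi v) *: v, q.2).
(* The relation given by the slice map of [phi] is solved for w, and w is substituted; this shortens
   the list by one. *)
have E : \pi_(tensor V W) ((v, w) :: s) = \pi_(tensor V W) (map c s).
  have := h phi Pphi; rewrite tens_piE linear_sum/= big_cons tcontract_tens /=.
  under eq_bigr do rewrite tcontract_tens.
  move/eqP; rewrite addr_eq0 => /eqP hw.
  have {}hw : w = - (phi v : K)^-1 *: \sum_(q <- s) (phi q.1 : K) *: q.2.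
    by rewrite scaleNr -scalerN -hw scalerA mulVf// scale1r.
  rewrite !tens_piE big_cons big_map /= hw.
  rewrite tensZr (big_morph (tens v) (tensDr v) (tens0r _ v)).
  rewrite scaler_sumr -big_split; apply: eq_bigr => q _ /=.
  rewrite tensDl -scaleNr tensZl tensZr addrC scalerA; congr (_ + _ *: _).
  by rewrite mulNr mulrC.
rewrite E in h *; apply: IHn => //.
by rewrite size_map.
Qed.

End Separation.

(** * Operator norms and amplifications *)

Section OperatorNorm.
Context {R : realType} (U V : lmodType R[i]) (NU : U -> R) (NV : V -> R).
Hypotheses (NUs : is_seminorm NU) (NVs : is_seminorm NV).

Lemma seminorm0 (W : lmodType R[i]) (N : W -> R) : is_seminorm N -> N 0 = 0.
Proof. by move=> Ns; rewrite -(scale0r 0) Ns.2 ComplexField.Normc.normc0 mul0r. Qed.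

Lemma seminorm_ge0 (W : lmodType R[i]) (N : W -> R) w : is_seminorm N -> 0 <= N w.
Proof.
move=> Ns; have := Ns.1 w (- w).
by rewrite subrr seminorm0// -scaleN1r Ns.2 normcN1; lra.
Qed.

Lemma seminorm_rc (W : lmodType R[i]) (N : W -> R) w (t : R) : is_seminorm N ->
  0 <= t -> N (t%:C%C *: w) = t * N w.
Proof. by move=> Ns t0; rewrite Ns.2 normc_rc. Qed.

Lemma op_norm_ge0 (f : {linear U -> V}) : 0 <= op_norm NU NV f.
Proof.
rewrite /op_norm; set A := (X in sup X).
(* An unbounded operator has norm 0 here, the default value of [sup]. *)
have [[_ h]|h] := pselect (has_sup A); last by rewrite sup_out.
apply: (le_trans _ (ub_le_sup h _)); last first.
  by exists 0; rewrite /= ?seminorm0.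
exact: seminorm_ge0.
Qed.

Lemma op_norm_has_sup (f : {linear U -> V}) : bounded_op NU NV f ->
  has_sup [set NV (f u) | u in [set u | NU u <= 1]].
Proof.
move=> [M hM]; split; first by exists (NV (f 0)), 0 => //=; rewrite seminorm0.
exists `|M| => _ [u /= u1 <-]; apply: (le_trans (hM u)).
apply: (@le_trans _ _ (`|M| * NU u)).
  by rewrite ler_wpM2r ?ler_norm// seminorm_ge0.
by rewrite -[leRHS]mulr1 ler_wpM2l.
Qed.

Lemma op_norm_bound (f : {linear U -> V}) u : bounded_op NU NV f ->
  NV (f u) <= op_norm NU NV f * NU u.
Proof.
move=> fb; have [_ h] := op_norm_has_sup fb.
have := seminorm_ge0 u NUs; rewrite le_eqVlt => /predU1P[u0|u0].
  (* A vector of seminorm 0 cannot be rescaled to the unit sphere, but any bound M already gives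
     0. *)
  by case: fb => M /(_ u); rewrite -u0 !mulr0.
rewrite -ler_pdivrMr//; apply: ub_le_sup => //.
exists ((NU u)^-1%:C%C *: u) => /=.
  by rewrite seminorm_rc ?invr_ge0 ?(ltW u0)// mulVf// gt_eqF.
by rewrite linearZ/= seminorm_rc ?invr_ge0 ?(ltW u0)// mulrC.
Qed.

Lemma op_norm_le (f : {linear U -> V}) (M : R) : 0 <= M ->
  (forall u, NV (f u) <= M * NU u) -> op_norm NU NV f <= M.
Proof.
move=> M0 hM; apply: sup_le_ub; first by exists (NV (f 0)), 0 => //=; rewrite seminorm0.
by move=> _ [u /= u1 <-]; rewrite (le_trans (hM u))// ler_piMr.
Qed.

End OperatorNorm.

Section BiopNorm.
Context {R : realType} (U V W : lmodType R[i]).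
Variables (NU : U -> R) (NV : V -> R) (NW : W -> R).
Hypotheses (NUs : is_seminorm NU) (NVs : is_seminorm NV) (NWs : is_seminorm NW).
Variable f : {bilinear U -> V -> W}.
Hypothesis fb : bounded_biop NU NV NW f.

Lemma biop_norm_ub u v : NU u <= 1 -> NV v <= 1 -> NW (f u v) <= biop_norm NU NV NW f.
Proof.
move=> u1 v1; apply: ub_le_sup; last by exists u => //; exists v.
have [M hM] := fb; exists `|M| => _ [x /= x1 [y /= y1 <-]].
apply: (le_trans (hM x y)); rewrite -mulrA.
have xy0 : 0 <= NU x * NV y by rewrite mulr_ge0// seminorm_ge0.
apply: (@le_trans _ _ (`|M| * (NU x * NV y))); first by rewrite ler_wpM2r ?ler_norm.
by rewrite ler_piMr// mulr_ile1// seminorm_ge0.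
Qed.

Lemma biop_norm_ge0 : 0 <= biop_norm NU NV NW f.
Proof.
have := biop_norm_ub (u := 0) (v := 0); rewrite !seminorm0// => /(_ ler01 ler01).
by apply: le_trans; exact: seminorm_ge0.
Qed.

Lemma biop_norm_bound u v : NW (f u v) <= biop_norm NU NV NW f * (NU u * NV v).
Proof.
have [M hM] := fb; have := hM u v.
have := seminorm_ge0 u NUs; rewrite le_eqVlt => /predU1P[<-|u0].
  by rewrite mulr0 !mul0r mulr0.
have := seminorm_ge0 v NVs; rewrite le_eqVlt => /predU1P[<-|v0].
  by rewrite !mulr0.
move=> _; have uv0 : 0 < NU u * NV v by rewrite mulr_gt0.
rewrite -ler_pdivrMr//.
have := @biop_norm_ub ((NU u)^-1%:C%C *: u) ((NV v)^-1%:C%C *: v).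
rewrite !seminorm_rc ?invr_ge0 ?(ltW u0) ?(ltW v0)// !mulVf ?gt_eqF// => /(_ (lexx _) (lexx _)).
rewrite linearZl_LR linearZr_LR /= !seminorm_rc ?invr_ge0 ?(ltW u0) ?(ltW v0)//.
by rewrite mulrA mulrC -invfM.
Qed.

End BiopNorm.

Section ModuleFacts.
Context d (T : measurableType d) (R : realType) (mu : {measure set T -> \bar R}).
Context (p : \bar R) (p1 : (1 <= p)%E).
Local Notation L := (Lp mu p1).
Local Notation normL := (@Lp_norm _ _ _ mu p p1).
Implicit Types E F : lmodType R[i].

HB.instance Definition _ (A : set T) (mA : measurable A) :=
  GRing.isLinear.Build R[i] L L _ (Lp_proj mA) (Lp_proj_linear mA).

HB.instance Definition _ E (a : {linear L -> L}) :=
  GRing.Linear.copy (@Lact _ _ _ _ _ p1 E a) (tmap a idfun).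

HB.instance Definition _ E F (phi : {linear E -> F}) :=
  GRing.Linear.copy (@ampl _ _ _ _ _ p1 E F phi) (tmap (@idfun L) phi).

Lemma Lact_tens E (a : {linear L -> L}) xi (x : E) :
  Lact a (tens xi x) = tens (a xi) x.
Proof. exact: (tmap_tens a idfun). Qed.

Lemma ampl_tens E F (phi : {linear E -> F}) (xi : L) (x : E) :
  ampl phi (tens xi x) = tens xi (phi x).
Proof. exact: (tmap_tens (@idfun L) phi). Qed.

Lemma Lact_comp E (a b c : {linear L -> L}) : (forall xi, a (b xi) = c xi) ->
  forall u : tensor L E, Lact a (Lact b u) = Lact c u.
Proof.
move=> abc u; apply: (tensor_ext (f := Lact a \o Lact b) (g := Lact c)) => xi x /=.
by rewrite !Lact_tens abc.
Qed.

Lemma Lact_id E (a : {linear L -> L}) : (forall xi, a xi = xi) ->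
  forall u : tensor L E, Lact a u = u.
Proof. by move=> aid; apply: (tensor_ext (f := Lact a) (g := idfun)) => xi x /=; rewrite Lact_tens aid. Qed.

Lemma Lact_scale E (a b : {linear L -> L}) (c : R[i]) : (forall xi, b xi = c *: a xi) ->
  forall u : tensor L E, Lact b u = c *: Lact a u.
Proof.
move=> abc; apply: (tensor_ext (f := Lact b) (g := c \*: Lact a)) => xi x /=.
by rewrite !Lact_tens abc tensZl.
Qed.

Lemma ampl_Lact E F (phi : {linear E -> F}) (a : {linear L -> L}) u :
  ampl phi (Lact a u) = Lact a (ampl phi u).
Proof.
apply: (tensor_ext (f := ampl phi \o Lact a) (g := Lact a \o ampl phi)) => xi x /=.
by rewrite Lact_tens !ampl_tens Lact_tens.
Qed.

End ModuleFacts.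

Section DiamondFacts.
Context d (T : measurableType d) (R : realType).
Variables (mu : {sigma_finite_measure set T -> \bar R}).
Variables (p : \bar R) (p1 : (1 <= p)%E).
Local Notation L := (Lp mu p1).
Variable i : {linear Lp (mu \x mu)%E p1 -> L}.
Implicit Types E F G : lmodType R[i].

HB.instance Definition _ E F G (B : {bilinear E -> F -> G}) :=
  bilinear_isBilinear.Build R[i] (tensor L E) (tensor L F) (tensor L G) _ _
    (@biampl _ _ _ _ _ p1 i E F G B) (tmap2_bilinear (diamond i) B).

Lemma biampl_tens E F G (B : {bilinear E -> F -> G}) (xi eta : L) x y :
  biampl i B (tens xi x) (tens eta y) = tens (diamond i xi eta) (B x y).
Proof. exact: (tmap2_tens (diamond i) B). Qed.

Lemma ampl_biampl E F G (H : lmodType R[i]) (B : {bilinear E -> F -> G}) (C : {bilinear E -> F -> H})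
    (phi : {linear G -> H}) : (forall x y, phi (B x y) = C x y) ->
  forall u v, ampl phi (biampl i B u v) = biampl i C u v.
Proof.
move=> phiBC u v; elim/(@tensor_ind _ L E): u => [|xi x|u u' hu hu'].
- by rewrite !linear0l linear0.
- elim/(@tensor_ind _ L F): v => [|eta y|v v' hv hv'].
  + by rewrite !linear0r linear0.
  + by rewrite !biampl_tens ampl_tens phiBC.
  + by rewrite !linearDr /= linearD /= hv hv'.
- by rewrite !linearDl /= linearD /= hu hu'.
Qed.

End DiamondFacts.

Section ProductNorm.
Context d (T : measurableType d) (R : realType).
Variables (mu : {sigma_finite_measure set T -> \bar R}).

Lemma Lp_repr_prod (p : \bar R) (p1 : (1 <= p)%E) (xi eta : Lp mu p1) :
  \forall z \ae (mu \x mu)%E,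
    Lp_repr (Lp_prod xi eta) z = Lp_repr xi z.1 * Lp_repr eta z.2.
Proof.
by apply: filterS (Lp_repr_class (Lpfun_prod (Lp_reprP xi) (Lp_reprP eta))) => z /(_ I).
Qed.

(** For finite p Tonelli's theorem even gives equality; for p = oo the two essential bounds
    multiply. *)
Lemma Lp_prod_norm (p : \bar R) (p1 : (1 <= p)%E) (xi eta : Lp mu p1) :
  Lp_norm (Lp_prod xi eta) <= Lp_norm xi * Lp_norm eta.
Proof.
have E := Lp_repr_prod xi eta.
case: p p1 xi eta E => [r||] p1 xi eta E; last by have := p1; rewrite leeNy_eq.
  have r0 : r != 0 by rewrite gt_eqF// (lt_le_trans ltr01)// -lee_fin.
  suff h : Lp_norm (Lp_prod xi eta) `^ r = Lp_norm xi `^ r * Lp_norm eta `^ r.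
    rewrite -(powRKV r0 (Lp_norm_ge0 _)) h -powRM ?Lp_norm_ge0//.
    by rewrite powRKV// mulr_ge0 ?Lp_norm_ge0.
  apply/EFin_inj; rewrite EFinM !Lp_norm_powR.
  pose f (z : Lp mu p1) x := (normc (Lp_repr z x) `^ r)%:E.
  have mpow d' (S : measurableType d') (h : S -> R) : measurable_fun setT h ->
      measurable_fun setT (fun x => (h x `^ r)%:E).
    move=> mh; apply/measurable_EFinP.
    exact: (@measurableT_comp _ _ _ _ _ _ (@powR R ^~ r)).
  have mf z : measurable_fun setT (f z) by apply: mpow; exact: measurable_Lp_repr.
  have f0 z x : (0 <= f z x)%E by rewrite lee_fin powR_ge0.
  have mfg : measurable_fun setT (fun z : T * T => (f xi z.1 * f eta z.2)%E).
    apply: emeasurable_funM.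
      exact: (measurableT_comp (mf xi) measurable_fst).
    exact: (measurableT_comp (mf eta) measurable_snd).
  transitivity (\int[(mu \x mu)%E]_z (f xi z.1 * f eta z.2))%E.
    apply: ae_eq_integral => //; first by apply: mpow; exact: measurable_Lp_repr.
    apply: filterS E => z -> _.
    by rewrite ComplexField.Normc.normcM powRM ?normc_ge0.
  rewrite (@fubini_tonelli1 _ _ _ _ _ mu mu) //; last by move=> z; exact: mule_ge0.
  transitivity (\int[mu]_x (f xi x * \int[mu]_y f eta y))%E.
    by apply: eq_integral => x _; rewrite /fubini_F/= ge0_integralZl//.
  by rewrite ge0_integralZr// integral_ge0.
apply/Lp_norm_ley; first by rewrite mulr_ge0 ?Lp_norm_ge0.
have /Lp_norm_ley := lexx (Lp_norm xi) => /(_ (Lp_norm_ge0 _)) nx.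
have /Lp_norm_ley := lexx (Lp_norm eta) => /(_ (Lp_norm_ge0 _)) ny.
apply: filterS3 E (ae_fst nx) (ae_snd ny) => z -> h1 h2.
by rewrite ComplexField.Normc.normcM ler_pM ?normc_ge0.
Qed.

(** The product of the two supports is a null set for the product measure, so one of the supports is
    null. In particular xi <> xi vanishes only for xi = 0. *)
Lemma Lp_prod_eq0 (p : \bar R) (p1 : (1 <= p)%E) (xi eta : Lp mu p1) :
  Lp_prod xi eta = 0 -> xi = 0 \/ eta = 0.
Proof.
move=> h; have E : \forall z \ae (mu \x mu)%E, Lp_repr xi z.1 * Lp_repr eta z.2 = 0.
  have := Lp_repr_prod xi eta; rewrite h => h'.
  by apply: filterS2 h' (Lp_repr0 _ p1) => z <- ->.
pose A (z : Lp mu p1) := (normc \o Lp_repr z) @^-1` [set~ 0].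
have mA z : measurable (A z).
  rewrite -[A z]setTI; apply: measurable_Lp_repr => //.
  exact: measurableC.
have inA z x : A z x <-> Lp_repr z x <> 0.
  split=> h1 h2; apply: h1; first by rewrite /= h2 ComplexField.Normc.normc0.
  exact: ComplexField.Normc.eq0_normc.
have A0 z : mu (A z) = 0%E -> z = 0.
  move=> Az; apply/Lp_eqP.
  have h' : \forall x \ae mu, Lp_repr z x = 0.
    by exists (A z); split => // x /= nz; apply/inA.
  by apply: filterS2 h' (Lp_repr0 _ p1) => x -> ->.
have : (mu \x mu)%E (A xi `*` A eta) = 0%E.
  have [N [mN N0 NP]] := E.
  apply/eqP; rewrite -measure_le0 -N0; apply: le_measure; rewrite ?inE//.
    exact: measurableX.
  move=> z [/inA h1 /inA h2]; apply: NP => /= /eqP; rewrite mulf_eq0.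
  by move=> /orP[/eqP|/eqP].
rewrite (_ : (_ \x _)%E _ = mu (A xi) * mu (A eta))%E; last exact: product_measure1E.
by move/eqP; rewrite mule_eq0 => /orP[/eqP/A0|/eqP/A0]; [left|right].
Qed.

End ProductNorm.

(** * Proper isometries and bands *)

Section ProperIsometries.
Context d (T : measurableType d) (R : realType) (mu : {measure set T -> \bar R}).
Context (p : \bar R) (p1 : (1 <= p)%E).
Local Notation L := (Lp mu p1).
Local Notation normL := (@Lp_norm _ _ _ mu p p1).
Local Notation band mA := (range (Lp_proj mA : L -> L)).

Lemma bandP (A : set T) (mA : measurable A) (xi : L) :
  band mA xi <-> Lp_proj mA xi = xi.
Proof. by split=> [[z _ <-]|<-]; [exact: Lp_proj_idem|exists xi]. Qed.

Lemma Lp_projC (A B : set T) (mA : measurable A) (mB : measurable B) (xi : L) :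
  Lp_proj mA (Lp_proj mB xi) = Lp_proj mB (Lp_proj mA xi).
Proof.
rewrite (Lp_projI _ _ (measurableI _ _ mA mB)) (Lp_projI _ _ (measurableI _ _ mB mA)).
by apply: Lp_proj_ext; rewrite setIC.
Qed.

Lemma disjoint_bandP (A B : set T) (mA : measurable A) (mB : measurable B) :
  band mA `&` band mB = [set 0] <-> forall xi : L, Lp_proj mA (Lp_proj mB xi) = 0.
Proof.
split=> [AB xi|AB].
  have : (band mA `&` band mB) (Lp_proj mA (Lp_proj mB xi)).
    by split; [exists (Lp_proj mB xi)|rewrite Lp_projC; exists (Lp_proj mA xi)].
  by rewrite AB.
apply/seteqP; split=> [xi [/bandP h1 /bandP h2]|_ ->] /=.
  by rewrite -h1 -{1}h2 AB.
by split; exists 0; rewrite ?linear0.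
Qed.

Lemma le_lp_sum2l (x y : R) : 0 <= x -> 0 <= y -> x <= lp_sum p [:: x; y].
Proof.
move=> x0 y0; have := @lp_sum_cat _ p [:: x] [::] p1.
rewrite cats0 lp_sum_seq1// lp_sum_nil// => {1}->.
by apply: lp_sum2_mono => //; rewrite ?lexx ?x0 ?y0.
Qed.

Lemma le_lp_sum2r (x y : R) : 0 <= x -> 0 <= y -> y <= lp_sum p [:: x; y].
Proof.
move=> x0 y0; have := @lp_sum_cat _ p [::] [:: y] p1.
rewrite cat0s lp_sum_seq1// lp_sum_nil// => {1}->.
by apply: lp_sum2_mono => //; rewrite ?lexx ?x0 ?y0.
Qed.

Lemma Lp_norm_proj2 (A B : set T) (mA : measurable A) (mB : measurable B) (xi : L) :
  (forall xi : L, Lp_proj mA (Lp_proj mB xi) = 0) ->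
  lp_sum p [:: normL (Lp_proj mA xi); normL (Lp_proj mB xi)] <= normL xi.
Proof.
move=> AB; rewrite -[X in _ <= normL X](subrKC (Lp_proj mA xi)).
rewrite (@Lp_norm_split _ _ _ _ _ _ _ mA); last 2 first.
- exact: Lp_proj_idem.
- by rewrite linearB/= Lp_proj_idem subrr.
apply: lp_sum2_mono; rewrite ?p1 ?lexx ?Lp_norm_ge0//=.
rewrite (_ : Lp_proj mB xi = Lp_proj mB (xi - Lp_proj mA xi)) ?Lp_proj_norm//.
by rewrite linearB/= Lp_projC AB subr0.
Qed.

(** S' projects onto the range of S and then inverts S there; it is linear because an isometry is
    injective. *)
Lemma proper_isometry_inverse (S : {linear L -> L}) : is_proper_isometry S ->
  exists (A : set T) (mA : measurable A) (S' : {linear L -> L}),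
  [/\ range S = band mA, forall xi, S' (S xi) = xi &
      forall zeta, normL (S' zeta) = normL (Lp_proj mA zeta)].
Proof.
move=> [Siso [A [mA SA]]].
have Sinj x y : S x = S y -> x = y.
  move=> xy; apply/eqP; rewrite -subr_eq0; apply/eqP/Lp_norm_eq0.
  by rewrite -Siso linearB/= xy subrr (seminorm0 (Lp_norm_seminorm _ p1)).
have ex zeta : exists xi, S xi = Lp_proj mA zeta.
  have : (range S) (Lp_proj mA zeta) by rewrite SA; exists zeta.
  by move=> [xi _ h]; exists xi.
pose S' zeta := sval (cid (ex zeta)).
have SS' zeta : S (S' zeta) = Lp_proj mA zeta by rewrite /S'; case: cid.
have S'lin : linear S'.
  by move=> c x y; apply: Sinj; rewrite SS' !linearP/= !SS'.
pose S'L : {linear L -> L} := HB.pack S' (GRing.isLinear.Build _ _ _ _ S' S'lin).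
exists A, mA, S'L; split => //=.
  move=> xi; apply: Sinj; rewrite SS'; apply/bandP; rewrite -SA.
  by exists xi.
by move=> zeta; rewrite -SS' Siso.
Qed.

(** With A and B carrying the ranges, c = a1 S^-1 P_A + a2 T'^-1 P_B. A bound for the row (a1, a2)
    on the l_p-sum of two copies of L passes to c, because the l_p-sum of the norms of P_A z and P_B
    z is at most the norm of z. *)
Lemma row_operator (S T' a1 a2 : {linear L -> L}) (g : R) :
  is_proper_isometry S -> is_proper_isometry T' -> disjoint_isometries S T' ->
  0 <= g ->
  (forall x y, normL (a1 x + a2 y) <= g * lp_sum p [:: normL x; normL y]) ->
  exists c : {linear L -> L}, [/\ forall z, normL (c z) <= g * normL z,
    forall x, c (S x) = a1 x & forall x, c (T' x) = a2 x].
Proof.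
move=> /proper_isometry_inverse[A [mA [S' [SA S'S S'N]]]].
move=> /proper_isometry_inverse[B [mB [R' [TB R'T R'N]]]].
rewrite /disjoint_isometries SA TB => /disjoint_bandP AB g0 h.
have BA (xi : L) : Lp_proj mB (Lp_proj mA xi) = 0 by rewrite Lp_projC.
have S'T x : S' (T' x) = 0.
  apply: Lp_norm_eq0; rewrite S'N.
  have /bandP <- : band mB (T' x) by rewrite -TB; exists x.
  by rewrite AB (seminorm0 (Lp_norm_seminorm _ p1)).
have R'S x : R' (S x) = 0.
  apply: Lp_norm_eq0; rewrite R'N.
  have /bandP <- : band mA (S x) by rewrite -SA; exists x.
  by rewrite BA (seminorm0 (Lp_norm_seminorm _ p1)).
exists ((a1 \o S') \+ (a2 \o R')); split=> [z|x|x] /=.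
- apply: (le_trans (h _ _)); rewrite S'N R'N ler_wpM2l//.
  exact: Lp_norm_proj2.
- by rewrite S'S R'S linear0 addr0.
- by rewrite R'T S'T linear0 add0r.
Qed.

(* For p = 2 a proper isometry need not map bands to bands. *)
Definition band_isometry (S : {linear L -> L}) :=
  (forall xi, normL (S xi) = normL xi) /\
  forall (A : set T) (mA : measurable A), exists (B : set T) (mB : measurable B),
    S @` band mA = band mB.

(** The interface between functional analysis and measure theory: the estimates for the seminorm
    assume a halving, and the conditions on X serve to produce one. *)
Definition halving := exists S T' : {linear L -> L},
  [/\ band_isometry S, band_isometry T' & disjoint_isometries S T'].

Lemma bandT : band (@measurableT _ T) = [set: L].
Proof. by apply/seteqP; split=> // xi _; apply/bandP; rewrite Lp_projT. Qed.

Lemma band_isometry_proper S : band_isometry S -> is_proper_isometry S.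
Proof.
move=> [Siso Sband]; split => //.
by have [B [mB]] := Sband _ measurableT; rewrite bandT => SB; exists B, mB.
Qed.

Lemma band_isometry_comp (S I : {linear L -> L}) : band_isometry S ->
  is_proper_isometry I -> is_proper_isometry (S \o I).
Proof.
move=> [Siso Sband] [Iiso [A [mA IA]]]; split=> [xi|]; first by rewrite /= Siso Iiso.
have [B [mB SB]] := Sband _ mA; exists B, mB.
by rewrite -SB -IA [RHS]image_comp.
Qed.

Lemma disjoint_isometries_compl (S I J : {linear L -> L}) :
  (forall xi, normL (S xi) = normL xi) ->
  disjoint_isometries I J -> disjoint_isometries (S \o I) (S \o J).
Proof.
move=> Siso IJ; apply/seteqP; split=> [z [[x _ /= <-] [y _ /= xy]]|_ ->]; last first.
  by split; exists 0 => //=; rewrite !linear0.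
have xyE : J y = I x.
  apply/eqP; rewrite -subr_eq0; apply/eqP/Lp_norm_eq0.
  by rewrite -Siso linearB/= xy subrr (seminorm0 (Lp_norm_seminorm _ p1)).
have : (range I `&` range J) (I x) by split; [exists x|exists y].
by rewrite IJ => /= ->; rewrite linear0.
Qed.

Lemma disjoint_isometries_comp (S T' I J : {linear L -> L}) :
  disjoint_isometries S T' -> disjoint_isometries (S \o I) (T' \o J).
Proof.
move=> ST; apply/seteqP; split=> [z [[x _ /= <-] [y _ /= xy]]|_ ->]; last first.
  by split; exists 0 => //=; rewrite !linear0.
have : (range S `&` range T') (S (I x)) by split; [exists (I x)|exists (J y)].
by rewrite ST.
Qed.

Lemma disjoint_isometriesC (I J : {linear L -> L}) :
  disjoint_isometries I J -> disjoint_isometries J I.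
Proof. by rewrite /disjoint_isometries setIC. Qed.

Lemma proper_isometry_id : is_proper_isometry (idfun : {linear L -> L}).
Proof.
split => //; exists setT, measurableT; rewrite bandT.
by apply/seteqP; split=> // x _; exists x.
Qed.

End ProperIsometries.

(** * p-convexity for finite sums over disjoint bands *)

Section PConvexSums.
Context d (T : measurableType d) (R : realType) (mu : {measure set T -> \bar R}).
Context (p : \bar R) (p1 : (1 <= p)%E).
Local Notation L := (Lp mu p1).
Local Notation normL := (@Lp_norm _ _ _ mu p p1).
Context (G : lmodType R[i]) (NG : tensor L G -> R).
Hypotheses (NGs : is_Lseminorm NG) (NGp : p_convex NG).

Lemma Lact_norm_le (a : {linear L -> L}) (M : R) (u : tensor L G) : 0 <= M ->
  (forall xi, normL (a xi) <= M * normL xi) -> NG (Lact a u) <= M * NG u.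
Proof.
move=> M0 aM; have Ls := Lp_norm_seminorm mu p1.
apply: (le_trans (NGs.2 a _ u)); first by exists M.
by rewrite ler_wpM2r ?(seminorm_ge0 _ NGs.1)// op_norm_le.
Qed.

Lemma lp_sum_ordSr n (c : 'I_n.+1 -> R) :
  lp_sum p [seq c k | k : 'I_n.+1] =
  lp_sum p [:: lp_sum p [seq c (widen_ord (leqnSn _) k) | k : 'I_n];
    lp_sum p [:: c ord_max]].
Proof.
by rewrite /image_mem enum_ordSr map_rcons -cats1 lp_sum_cat// -map_comp.
Qed.

(** Since p-convexity speaks of two summands, the induction also has to produce a set D that carries
    the partial sum and is disjoint, up to null sets, from everything that is disjoint from all the
    A_k. *)
Lemma p_convex_sum n (A : 'I_n -> set T) (mA : forall k, measurable (A k))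
    (w : 'I_n -> tensor L G) (c : 'I_n -> R) :
  (forall k l, k != l -> forall xi : L, Lp_proj (mA k) (Lp_proj (mA l) xi) = 0) ->
  (forall k, Lact (Lp_proj (mA k) : L -> L) (w k) = w k) ->
  (forall k, NG (w k) <= c k) ->
  exists (D : set T) (mD : measurable D),
  [/\ Lact (Lp_proj mD : L -> L) (\sum_k w k) = \sum_k w k,
      (forall (B : set T) (mB : measurable B),
        (forall k (xi : L), Lp_proj mB (Lp_proj (mA k) xi) = 0) ->
        forall xi : L, Lp_proj mB (Lp_proj mD xi) = 0) &
      NG (\sum_k w k) <= lp_sum p [seq c k | k : 'I_n]].
Proof.
elim: n A mA w c => [|n IHn] A mA w c Adisj Aw wc.
  exists set0, measurable0; split.
  - by rewrite big_ord0 linear0.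
  - by move=> B mB _ xi; rewrite (Lp_proj0 measurable0) ?measure0// linear0.
  - by rewrite big_ord0 (seminorm0 NGs.1) lp_sum_ge0.
set wd := widen_ord (leqnSn n).
have [D [mD [Dw DB Dn]]] := IHn (A \o wd) (fun k => mA (wd k)) (w \o wd) (c \o wd)
  (fun k l kl => Adisj (wd k) (wd l) kl) (fun k => Aw (wd k)) (fun k => wc (wd k)).
set x := \sum_(k < n) _ in Dw Dn; set y := w ord_max.
rewrite big_ord_recr -/x -/y /=.
have AD xi : Lp_proj (mA ord_max) (Lp_proj mD xi) = 0 :> L.
  apply: DB => k {}xi; apply: Adisj.
  by rewrite -val_eqE/= neq_ltn ltn_ord orbT.
have DA xi : Lp_proj mD (Lp_proj (mA ord_max) xi) = 0 :> L by rewrite Lp_projC.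
have mU := measurableU _ _ mD (mA ord_max).
have UD xi : Lp_proj mU (Lp_proj mD xi) = Lp_proj mD xi :> L.
  rewrite (Lp_projI _ _ (measurableI _ _ mU mD)); apply: Lp_proj_ext.
  by apply: setIidr => z; left.
have UA xi : Lp_proj mU (Lp_proj (mA ord_max) xi) = Lp_proj (mA ord_max) xi :> L.
  rewrite (Lp_projI _ _ (measurableI _ _ mU (mA ord_max))); apply: Lp_proj_ext.
  by apply: setIidr => z; right.
exists (D `|` A ord_max), mU; split.
- rewrite linearD/=; congr (_ + _).
    by rewrite -{1}Dw (Lact_comp (c := Lp_proj mD)).
  have Ay : Lact (Lp_proj (mA ord_max) : L -> L) y = y := Aw ord_max.
  by rewrite -{1}Ay (Lact_comp (c := Lp_proj (mA ord_max))).
- move=> B mB BA xi; rewrite Lp_projC.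
  have BD (z : L) : Lp_proj mD (Lp_proj mB z) = 0.
    by rewrite Lp_projC; apply: DB => k y'; exact: BA.
  have BA' (z : L) : Lp_proj (mA ord_max) (Lp_proj mB z) = 0 by rewrite Lp_projC; exact: BA.
  apply/Lp_eqP; have := Lp_repr_proj mD (Lp_proj mB xi).
  have := Lp_repr_proj (mA ord_max) (Lp_proj mB xi).
  rewrite BD BA'; apply: filterS3 (Lp_repr_proj mU (Lp_proj mB xi)) => z -> h1 h2 _.
  move: h1 h2; rewrite in_setU; case: (z \in D) => /= [_|h1 _]; first by move=> ->.
  by rewrite h1.
- rewrite lp_sum_ordSr; apply: (le_trans (NGp DA AD Dw (Aw ord_max))).
  have yc : NG y <= c ord_max := wc _.
  have y0 : 0 <= NG y := seminorm_ge0 _ NGs.1.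
  rewrite lp_sum_seq1 ?(le_trans y0)//.
  by apply: lp_sum2_mono; rewrite ?p1 ?(seminorm_ge0 _ NGs.1)//= ?y0.
Qed.

(** The range of a proper isometry is a band, so I_k . z_k is supported there, and its norm is at
    most that of z_k; disjoint ranges give disjoint bands. *)
Lemma p_convex_isometries n (I : 'I_n -> {linear L -> L})
    (z : 'I_n -> tensor L G) (c : 'I_n -> R) :
  (forall k, is_proper_isometry (I k)) ->
  (forall k l, k != l -> disjoint_isometries (I k) (I l)) ->
  (forall k, NG (z k) <= c k) ->
  NG (\sum_k Lact (I k) (z k)) <= lp_sum p [seq c k | k : 'I_n].
Proof.
move=> Iprop Idisj zc.
have /choice[A /= Ah] : forall k, exists A : set T, exists mA : measurable A,
    range (I k) = range (Lp_proj mA : L -> L) by move=> k; case: (Iprop k).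
pose mA k := sval (cid (Ah k)).
have IA k : range (I k) = range (Lp_proj (mA k) : L -> L) by exact: svalP (cid (Ah k)).
have [|k|k|D [mD [_ _]]//] := @p_convex_sum n A mA (fun k => Lact (I k) (z k)) c.
- by move=> k l /Idisj; rewrite /disjoint_isometries !IA => /disjoint_bandP.
- apply: (Lact_comp (c := I k)) => xi; apply/bandP; rewrite -IA.
  by exists xi.
- apply: le_trans (zc k); rewrite -[leRHS]mul1r; apply: Lact_norm_le => // xi.
  by rewrite mul1r (Iprop k).1.
Qed.

End PConvexSums.

Lemma LactZ d (T : measurableType d) (R : realType) (mu : {measure set T -> \bar R})
    (p : \bar R) (p1 : (1 <= p)%E) (E : lmodType R[i])
    (a : {linear Lp mu p1 -> Lp mu p1}) c (u : tensor (Lp mu p1) E) :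
  Lact a (c *: u) = c *: Lact a u.
Proof. exact: (linearZ_LR (Lact a)). Qed.

(** * The seminorm on the tensor product *)

Section PLNorm.
Context d (T : measurableType d) (R : realType).
Variables (mu : {sigma_finite_measure set T -> \bar R}).
Variables (p : \bar R) (p1 : (1 <= p)%E).
Local Notation L := (Lp mu p1).
Local Notation normL := (@Lp_norm _ _ _ mu p p1).
Variable i : {linear Lp (mu \x mu)%E p1 -> L}.
Hypothesis iiso : isometric_isomorphism i.
Variables (E F : lmodType R[i]) (NE : tensor L E -> R) (NF : tensor L F -> R).
Hypotheses (NEn : is_Lnorm NE) (NFn : is_Lnorm NF).
Local Notation N := (pLnorm i NE NF).
Local Notation EF := (tensor E F).
Implicit Types (U V : tensor L EF) (a b : {linear L -> L}).

Let Ls := Lp_norm_seminorm mu p1.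
Let NE0 u : 0 <= NE u := seminorm_ge0 u NEn.1.1.
Let NF0 v : 0 <= NF v := seminorm_ge0 v NFn.1.1.

(** The operator a and a bound s for the l_p-size are kept apart, instead of being multiplied to a
    value, because the two factors have to be balanced separately when representations are added. *)
Definition prerep U a (s : R) := exists n (I : 'I_n -> {linear L -> L})
    (u : 'I_n -> tensor L E) (v : 'I_n -> tensor L F),
  [/\ forall k, is_proper_isometry (I k),
      forall k l, k != l -> disjoint_isometries (I k) (I l),
      U = Lact a (\sum_(k < n) Lact (I k) (ldiamond i (u k) (v k))) &
      lp_sum p [seq NE (u k) * NF (v k) | k : 'I_n] <= s].

Definition rep_values U := [set r : R | exists n a (I : 'I_n -> {linear L -> L}) u v,
    pL_representation i U a I u v /\
    r = op_norm normL normL a * lp_sum p [seq NE (u k) * NF (v k) | k : 'I_n]].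

Lemma rep_values_ge0 U : lbound (rep_values U) 0.
Proof.
move=> _ [n [a [I [u [v [_ ->]]]]]].
by rewrite mulr_ge0 ?lp_sum_ge0 ?op_norm_ge0.
Qed.

Lemma prerep_le U a (al s : R) : 0 <= al -> (forall xi, normL (a xi) <= al * normL xi) ->
  prerep U a s -> N U <= al * s.
Proof.
move=> al0 aal [n [I [u [v [Ip Id UE us]]]]].
apply: (@le_trans _ _ (op_norm normL normL a * lp_sum p [seq NE (u k) * NF (v k) | k : 'I_n])).
  apply: ge_inf; first by exists 0; exact: rep_values_ge0.
  by exists n, a, I, u, v; split => //; split => //; exists al.
by apply: ler_pM; rewrite ?lp_sum_ge0 ?op_norm_ge0// op_norm_le.
Qed.

Lemma prerep0 a s : 0 <= s -> prerep 0 a s.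
Proof.
move=> s0; exists 0%N, (fun=> idfun), (fun=> 0), (fun=> 0); split.
- by case.
- by case.
- by rewrite big_ord0 linear0.
- by rewrite /image_mem enum_ord0 lp_sum_nil.
Qed.

Lemma prerep_Lact U a b (c : {linear L -> L}) s : (forall xi, c xi = b (a xi)) ->
  prerep U a s -> prerep (Lact b U) c s.
Proof.
move=> cE [n [I [u [v [Ip Id -> us]]]]]; exists n, I, u, v; split => //.
by rewrite (Lact_comp (c := c)).
Qed.

Lemma prerep_diamond u v : prerep (ldiamond i u v) idfun (NE u * NF v).
Proof.
exists 1%N, (fun=> idfun), (fun=> u), (fun=> v); split.
- by move=> _; exact: proper_isometry_id.
- by move=> k l; rewrite !ord1.
- by rewrite big_ord1 !(Lact_id (a := idfun)).
- rewrite /image_mem enum_ordSr enum_ord0 /= lp_sum_seq1//.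
  by rewrite mulr_ge0.
Qed.

Lemma lp_sum_ordD m n (c : 'I_(m + n) -> R) :
  lp_sum p [seq c k | k : 'I_(m + n)] =
  lp_sum p [:: lp_sum p [seq c (lshift n k) | k : 'I_m];
    lp_sum p [seq c (rshift m k) | k : 'I_n]].
Proof.
rewrite -lp_sum_cat//; congr (lp_sum p _).
rewrite /image_mem (_ : enum 'I_(m + n) =
  [seq lshift n k | k <- enum 'I_m] ++ [seq rshift m k | k <- enum 'I_n]).
  by rewrite map_cat -!map_comp.
apply: (@inj_map _ _ (val : 'I_(m + n) -> nat) val_inj).
rewrite map_cat -(map_comp val (@lshift m n)) -(map_comp val (@rshift m n)).
rewrite val_enum_ord iotaD add0n; congr (_ ++ _).
  by rewrite -val_enum_ord; apply: eq_map.
rewrite -{1}(addn0 m) iotaDl -val_enum_ord -(map_comp (addn m) val).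
by apply: eq_map.
Qed.

(** The number g bounds the row (a1, a2). The triangle inequality and p-convexity both follow from
    this lemma and differ in the choice of g, s1 and s2. *)
Lemma prerep_add (hv : halving mu p1) U V a1 a2 (s1 s2 g : R) : 0 <= g ->
  (forall x y, normL (a1 x + a2 y) <= g * lp_sum p [:: normL x; normL y]) ->
  prerep U a1 s1 -> prerep V a2 s2 ->
  exists c : {linear L -> L}, (forall z, normL (c z) <= g * normL z) /\
    prerep (U + V) c (lp_sum p [:: s1; s2]).
Proof.
move=> g0 h [m [I [u [v [Ip Id -> us]]]]] [n [J [w [z [Jp Jd -> ws]]]]].
have [S [T' [Sb Tb ST]]] := hv.
have [c [cg cS cT]] := row_operator (band_isometry_proper Sb)
  (band_isometry_proper Tb) ST g0 h.
exists c; split => //.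
pose K (k : 'I_(m + n)) : {linear L -> L} :=
  match fintype.split k with inl j => S \o I j | inr j => T' \o J j end.
pose x k := match fintype.split k with inl j => u j | inr j => w j end.
pose y k := match fintype.split k with inl j => v j | inr j => z j end.
have spl (k : 'I_m) : fintype.split (lshift n k) = inl k := unsplitK (inl k).
have spr (k : 'I_n) : fintype.split (rshift m k) = inr k := unsplitK (inr k).
exists (m + n)%N, K, x, y; split.
- by move=> k; rewrite /K; case: fintype.split => j; exact: band_isometry_comp.
- move=> k l; rewrite -[k]splitK -[l]splitK.
  case: (fintype.split k) => k'; case: (fintype.split l) => l' /= kl;
    rewrite /K ?spl ?spr.
  + apply: disjoint_isometries_compl; first exact: Sb.1.
    by apply: Id; apply: contra kl => /eqP->.
  + exact: disjoint_isometries_comp.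
  + by apply: disjoint_isometriesC; exact: disjoint_isometries_comp.
  + apply: disjoint_isometries_compl; first exact: Tb.1.
    by apply: Jd; apply: contra kl => /eqP->.
- rewrite big_split_ord (linearD (Lact c)); congr (_ + _);
    rewrite (linear_sum (Lact _)) (linear_sum (Lact c)).
    apply: eq_bigr => k _; rewrite /= /K /x /y spl.
    by rewrite !(Lact_comp (c := a1 \o I k))// => xi /=.
  apply: eq_bigr => k _; rewrite /= /K /x /y spr.
  by rewrite !(Lact_comp (c := a2 \o J k))// => xi /=.
- rewrite lp_sum_ordD; apply: lp_sum2_mono => //; rewrite lp_sum_ge0/=.
    apply: le_trans us; rewrite le_eqVlt; apply/orP; left; apply/eqP.
    by congr lp_sum; apply: eq_map => k; rewrite /x /y spl.
  apply: le_trans ws; rewrite le_eqVlt; apply/orP; left; apply/eqP.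
  by congr lp_sum; apply: eq_map => k; rewrite /x /y spr.
Qed.

Lemma diamond_norm (xi eta : L) : normL (diamond i xi eta) <= normL xi * normL eta.
Proof. by rewrite iiso.1 Lp_prod_norm. Qed.

Lemma diamond_eq0 (xi eta : L) : diamond i xi eta = 0 -> xi = 0 \/ eta = 0.
Proof.
move=> h; apply: Lp_prod_eq0; apply: Lp_norm_eq0.
by rewrite -iiso.1 -/(diamond i xi eta) h (seminorm0 Ls).
Qed.

Definition bounded_prerep U := exists a al s, [/\ 0 <= al,
  forall xi, normL (a xi) <= al * normL xi & prerep U a s].

Lemma bounded_prerepD (hv : halving mu p1) U V :
  bounded_prerep U -> bounded_prerep V -> bounded_prerep (U + V).
Proof.
move=> [a1 [al1 [s1 [al10 ha1 hU]]]] [a2 [al2 [s2 [al20 ha2 hV]]]].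
have [||c [cg cUV]] := prerep_add hv (g := al1 + al2) _ _ hU hV.
- exact: addr_ge0.
- move=> x y; apply: (le_trans (Ls.1 _ _)).
  rewrite mulrDl; apply: lerD.
    by apply: (le_trans (ha1 _)); rewrite ler_wpM2l// le_lp_sum2l ?Lp_norm_ge0.
  by apply: (le_trans (ha2 _)); rewrite ler_wpM2l// le_lp_sum2r ?Lp_norm_ge0.
by exists c, (al1 + al2), (lp_sum p [:: s1; s2]); split => //; exact: addr_ge0.
Qed.

Lemma bounded_prerep0 : bounded_prerep 0.
Proof.
exists idfun, 1, 0; split => //; first by move=> xi; rewrite mul1r.
exact: prerep0.
Qed.

(* xi (x (x) y) is the image of (xi x) <> (xi y) under a rank-one operator that
   sends xi <> xi to xi. *)
Lemma bounded_prerep_tens (xi : L) x y : bounded_prerep (tens xi (tens x y)).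
Proof.
have [->|xi0] := eqVneq xi 0; first by rewrite tens0l; exact: bounded_prerep0.
set w := diamond i xi xi.
have w0 : normL w != 0.
  apply: contraNneq xi0 => /Lp_norm_eq0/diamond_eq0[] ->//.
have wgt0 : 0 < normL w by rewrite lt_neqAle eq_sym w0 Lp_norm_ge0.
(* A functional of norm at most 1 that attains the norm of w = xi <> xi, so that phi(.) / ||w|| is 1
   at w. *)
have [phi [phiN phiw]] := hahn_banach w Ls.
pose a0 (eta : L) : L := ((phi eta : R[i]) / (normL w)%:C%C) *: xi.
have a0lin : linear a0.
  move=> c u v; rewrite /a0 linearP scalerA -scalerDl; congr (_ *: _).
  by rewrite mulrDl mulrA.
pose a : {linear L -> L} := HB.pack a0 (GRing.isLinear.Build _ _ _ _ a0 a0lin).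
exists a, (normL xi / normL w), (NE (tens xi x) * NF (tens xi y)); split.
- by rewrite divr_ge0 ?Lp_norm_ge0.
- move=> eta; rewrite /a /= /a0 Ls.2 ComplexField.Normc.normcM.
  rewrite ComplexField.Normc.normcV normc_rc ?Lp_norm_ge0//.
  rewrite mulrAC [leRHS]mulrAC ler_wpM2r ?invr_ge0 ?Lp_norm_ge0//.
  by rewrite mulrC ler_wpM2l ?Lp_norm_ge0.
have -> : tens xi (tens x y) = Lact a (ldiamond i (tens xi x) (tens xi y)).
  rewrite /ldiamond biampl_tens Lact_tens; congr tens.
  rewrite /a /= /a0 -/w phiw divff ?scale1r//.
  by apply: contra w0 => /eqP[->].
by apply: prerep_Lact (prerep_diamond _ _).
Qed.

Lemma bounded_prerep_ex (hv : halving mu p1) U : bounded_prerep U.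
Proof.
elim/(@tensor_ind _ L EF): U => [|xi z|U V]; [exact: bounded_prerep0| |exact: bounded_prerepD].
elim/(@tensor_ind _ E F): z => [|x y|z z' hz hz'].
- by rewrite tens0r; exact: bounded_prerep0.
- exact: bounded_prerep_tens.
- by rewrite tensDr; exact: bounded_prerepD.
Qed.

(** Without a representation, [inf] of the empty set would make the seminorm 0 by default. *)
Lemma rep_values_neq0 (hv : halving mu p1) U : rep_values U !=set0.
Proof.
have [a [al [s [al0 aal [n [I [u [v [Ip Id UE us]]]]]]]]] := bounded_prerep_ex hv U.
by eexists; exists n, a, I, u, v; split; last reflexivity; split => //; exists al.
Qed.

Section WithHalving.
Hypothesis hv : halving mu p1.

Lemma pLnorm_ge0 U : 0 <= N U.
Proof. by apply: lb_le_inf; [exact: rep_values_neq0|exact: rep_values_ge0]. Qed.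

Lemma le_pLnorm U (M x : R) : 0 <= M -> (forall r, rep_values U r -> x <= M * r) ->
  x <= M * N U.
Proof.
rewrite le_eqVlt => /predU1P[<- h|M0 h].
  by have [r Ur] := rep_values_neq0 hv U; have := h r Ur; rewrite !mul0r.
rewrite -ler_pdivrMl//; apply: lb_le_inf; first exact: rep_values_neq0.
by move=> r Ur; rewrite ler_pdivrMl//; exact: h.
Qed.

(** A representation with operator norm na and size s' satisfies na * s' < al * s; rescaling by t =
    s' / s turns the size into s and the operator norm into t * na <= al. *)
Lemma prerep_lt U (al s : R) : 0 < al -> 0 < s -> N U < al * s ->
  exists a, (forall xi, normL (a xi) <= al * normL xi) /\ prerep U a s.
Proof.
move=> al0 s0 Ur.
have [r [n [a [I [u [v [[ab Ip Id UE] rE]]]]]] rlt] := inf_lt (rep_values_neq0 hv U) Ur.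
set s' := lp_sum _ _ in rE; have s'0 : 0 <= s' := lp_sum_ge0 _ _.
set na := op_norm _ _ _ in rE; have na0 : 0 <= na by exact: op_norm_ge0.
have [t [t0 tal ts]] : exists t : R, [/\ 0 < t, t * na <= al & s' / t <= s].
  move: s'0; rewrite le_eqVlt => /predU1P[s'0|s'0].
    (* If the size s' is 0, any t with t * na <= al serves; the summand 1 keeps the denominator
       positive. *)
    exists (al / (na + 1)); have na1 : 0 < na + 1 by rewrite ltr_wpDl.
    split; first by rewrite divr_gt0.
      rewrite mulrAC ler_pdivrMr// ler_pM2l//; lra.
    by rewrite -s'0 mul0r ltW.
  exists (s' / s); split; first by rewrite divr_gt0.
    by rewrite mulrAC ler_pdivrMr// mulrC -rE ltW.
  by rewrite invf_div mulrCA divff ?mulr1// gt_eqF.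
exists (t%:C%C \*: a); split=> [xi|].
  rewrite /= seminorm_rc ?(ltW t0)//.
  apply: (@le_trans _ _ (t * (na * normL xi))).
    by rewrite ler_pM2l// op_norm_bound.
  by rewrite mulrA ler_wpM2r ?Lp_norm_ge0.
exists n, I, (fun k => (t^-1)%:C%C *: u k), v; split => //.
- rewrite UE (Lact_scale (a := a) (b := t%:C%C \*: a) (c := t%:C%C))// -LactZ scaler_sumr.
  congr Lact; apply: eq_bigr => k _.
  rewrite /ldiamond (linearZl_LR (biampl i (@tens _ E F))) /= LactZ.
  rewrite scalerA -(rmorphM (@real_complex R)) mulfV ?gt_eqF//.
  by rewrite scale1r.
- apply: le_trans ts; rewrite mulrC -lp_sumZ ?invr_ge0 ?(ltW t0)//; last first.
    by apply/allP => _ /mapP[k _ ->]; rewrite mulr_ge0.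
  rewrite le_eqVlt; apply/orP; left; apply/eqP; congr lp_sum.
  rewrite /image_mem -map_comp; apply: eq_map => k /=.
  by rewrite (seminorm_rc _ NEn.1.1) ?invr_ge0 ?(ltW t0)// mulrA.
Qed.

(** Factor r1 = al1 * s1 and r2 = al2 * s2 as in [lp_sum_hoelder]. The row then has norm at most (r1
    + r2) / ss, the joint size is at most ss, and their product is r1 + r2. *)
Lemma pLnormD U V : N (U + V) <= N U + N V.
Proof.
apply/ler_addgt0Pr => e e0; have e20 : 0 < e / 2 by rewrite divr_gt0.
set r1 := N U + e / 2; set r2 := N V + e / 2.
have -> : N U + N V + e = r1 + r2 by rewrite /r1 /r2; lra.
have r10 : 0 < r1 by rewrite ltr_wpDl ?pLnorm_ge0.
have r20 : 0 < r2 by rewrite ltr_wpDl ?pLnorm_ge0.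
have [al1 [s1 [al2 [s2 [[al10 s10 al20 s20] e1 e2 h]]]]] := lp_sum_hoelder p1 r10 r20.
have [|a1 [ha1 hU]] := @prerep_lt U _ _ al10 s10; first by rewrite e1 ltrDl.
have [|a2 [ha2 hV]] := @prerep_lt V _ _ al20 s20; first by rewrite e2 ltrDl.
set ss := lp_sum p [:: s1; s2] in h.
have ss0 : 0 < ss by rewrite (lt_le_trans s10)// le_lp_sum2l// ltW.
have g0 : 0 <= (r1 + r2) / ss by rewrite divr_ge0 ?(ltW ss0)// addr_ge0 ?ltW.
have [|c [hc hUV]] := prerep_add hv g0 _ hU hV.
  move=> x y; apply: (le_trans (Ls.1 _ _)); apply: (le_trans (lerD (ha1 _) (ha2 _))).
  by rewrite mulrAC ler_pdivlMr// h ?Lp_norm_ge0.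
by apply: (le_trans (prerep_le g0 hc hUV)); rewrite divfK// gt_eqF.
Qed.

Lemma pLnorm_Lact b (be : R) U : 0 <= be ->
  (forall xi, normL (b xi) <= be * normL xi) -> N (Lact b U) <= be * N U.
Proof.
move=> be0 hb; apply: le_pLnorm => // _ [n [a [I [u [v [[ab Ip Id UE] ->]]]]]].
rewrite mulrA; apply: (prerep_le (a := b \o a)).
- by rewrite mulr_ge0 ?op_norm_ge0.
- move=> xi /=; apply: (le_trans (hb _)); rewrite -mulrA ler_wpM2l//.
  exact: op_norm_bound.
- apply: (@prerep_Lact _ a) => //.
  by exists n, I, u, v; split.
Qed.

(** The scalar c acts as the operator c id, which gives one inequality; the other is the same for
    the inverse scalar. *)
Lemma pLnormZ c U : N (c *: U) = normc c * N U.
Proof.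
have h (c' : R[i]) V : N (c' *: V) <= normc c' * N V.
  rewrite (_ : c' *: V = Lact (c' \*: (idfun : {linear L -> L})) V).
    by apply: pLnorm_Lact; [exact: normc_ge0|move=> xi /=; rewrite Ls.2].
  by rewrite (Lact_scale (a := idfun) (b := c' \*: idfun) (c := c')) ?Lact_id.
apply/le_anti; rewrite h/=; have [->|c0] := eqVneq c 0.
  by rewrite ComplexField.Normc.normc0 mul0r pLnorm_ge0.
have nc0 : 0 < normc c.
  rewrite lt_neqAle normc_ge0 andbT eq_sym; apply: contra c0 => /eqP h0.
  by rewrite (ComplexField.Normc.eq0_normc h0).
rewrite -ler_pdivlMl// -ComplexField.Normc.normcV.
by apply: le_trans (h _ _); rewrite scalerA mulVf// scale1r.
Qed.

Lemma pLnorm_seminorm : is_Lseminorm N.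
Proof.
split; first by split; [exact: pLnormD|exact: pLnormZ].
move=> a ab U; apply: pLnorm_Lact; first exact: op_norm_ge0.
by move=> xi; exact: op_norm_bound.
Qed.

(** Since P . U = U and Q . V = V, the operators may be replaced by P a1 and Q a2. Their values lie
    in disjoint bands, so the row of two contractions is again contractive: g = 1, and the sizes add
    in l_p. *)
Lemma pLnorm_convex : p_convex N.
Proof.
move=> A B mA mB P Q PQ QP U V PU QV.
have NU0 := pLnorm_ge0 U; have NV0 := pLnorm_ge0 V.
(* [prerep_lt] needs a positive size, and t * N U is positive only if N U is; otherwise the triangle
   inequality suffices. *)
have [U0|U0] := eqVneq (N U) 0.
  apply: (le_trans (pLnormD _ _)); rewrite U0 add0r.
  exact: le_lp_sum2r.
have [V0|V0] := eqVneq (N V) 0.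
  apply: (le_trans (pLnormD _ _)); rewrite V0 addr0.
  exact: le_lp_sum2l.
have Ugt0 : 0 < N U by rewrite lt_neqAle eq_sym U0.
have Vgt0 : 0 < N V by rewrite lt_neqAle eq_sym V0.
set W := lp_sum _ _; have Wgt0 : 0 < W.
  by rewrite (lt_le_trans Ugt0)// le_lp_sum2l.
suff h t : 1 < t -> N (U + V) <= t * W.
  rewrite -(mulr1 W) mulrC -ler_pdivrMr//; apply/ler_addgt0Pr => e e0.
  by rewrite ler_pdivrMr// h// ltrDl.
move=> t1; have t0 : 0 < t by rewrite (lt_trans ltr01).
have [||a1 [ha1 hU]] := @prerep_lt U 1 (t * N U) ltr01.
- by rewrite mulr_gt0.
- by rewrite mul1r ltr_pMl.
have [||a2 [ha2 hV]] := @prerep_lt V 1 (t * N V) ltr01.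
- by rewrite mulr_gt0.
- by rewrite mul1r ltr_pMl.
have {}hU : prerep U ((Lp_proj mA : {linear L -> L}) \o a1) (t * N U).
  by rewrite -{1}PU; apply: (prerep_Lact (b := Lp_proj mA) _ hU).
have {}hV : prerep V ((Lp_proj mB : {linear L -> L}) \o a2) (t * N V).
  by rewrite -{1}QV; apply: (prerep_Lact (b := Lp_proj mB) _ hV).
have [|c [hc hUV]] := prerep_add hv ler01 _ hU hV.
  move=> x y /=; rewrite (@Lp_norm_split _ _ _ _ _ _ _ mA); last 2 first.
  - exact: Lp_proj_idem.
  - exact: PQ.
  rewrite mul1r; apply: lp_sum2_mono; rewrite ?p1 ?Lp_norm_ge0//=.
    by apply: (le_trans (Lp_proj_norm _ _)); rewrite -[leRHS]mul1r.
  by apply: (le_trans (Lp_proj_norm _ _)); rewrite -[leRHS]mul1r.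
apply: (le_trans (prerep_le ler01 hc hUV)); rewrite mul1r.
by rewrite (@lp_sumZ _ _ t [:: N U; N V]) ?(ltW t0)//= NU0 NV0.
Qed.

Lemma pLnorm_diamond u v : N (ldiamond i u v) <= NE u * NF v.
Proof.
rewrite -[leRHS]mul1r; apply: prerep_le (prerep_diamond u v) => //.
by move=> xi; rewrite mul1r.
Qed.

Section Universal.
Context (G : lmodType R[i]) (NG : tensor L G -> R) (B : {bilinear E -> F -> G}).
Context (phi : {linear EF -> G}) (M : R).
Hypotheses (NGs : is_Lseminorm NG) (NGp : p_convex NG) (M0 : 0 <= M).
Hypothesis BM : forall u v, NG (biampl i B u v) <= M * (NE u * NF v).
Hypothesis phiB : forall x y, phi (tens x y) = B x y.

(** The amplification of [phi] commutes with the action of operators and sends u <> v to the value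
    of the amplified B at (u, v). A representation of U is thus mapped to a sum over disjoint
    isometries, to which p-convexity of G applies. *)
Lemma pLnorm_universal U : NG (ampl phi U) <= M * N U.
Proof.
apply: le_pLnorm => // _ [n [a [I [u [v [[ab Ip Id UE] ->]]]]]].
rewrite UE ampl_Lact (linear_sum (ampl phi)) mulrCA.
rewrite (eq_bigr (fun k => Lact (I k) (biampl i B (u k) (v k)))); last first.
  by move=> k _ /=; rewrite ampl_Lact (ampl_biampl i (C := B)).
apply: (le_trans (Lact_norm_le NGs _ (op_norm_ge0 Ls Ls a)
  (fun xi => op_norm_bound Ls Ls xi ab))).
rewrite ler_wpM2l ?op_norm_ge0//.
have h := p_convex_isometries (z := fun k => biampl i B (u k) (v k))
  (c := fun k => M * (NE (u k) * NF (v k))) NGs NGp Ip Id (fun k => BM (u k) (v k)).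
apply: (le_trans h).
rewrite -lp_sumZ//; last by apply/allP => _ /mapP[k _ ->]; rewrite mulr_ge0.
by rewrite /image_mem -map_comp.
Qed.

End Universal.

End WithHalving.
End PLNorm.

(** * Nondegeneracy *)

Section ScalarTensor.
Context d (T : measurableType d) (R : realType) (mu : {measure set T -> \bar R}).
Context (p : \bar R) (p1 : (1 <= p)%E).
Local Notation L := (Lp mu p1).
Local Notation normL := (@Lp_norm _ _ _ mu p p1).
Local Notation C := (R[i]^o : lmodType R[i]).

Let B (xi : L) (c : C) : L := (c : R[i]) *: xi.
Let B_bilinear : bilinear_for
  (GRing.Scale.Law.clone _ _ *:%R _) (GRing.Scale.Law.clone _ _ *:%R _) B.
Proof.
split=> [c|xi] a u v; rewrite /B/=; first by rewrite scalerDr !scalerA mulrC.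
by rewrite scalerDl scalerA.
Qed.
HB.instance Definition _ := bilinear_isBilinear.Build R[i] L C L _ _ B B_bilinear.

Definition scalar_tensor : tensor L C -> L := tlift B.
HB.instance Definition _ := GRing.Linear.on scalar_tensor.

Lemma scalar_tensor_tens xi (c : C) : scalar_tensor (tens xi c) = (c : R[i]) *: xi.
Proof. exact: (tlift_tens B). Qed.

Definition scalar_Lnorm (u : tensor L C) : R := normL (scalar_tensor u).

Lemma scalar_tensor_Lact (a : {linear L -> L}) u :
  scalar_tensor (Lact a u) = a (scalar_tensor u).
Proof.
apply: (tensor_ext (f := scalar_tensor \o Lact a) (g := a \o scalar_tensor)) => xi c /=.
by rewrite Lact_tens !scalar_tensor_tens linearZ.
Qed.

Lemma scalar_Lnorm_seminorm : is_Lseminorm scalar_Lnorm.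
Proof.
have Ls := Lp_norm_seminorm mu p1; split.
  split=> [u v|c u]; first by rewrite /scalar_Lnorm linearD Ls.1.
  by rewrite /scalar_Lnorm linearZ Ls.2.
by move=> a ab u; rewrite /scalar_Lnorm scalar_tensor_Lact op_norm_bound.
Qed.

Lemma scalar_Lnorm_convex : p_convex scalar_Lnorm.
Proof.
move=> A D mA mD P Q PQ QP u v Pu Qv; rewrite /scalar_Lnorm linearD.
have Pu' : Lp_proj mA (scalar_tensor u) = scalar_tensor u.
  by rewrite -{2}Pu (scalar_tensor_Lact (Lp_proj mA)).
have Qv' : Lp_proj mD (scalar_tensor v) = scalar_tensor v.
  by rewrite -{2}Qv (scalar_tensor_Lact (Lp_proj mD)).
have PQv : Lp_proj mA (scalar_tensor v) = 0 by rewrite -Qv'; exact: PQ.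
by rewrite (Lp_norm_split Pu' PQv).
Qed.

End ScalarTensor.

(** * Bounded functionals and their amplifications *)

Section Functionals.
Context d (T : measurableType d) (R : realType) (mu : {measure set T -> \bar R}).
Context (p : \bar R) (p1 : (1 <= p)%E).
Local Notation L := (Lp mu p1).
Local Notation normL := (@Lp_norm _ _ _ mu p p1).
Context (E : lmodType R[i]) (NE : tensor L E -> R) (NEn : is_Lnorm NE).
Variables (xi0 : L) (xi0N : xi0 != 0).
Let Ls := Lp_norm_seminorm mu p1.

(** E carries no norm of its own, but a fixed nonzero xi0 makes x -> ||xi0 x|| one; these are its
    functionals of norm at most 1. *)
Definition dominated (f : {linear E -> R[i]^o}) := forall x, normc (f x) <= NE (tens xi0 x).

Definition Lp_dominated (phi : {linear L -> R[i]^o}) := forall xi, normc (phi xi) <= normL xi.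

Lemma Lp_dominated_separates xi : xi != 0 -> exists2 phi, Lp_dominated phi & phi xi != 0.
Proof.
move=> xiN; have [phi [phiN phixi]] := hahn_banach xi Ls.
exists phi => //; rewrite phixi; apply: contra xiN => /eqP[/Lp_norm_eq0->//].
Qed.

Lemma dominated_separates x : x != 0 -> exists2 f, dominated f & f x != 0.
Proof.
move=> xN; pose N x := NE (tens xi0 x).
have Nsn : is_seminorm N.
  by split=> [u v|c u]; rewrite /N ?tensDr ?tensZr ?NEn.1.1.1 ?NEn.1.1.2.
have [f [fN fx]] := hahn_banach x Nsn.
exists f => //; rewrite fx; apply: contra xN => /eqP[/NEn.2 h].
have [phi _ phixi] := Lp_dominated_separates xi0N.
have := congr1 (tcontract phi) h; rewrite tcontract_tens linear0 => /eqP.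
by rewrite scaler_eq0 (negbTE phixi).
Qed.

(* A bounded functional f is L-bounded: for phi in the dual of L,
   phi(f_oo u) = f(phi_oo u), and phi_oo u is the image of u under the rank-one
   operator phi(.) xi0. *)
Lemma ampl_dominated f u : dominated f ->
  scalar_Lnorm (ampl f u : tensor L R[i]^o) <= normL xi0 * NE u.
Proof.
move=> fd; have [phi [phiN phiE]] := hahn_banach (scalar_tensor (ampl f u)) Ls.
pose a0 (eta : L) : L := (phi eta : R[i]) *: xi0.
have a0lin : linear a0 by move=> c x y; rewrite /a0 linearP scalerDl scalerA.
pose a : {linear L -> L} := HB.pack a0 (GRing.isLinear.Build _ _ _ _ a0 a0lin).
have E1 : tens xi0 (tcontract phi u) = Lact a u.
  elim/(@tensor_ind _ L E): u {phiE} => [|xi x|u v hu hv].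
  - by rewrite !linear0 tens0r.
  - by rewrite tcontract_tens Lact_tens tensZr tensZl.
  - by rewrite !linearD tensDr /= hu hv.
have E2 : phi (scalar_tensor (ampl f u)) = f (tcontract phi u).
  elim/(@tensor_ind _ L E): u {phiE E1} => [|xi x|u v hu hv].
  - by rewrite !linear0.
  - rewrite ampl_tens scalar_tensor_tens tcontract_tens !linearZ /=.
    exact: mulrC.
  - by rewrite !linearD /= hu hv.
have := fd (tcontract phi u); rewrite -E2 phiE normc_rc ?Lp_norm_ge0// E1.
move=> h; apply: (le_trans h); apply: Lact_norm_le; first exact: NEn.1.
  exact: Lp_norm_ge0.
by move=> eta; rewrite /a /= /a0 Ls.2 mulrC ler_wpM2l ?Lp_norm_ge0.
Qed.

End Functionals.

Section FunctionalProduct.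
Context {K : comNzRingType} (E F : lmodType K).
Context (f : {linear E -> K^o}) (g : {linear F -> K^o}).
Definition functional_prod (x : E) (y : F) : K^o := (f x : K) * g y.
Lemma functional_prod_bilinear : bilinear_for
  (GRing.Scale.Law.clone _ _ *:%R _) (GRing.Scale.Law.clone _ _ *:%R _) functional_prod.
Proof.
split=> [y|x] c u v; rewrite /functional_prod/= linearP /=.
  by rewrite mulrDl -mulrA.
by rewrite mulrDr mulrCA.
Qed.
HB.instance Definition _ :=
  bilinear_isBilinear.Build K E F K^o _ _ functional_prod functional_prod_bilinear.
End FunctionalProduct.

(** * The tensor product over a space with a halving *)

Section Main.
Context d (T : measurableType d) (R : realType).
Variables (mu : {sigma_finite_measure set T -> \bar R}).
Variables (p : \bar R) (p1 : (1 <= p)%E).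
Local Notation L := (Lp mu p1).
Local Notation normL := (@Lp_norm _ _ _ mu p p1).
Variable i : {linear Lp (mu \x mu)%E p1 -> L}.
Hypothesis iiso : isometric_isomorphism i.
Variables (E F : lmodType R[i]) (NE : tensor L E -> R) (NF : tensor L F -> R).
Hypotheses (NEn : is_Lnorm NE) (NFn : is_Lnorm NF).
Hypothesis hv : halving mu p1.
Local Notation N := (pLnorm i NE NF).
Local Notation EF := (tensor E F).

(** For Phi = f (x) g, applying phi to the amplification of Phi at U is the same as slicing U by
    phi, then by f, and evaluating g. The amplification at U is at most ||xi0||^2 N(U) = 0, so all
    these numbers vanish; separation by slices, once in L and once in E, and by functionals on F
    then gives U = 0. *)
Lemma pLnorm_eq0 (U : tensor L EF) : N U = 0 -> U = 0.
Proof.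
move=> U0; have [[xi0 xi0N]|L0] := pselect (exists xi : L, xi != 0); last first.
  elim/(@tensor_ind _ L EF): U {U0} => // [xi z|u v -> ->]; last by rewrite addr0.
  have [->|h] := eqVneq xi 0; first by rewrite tens0l.
  by exfalso; apply: L0; exists xi.
have h f g phi : dominated NE xi0 f -> dominated NF xi0 g -> @Lp_dominated _ _ _ mu _ p1 phi ->
    g (tcontract f (tcontract phi U)) = 0.
  move=> fd gd phid.
  pose B := functional_prod f g : {bilinear E -> F -> R[i]^o}.
  pose Phi : {linear EF -> R[i]^o} := tlift B.
  have PhiB x y : Phi (tens x y) = B x y by exact: tlift_tens.
  (* After identifying L (x) C with L, the amplification of f(x) g(y) is the diamond product of the
     amplifications of f and g. *)
  have amplB u v : scalar_tensor (biampl i B u v) =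
      diamond i (scalar_tensor (ampl f u)) (scalar_tensor (ampl g v)).
    elim/(@tensor_ind _ L E): u => [|xi x|u u' hu hu'].
    - by rewrite linear0l !linear0 linear0l.
    - elim/(@tensor_ind _ L F): v => [|eta y|v v' hv1 hv2].
      + by rewrite linear0r !linear0 linear0r.
      + rewrite biampl_tens !ampl_tens !scalar_tensor_tens.
        by rewrite linearZl_LR linearZr_LR /= scalerA.
      + by rewrite !(linearDr, linearD) /= hv1 hv2.
    - by rewrite !(linearDl, linearD) /= hu hu'.
  have BM u v : scalar_Lnorm (biampl i B u v) <= normL xi0 ^+ 2 * (NE u * NF v).
    rewrite /scalar_Lnorm amplB; apply: (le_trans (diamond_norm iiso _ _)).
    rewrite expr2 mulrACA; apply: ler_pM; rewrite ?Lp_norm_ge0//.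
      exact: ampl_dominated.
    exact: ampl_dominated.
  have := pLnorm_universal iiso NEn NFn hv (scalar_Lnorm_seminorm mu p1)
    (@scalar_Lnorm_convex _ _ _ mu p p1) (sqr_ge0 (normL xi0)) BM PhiB U.
  rewrite U0 mulr0 => hle.
  have /Lp_norm_eq0 : normL (scalar_tensor (ampl Phi U)) = 0.
    by apply/le_anti; rewrite hle Lp_norm_ge0.
  move=> /(congr1 phi); rewrite linear0 => <-.
  elim/(@tensor_ind _ L EF): U {U0 hle} => [|xi z|u v hu hu'].
  - by rewrite !linear0.
  - rewrite tcontract_tens ampl_tens scalar_tensor_tens !linearZ /=.
    transitivity ((g (tcontract f z) : R[i]) * phi xi); first exact: mulrC.
    congr (_ * _); rewrite -[RHS]/(Phi z).
    elim/(@tensor_ind _ E F): z => [|x y|z z' hz hz'].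
    + by rewrite !linear0.
    + by rewrite tcontract_tens linearZ PhiB.
    + by rewrite !linearD /= hz hz'.
  - by rewrite !linearD /= hu hu'.
apply: (tcontract_separates (Phi := @Lp_dominated _ _ _ mu p p1)) => [xi|phi phid].
  exact: Lp_dominated_separates.
apply: (tcontract_separates (Phi := dominated NE xi0)) => [x|f fd].
  exact: dominated_separates.
apply/eqP; apply: contraT => /(dominated_separates NFn xi0N)[g gd].
by rewrite (h f g phi)// eqxx.
Qed.

Lemma pconvex_tensor_product_of_halving :
  is_pconvex_tensor_product i NE NF N (@tens _ E F : {bilinear E -> F -> EF}).
Proof.
have Ns := pLnorm_seminorm iiso NEn NFn hv.
split.
- by split; [exact: Ns|exact: pLnorm_eq0].
- exact: pLnorm_convex.
- by move=> u v; exact: pLnorm_diamond.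
move=> G NG NGn NGp B Bb.
pose phi : {linear EF -> G} := tlift B.
have phiB x y : phi (tens x y) = B x y by exact: tlift_tens.
have b0 : 0 <= Lb_norm2 i NE NF NG B.
  exact: (biop_norm_ge0 NEn.1.1 NFn.1.1 NGn.1.1 (f := biampl i B) Bb).
have phiN U : NG (ampl phi U) <= Lb_norm2 i NE NF NG B * N U.
  apply: pLnorm_universal => //; first exact: NGn.1.
  by move=> u v; exact: (biop_norm_bound NEn.1.1 NFn.1.1 NGn.1.1 (f := biampl i B) Bb).
have phib : Lbounded N NG phi by exists (Lb_norm2 i NE NF NG B).
exists phi; split => //; last first.
  move=> psi _ psiB; apply: tensor_ext => x y.
  by rewrite phiB psiB.
apply/le_anti/andP; split; first exact: (op_norm_le Ns.1 (f := ampl phi) b0 phiN).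
apply: sup_le_ub.
  exists (NG (biampl i B 0 0)), 0; rewrite /= ?(seminorm0 NEn.1.1)//.
  by exists 0; rewrite /= ?(seminorm0 NFn.1.1).
move=> _ [u /= u1 [v /= v1 <-]].
(* The value of B at (u, v) is that of phi at u <> v, and u <> v lies in the unit ball when u and v
   do. *)
rewrite -(ampl_biampl i (B := @tens _ E F) phiB).
apply: ub_le_sup; first by case: (op_norm_has_sup Ns.1 (f := ampl phi) phib).
exists (ldiamond i u v) => //=; apply: (le_trans (pLnorm_diamond _ NEn NFn u v)).
by rewrite mulr_ile1// seminorm_ge0//; [exact: NEn.1.1|exact: NFn.1.1].
Qed.

End Main.

(** * Weighted composition operators *)

Section WeightedComposition.
Context d (T : measurableType d) d' (Z : measurableType d') (R : realType).
Variables (mu : {measure set T -> \bar R}) (lam : {measure set Z -> \bar R}).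
Variables (A : set T) (phi : T -> Z) (rho : T -> R).
Hypotheses (mA : measurable A) (mphi : measurable_fun setT phi).
Hypotheses (mrho : measurable_fun setT rho) (rho0 : forall x, 0 < rho x).
(** Together the two hypotheses say that lam is the image under phi of rho mu restricted to A, and
    that preimages under phi exhaust the measurable subsets of A up to null sets. *)
Hypothesis change_var : forall h : Z -> \bar R, measurable_fun setT h ->
  (forall z, 0 <= h z)%E ->
  (\int[mu]_(x in A) ((rho x)%:E * h (phi x)) = \int[lam]_z h z)%E.
Hypothesis generating : forall C : set T, measurable C ->
  exists2 B : set Z, measurable B & \forall x \ae mu, A x -> (C x <-> B (phi x)).

Lemma measurable_preim (B : set Z) : measurable B -> measurable (phi @^-1` B).
Proof. by move=> mB; rewrite -[_ @^-1` _]setTI; exact: mphi. Qed.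

(** Positivity of rho: an integral of rho over a set vanishes only if the set is null.
    Almost-everywhere statements can therefore be moved along phi in both directions. *)
Lemma lam_null (B : set Z) : measurable B ->
  lam B = 0%E <-> mu (A `&` phi @^-1` B) = 0%E.
Proof.
move=> mB; have mpB := measurable_preim mB.
have m1 : measurable_fun setT (fun z => (\1_B z)%:E : \bar R).
  by apply/measurable_EFinP; exact: measurable_indic.
have pos z : (0 <= (\1_B z)%:E :> \bar R)%E by rewrite lee_fin.
have := change_var m1 pos; rewrite integral_indic// setIT => <-.
have mf : measurable_fun A (fun x => (rho x)%:E * (\1_B (phi x))%:E)%E.
  apply: emeasurable_funM; first by apply/measurable_EFinP; exact: measurable_funTS.
  apply: measurable_funTS; exact: (measurableT_comp m1 mphi).
split=> [h|h].
  have : (\int[mu]_(x in A) `| (rho x)%:E * (\1_B (phi x))%:E | = 0)%E.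
    rewrite -h; apply: eq_integral => x _.
    by rewrite gee0_abs// mule_ge0// lee_fin ltW.
  move/(ae_eq_integral_abs mu mA mf) => [N [mN N0 NP]].
  apply/eqP; rewrite -measure_le0 -N0; apply: le_measure; rewrite ?inE//.
    exact: measurableI.
  move=> x [Ax Bx]; apply: NP => /= /(_ Ax) /eqP.
  by rewrite indicE mem_set// mule1 eqe gt_eqF.
have null : \forall x \ae mu, A x -> ~ B (phi x).
  exists (A `&` phi @^-1` B); split => //; first exact: measurableI.
  by move=> x /= /not_implyP[Ax /contrapT Bx].
rewrite -[RHS](integral0 mu A); apply: ae_eq_integral => //.
by apply: filterS null => x h' Ax; rewrite indicE memNset ?mule0//; exact: h'.
Qed.

Lemma ae_pullback (P : Z -> Prop) : (\forall z \ae lam, P z) ->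
  \forall x \ae mu, A x -> P (phi x).
Proof.
move=> [N [mN N0 NP]]; have mpN := measurable_preim mN.
exists (A `&` phi @^-1` N); split; first exact: measurableI.
  exact/lam_null.
by move=> x /= /not_implyP[Ax nP]; split => //; exact: NP.
Qed.

Lemma ae_pushforward (P : set Z) : measurable P ->
  (\forall x \ae mu, A x -> P (phi x)) -> \forall z \ae lam, P z.
Proof.
move=> mP [N [mN N0 NP]]; exists (~` P); split => //; first exact: measurableC.
apply/lam_null; first exact: measurableC.
apply/eqP; rewrite -measure_le0 -N0; apply: le_measure; rewrite ?inE//.
  by apply: measurableI => //; apply: measurable_preim; exact: measurableC.
by move=> x [Ax nPx]; apply: NP => /= /(_ Ax).
Qed.

(** A Doob-Dynkin factorisation up to null sets: k is the supremum over rationals q of q times the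
    indicator of {q < k}, and each of these sets is a preimage. For k >= 0 the terms outside their
    set contribute 0, which does not exceed k. *)
Lemma ae_factor_ge0 (k : T -> R) : measurable_fun setT k -> (forall x, 0 <= k x) ->
  exists2 h : Z -> R, measurable_fun setT h & \forall x \ae mu, A x -> k x = h (phi x).
Proof.
move=> mk k0.
(* An enumeration of the rationals; codes of no rational give 0. *)
pose q (n : nat) : R := if unpickle n is Some r then ratr (r : rat) else 0.
have mC n : measurable (k @^-1` `]q n, +oo[%classic).
  by rewrite -[_ @^-1` _]setTI; apply: mk.
have /choice[B hB] n : exists B : set Z, measurable B /\
    \forall x \ae mu, A x -> (q n < k x <-> B (phi x)).
  have [B mB h] := generating (mC n); exists B; split => //.
  by apply: filterS h => x h /h; rewrite /= in_itv/= andbT.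
pose f n z : \bar R := (q n * \1_(B n) z)%:E.
pose H := fun z => esups (f ^~ z) 0%N.
have mH : measurable_fun setT H.
  apply: measurable_fun_esups => n; apply/measurable_EFinP.
  apply: measurable_funM => //; apply: measurable_indic; exact: (hB n).1.
exists (fine \o H); first exact: measurableT_comp.
have := ae_foralln (fun n => (hB n).2); apply: filterS => x h Ax /=.
suff -> : H (phi x) = (k x)%:E by [].
apply/le_anti/andP; split.
  apply: ub_ereal_sup => _ [n _ <-]; rewrite /f lee_fin.
  rewrite indicE; case: (boolP (phi x \in B n)) => [/set_mem/(h n Ax)|_].
    by rewrite mulr1 => /ltW.
  by rewrite mulr0.
apply/lee_subgt0Pr => e e0; rewrite -EFinB.
have ke : k x - e < k x by rewrite ltrBlDr ltrDl.
have [r] := rat_in_itvoo ke; rewrite in_itv/= => /andP[r1 r2].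
have qE : q (pickle r) = ratr r by rewrite /q pickleK.
apply: (@le_trans _ _ (f (pickle r) (phi x))); last first.
  by apply: ereal_sup_ubound; exists (pickle r).
rewrite /f lee_fin indicE mem_set ?mulr1 ?qE ?(ltW r1)//.
by apply/(h (pickle r) Ax); rewrite qE.
Qed.

Lemma ae_factor (k : T -> R) : measurable_fun setT k ->
  exists2 h : Z -> R, measurable_fun setT h & \forall x \ae mu, A x -> k x = h (phi x).
Proof.
move=> mk.
have [||h1 mh1 e1] := @ae_factor_ge0 (fun x => Num.max (k x) 0).
- by apply: measurable_maxr.
- by move=> x; rewrite le_max lexx orbT.
have [||h2 mh2 e2] := @ae_factor_ge0 (fun x => Num.max (- k x) 0).
- by apply: measurable_maxr => //; exact: measurable_funN.
- by move=> x; rewrite le_max lexx orbT.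
exists (fun z => h1 z - h2 z); first exact: measurable_funB.
apply: filterS2 e1 e2 => x e1 e2 Ax; rewrite -e1// -e2//.
by case: (leP (k x) 0); case: (leP (- k x) 0); lra.
Qed.

Section Exponent.
Variables (p : \bar R) (p1 : (1 <= p)%E).

(** Its p-th power is rho, as the change of variables requires. For p = oo only null sets count and
    the weight is 1. *)
Definition weight (x : T) : R := if p is r%:E then rho x `^ r^-1 else 1.

Lemma weight_gt0 x : 0 < weight x.
Proof. by rewrite /weight; case: p => // r; exact: powR_gt0. Qed.

Lemma measurable_weight : measurable_fun setT weight.
Proof.
rewrite /weight; case: p => [r||]; do ?exact: measurable_cst.
exact: (@measurableT_comp _ _ _ _ _ _ (@powR R ^~ r^-1)).
Qed.

Lemma Lnorm_ley d0 (S : measurableType d0) (nu : {measure set S -> \bar R}) (f : S -> R)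
    (M : \bar R) : (0 <= M)%E ->
  ('N[nu]_+oo[EFin \o f] <= M <-> \forall x \ae nu, `|f x|%:E <= M)%E.
Proof.
move=> M0; rewrite unlock; case: ifPn => [muT|].
  by split=> [/ess_supP|h]; [exact: filterS|apply/ess_supP; apply: filterS h].
rewrite -leNgt measure_le0 => /eqP muT; split => // _.
by exists setT; split.
Qed.

Lemma wcomp_Lnorm (k : Z -> R) : measurable_fun setT k -> (forall z, 0 <= k z) ->
  ('N[mu]_p[EFin \o (fun x => if x \in A then weight x * k (phi x) else 0)%R] =
   'N[lam]_p[EFin \o k])%E.
Proof.
move=> mk k0; rewrite /weight; case: p p1 => [r||] r1.
- have re1 : 1 <= r by rewrite -lee_fin.
  have r0 : r != 0 by rewrite gt_eqF// (lt_le_trans ltr01).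
  rewrite unlock; congr (_ `^ _)%E.
  pose h z := ((k z) `^ r)%:E.
  have mh : measurable_fun setT h.
    apply/measurable_EFinP.
    exact: (@measurableT_comp _ _ _ _ _ _ (@powR R ^~ r)).
  transitivity (\int[lam]_z h z)%E; last first.
    by apply: eq_integral => z _; rewrite /= ger0_norm.
  rewrite -change_var//; last by move=> z; rewrite lee_fin powR_ge0.
  rewrite [RHS]integral_mkcond; apply: eq_integral => x _ /=.
  rewrite patchE; case: ifP => _; last by rewrite normr0 powR0.
  rewrite ger0_norm ?mulr_ge0 ?powR_ge0// powRM ?powR_ge0//.
  by rewrite powRVK// ltW.
(* The norms are compared through their upper bounds M, since a bound almost everywhere passes along
   phi in both directions. *)
- have le M : (0 <= M)%E -> ('N[mu]_+oo[EFin \o (fun x => if x \in A then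
      1 * k (phi x) else 0)%R] <= M <-> 'N[lam]_+oo[EFin \o k] <= M)%E.
    move=> M0; rewrite !Lnorm_ley//; split=> h.
      apply: ae_pushforward.
        have mn : measurable_fun setT (fun z => `|k z|%:E).
          by apply/measurable_EFinP; exact: measurableT_comp.
        have := mn measurableT _ (emeasurable_itv `]-oo, M]); rewrite setTI.
        by congr measurable; apply/seteqP; split=> z /=; rewrite in_itv.
      apply: filterS h => x + Ax; rewrite mem_set//.
      by rewrite mul1r.
    apply: filterS (ae_pullback h) => x hx; case: ifP => [/set_mem/hx|_].
      by rewrite mul1r.
    by rewrite normr0.
  by apply/le_anti/andP; split; apply/le; rewrite ?Lnorm_ge0.
- by have := r1; rewrite leeNy_eq.
Qed.


Local Notation Lm := (Lp mu p1).
Local Notation Ll := (Lp lam p1).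

Definition wcomp_fun (h : Z -> R[i]) (x : T) : R[i] :=
  if x \in A then (weight x)%:C%C * h (phi x) else 0.

Lemma normc_wcomp_fun h : normc \o wcomp_fun h =
  fun x => if x \in A then weight x * (normc \o h) (phi x) else 0.
Proof.
apply/funext => x; rewrite /wcomp_fun /=; case: ifP => _; last exact: ComplexField.Normc.normc0.
by rewrite ComplexField.Normc.normcM normc_rc// ltW// weight_gt0.
Qed.

Lemma measurable_wcomp_fun (j : R[i] -> R) (h : Z -> R[i]) : j 0 = 0 ->
  (forall (t : R) z, j (t%:C%C * z) = t * j z) ->
  measurable_fun setT (j \o h) -> measurable_fun setT (j \o wcomp_fun h).
Proof.
move=> j0 jM mh.
have -> : j \o wcomp_fun h = \1_A \* (weight \* ((j \o h) \o phi)).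
  apply/funext => x; rewrite /wcomp_fun /= indicE.
  by case: (x \in A); rewrite ?mul1r ?mul0r.
apply: measurable_funM; first exact: measurable_indic.
apply: measurable_funM; first exact: measurable_weight.
exact: measurableT_comp.
Qed.

Lemma ReM (t : R) z : complex.Re (t%:C%C * z) = t * complex.Re z.
Proof. by case: z => a b /=; rewrite mul0r subr0. Qed.

Lemma ImM (t : R) z : complex.Im (t%:C%C * z) = t * complex.Im z.
Proof. by case: z => a b /=; rewrite mul0r addr0. Qed.

Lemma wcomp_finite_norm (h : Z -> R[i]) :
  measurable_fun setT (@complex.Re R \o h) -> measurable_fun setT (@complex.Im R \o h) ->
  ('N[mu]_p[EFin \o (normc \o wcomp_fun h)] = 'N[lam]_p[EFin \o (normc \o h)])%E.
Proof.
move=> mr mi; rewrite normc_wcomp_fun wcomp_Lnorm//.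
  exact: measurable_normc.
by move=> z; exact: normc_ge0.
Qed.

Lemma wcomp_Lpfun (h : Z -> R[i]) : h \in Lpfun_pred lam p1 ->
  wcomp_fun h \in Lpfun_pred mu p1.
Proof.
move=> /Lpfun_predP[mr mi hN]; apply/Lpfun_predP; split.
- by apply: measurable_wcomp_fun => //; exact: ReM.
- by apply: measurable_wcomp_fun => //; exact: ImM.
- by rewrite /finite_norm wcomp_finite_norm.
Qed.

Definition wcomp (xi : Ll) : Lm := Lp_class (wcomp_Lpfun (Lp_reprP xi)).

Lemma Lp_repr_wcomp xi :
  \forall x \ae mu, Lp_repr (wcomp xi) x = wcomp_fun (Lp_repr xi) x.
Proof. by apply: filterS (Lp_repr_class (wcomp_Lpfun (Lp_reprP xi))) => x /(_ I). Qed.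

Lemma wcomp_linear : linear wcomp.
Proof.
move=> c xi eta; apply/Lp_eqP.
have hD := ae_pullback (Lp_reprD (c *: xi) eta).
have hZ := ae_pullback (Lp_reprZ c xi).
have h1 := Lp_repr_wcomp (c *: xi + eta).
have h2 := Lp_reprD (c *: wcomp xi) (wcomp eta).
have h3 := Lp_reprZ c (wcomp xi).
have h4 := Lp_repr_wcomp xi; have h5 := Lp_repr_wcomp eta.
near=> x => _.
rewrite (near h1 x)//= (near h2 x)//= (near h3 x)//= (near h4 x)//= (near h5 x)//=.
rewrite /wcomp_fun; case: ifPn => [/set_mem Ax|_]; last by rewrite mulr0 addr0.
rewrite (near hD x _ Ax)// (near hZ x _ Ax)//.
by rewrite mulrDr mulrCA.
Unshelve. all: by end_near.
Qed.

HB.instance Definition _ := GRing.isLinear.Build R[i] Ll Lm _ wcomp wcomp_linear.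

Lemma wcomp_norm xi : Lp_norm (wcomp xi) = Lp_norm xi.
Proof.
rewrite /wcomp Lp_norm_class wcomp_finite_norm//.
  by have /Lpfun_predP[] := Lp_reprP xi.
by have /Lpfun_predP[] := Lp_reprP xi.
Qed.

Lemma wcomp_proj (B : set Z) (mB : measurable B) (mpB : measurable (phi @^-1` B)) xi :
  wcomp (Lp_proj mB xi) = Lp_proj mpB (wcomp xi).
Proof.
apply/Lp_eqP.
have h1 := Lp_repr_wcomp (Lp_proj mB xi).
have h2 := Lp_repr_wcomp xi.
have h3 := Lp_repr_proj mpB (wcomp xi).
have h4 := ae_pullback (Lp_repr_proj mB xi).
near=> x => _.
rewrite (near h1 x)//= (near h3 x)//= (near h2 x)//= /wcomp_fun.
case: ifPn => [/set_mem Ax|_]; last by case: ifP.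
rewrite (near h4 x _ Ax)//.
have -> : (x \in phi @^-1` B) = (phi x \in B) by apply/idP/idP => /set_mem/mem_set.
by case: ifP => _; rewrite ?mulr0.
Unshelve. all: by end_near.
Qed.

Lemma wcomp_band xi : Lp_proj mA (wcomp xi) = wcomp xi.
Proof.
apply/Lp_eqP; apply: filterS2 (Lp_repr_proj mA (wcomp xi)) (Lp_repr_wcomp xi) => x -> -> _.
by rewrite /wcomp_fun; case: (x \in A).
Qed.

(** After division by the weight, the real and the imaginary part factor through phi; the factor has
    finite norm because composition is isometric. *)
Lemma wcomp_onto eta : Lp_proj mA eta = eta -> exists xi, wcomp xi = eta.
Proof.
move=> Aeta; have /Lpfun_predP[mr mi etaN] := Lp_reprP eta.
have miw : measurable_fun setT (fun x => (weight x)^-1).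
  rewrite (_ : (fun x => _) = (@powR R ^~ (-1)) \o weight).
    exact: measurableT_comp measurable_weight.
  by apply/funext => x /=; rewrite powR_inv1// ltW// weight_gt0.
have [h1 mh1 e1] := ae_factor (measurable_funM miw mr).
have [h2 mh2 e2] := ae_factor (measurable_funM miw mi).
pose h z : R[i] := (h1 z +i* h2 z)%C.
have E : \forall x \ae mu, Lp_repr eta x = wcomp_fun h x.
  have h3 := Lp_repr_proj mA eta; rewrite Aeta in h3.
  apply: filterS3 h3 e1 e2 => x h3 e1 e2.
  rewrite h3 /wcomp_fun; case: ifPn => // /set_mem Ax.
  rewrite /h -(e1 Ax) -(e2 Ax) /=.
  have w0 : weight x != 0 by rewrite gt_eqF// weight_gt0.
  case: (Lp_repr eta x) => a b /=; rewrite -[RHS]/((_ +i* _)%C).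
  by apply/eqP; rewrite eq_complex /= !mul0r subr0 addr0 !mulVKf// !eqxx.
have hL : h \in Lpfun_pred lam p1.
  apply/Lpfun_predP; split => //.
  rewrite /finite_norm -wcomp_finite_norm//.
  apply: le_lt_trans etaN; apply: le_Lnorm => //.
  - apply: measurable_normc.
      by apply: measurable_wcomp_fun => //; exact: ReM.
    by apply: measurable_wcomp_fun => //; exact: ImM.
  - exact: measurable_Lp_repr.
  - by move=> x; exact: normc_ge0.
  - by apply: filterS E => x /= ->.
exists (Lp_class hL); apply/Lp_eqP.
have h4 := ae_pullback (Lp_repr_class hL).
apply: filterS3 (Lp_repr_wcomp (Lp_class hL)) h4 E => x -> h4 -> _.
by rewrite /wcomp_fun; case: ifPn => // /set_mem Ax; rewrite h4.
Qed.

Lemma wcomp_image_band (B : set Z) (mB : measurable B)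
    (mpB : measurable (A `&` phi @^-1` B)) :
  wcomp @` range (Lp_proj mB : Ll -> Ll) = range (Lp_proj mpB : Lm -> Lm).
Proof.
have mp := measurable_preim mB.
apply/seteqP; split=> [_ [_ [xi _ <-] <-]|_ [eta _ <-]].
  apply/bandP; rewrite -(Lp_projI mA mp) (wcomp_proj mB mp).
  by rewrite Lp_proj_idem -(wcomp_proj mB mp) wcomp_band.
have [|xi xiE] := @wcomp_onto (Lp_proj mpB eta).
  apply/bandP; exists (Lp_proj mp eta) => //.
  by rewrite (Lp_projI mA mp mpB).
exists (Lp_proj mB xi); first by exists xi.
rewrite (wcomp_proj mB mp) xiE -(Lp_projI mA mp) (Lp_projC mp mA).
by rewrite Lp_proj_idem.
Qed.

Lemma wcomp_preimage_band (C : set T) (mC : measurable C) (mAC : measurable (A `&` C)) :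
  exists (B : set Z) (mB : measurable B),
  wcomp @` range (Lp_proj mB : Ll -> Ll) = range (Lp_proj mAC : Lm -> Lm).
Proof.
have [B mB BC] := generating mC; exists B, mB.
have mp := measurableI _ _ mA (measurable_preim mB).
rewrite (wcomp_image_band mB mp).
suff -> : (Lp_proj mp : Lm -> Lm) = Lp_proj mAC by [].
apply/funext => xi; apply/Lp_eqP.
apply: filterS3 (Lp_repr_proj mp xi) (Lp_repr_proj mAC xi) BC => x -> -> h _.
rewrite !in_setI; case: (boolP (x \in A)) => //= /set_mem/h BCx.
by have -> : (x \in phi @^-1` B) = (x \in C) by apply/idP/idP => /set_mem/BCx/mem_set.
Qed.

End Exponent.
End WeightedComposition.

(** * Isometries between the L_p-spaces of two parts of X *)

Section Transport.
Context d (T : measurableType d) (R : realType) (mu : {measure set T -> \bar R}).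
Context (p : \bar R) (p1 : (1 <= p)%E).
Local Notation L := (Lp mu p1).
Local Notation normL := (@Lp_norm _ _ _ mu p p1).
Local Notation band mA := (range (Lp_proj mA : L -> L)).

Let Ls := Lp_norm_seminorm mu p1.

(** An isometry of L_p(A) into L_p(B) that maps bands to bands, extended by 0 to L; this avoids a
    separate type for L_p(A). *)
Definition transport (A B : set T) (mA : measurable A) (mB : measurable B) :=
  exists V : {linear L -> L}, [/\ forall xi, normL (V xi) = normL (Lp_proj mA xi),
    forall xi, Lp_proj mB (V xi) = V xi &
    forall (C : set T) (mC : measurable C), exists (D : set T) (mD : measurable D),
      V @` band mC = band mD].

Lemma Lp_proj_disj (A B : set T) (mA : measurable A) (mB : measurable B) (xi : L) :
  A `&` B = set0 -> Lp_proj mA (Lp_proj mB xi) = 0.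
Proof.
move=> AB; rewrite (Lp_projI _ _ (measurableI _ _ mA mB)).
by rewrite (Lp_proj_ext _ measurable0)// (Lp_proj0 measurable0) ?measure0.
Qed.

Lemma Lp_proj_sub (A B : set T) (mA : measurable A) (mB : measurable B) (xi : L) :
  B `<=` A -> Lp_proj mB xi = xi -> Lp_proj mA xi = xi.
Proof.
move=> BA Bxi; rewrite -Bxi (Lp_projI _ _ (measurableI _ _ mA mB)).
by apply: Lp_proj_ext; rewrite setIidr.
Qed.

Lemma Lp_projU (A B : set T) (mA : measurable A) (mB : measurable B)
    (mU : measurable (A `|` B)) (xi : L) :
  (forall xi : L, Lp_proj mA (Lp_proj mB xi) = 0) ->
  Lp_proj mU xi = Lp_proj mA xi + Lp_proj mB xi.
Proof.
move=> AB; apply/Lp_eqP.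
have := Lp_repr_proj mA (Lp_proj mB xi); rewrite AB => h1.
apply: filterS3 h1 (filterI (Lp_repr_proj mA xi) (Lp_repr_proj mB xi))
  (filterI (Lp_repr_proj mU xi) (filterI (Lp_reprD (Lp_proj mA xi) (Lp_proj mB xi))
    (Lp_repr0 mu p1))) => x h1 [h2 h3] [-> [-> h0]] _.
move: h1; rewrite h0 h2 h3 in_setU; case: (x \in A); case: (x \in B) => /=;
  rewrite ?addr0 ?add0r// => <-.
by rewrite addr0.
Qed.

(** The sum V + V' is isometric because A and A' split the argument while B and B' keep the two
    values disjoint. *)
Lemma transport_sum (A A' B B' : set T) (mA : measurable A) (mA' : measurable A')
    (mB : measurable B) (mB' : measurable B') :
  A `&` A' = set0 -> A `|` A' = setT -> B `&` B' = set0 ->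
  transport mA mB -> transport mA' mB' ->
  exists2 S : {linear L -> L}, band_isometry S &
    forall xi, Lp_proj (measurableU _ _ mB mB') (S xi) = S xi.
Proof.
move=> AA' AUA' BB' [V [VN VB Vb]] [V' [V'N V'B V'b]].
have PAA' (xi : L) : Lp_proj mA (Lp_proj mA' xi) = 0 by exact: Lp_proj_disj.
have PA'A (xi : L) : Lp_proj mA' (Lp_proj mA xi) = 0 by rewrite Lp_projC.
have PBB' (xi : L) : Lp_proj mB (Lp_proj mB' xi) = 0 by exact: Lp_proj_disj.
have split (xi : L) : xi = Lp_proj mA xi + Lp_proj mA' xi.
  rewrite -(Lp_projU (measurableU _ _ mA mA') _ PAA')// -[LHS]Lp_projT.
  by apply: Lp_proj_ext; rewrite AUA'.
have VA' xi : V (Lp_proj mA' xi) = 0.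
  by apply: Lp_norm_eq0; rewrite VN PAA' (seminorm0 Ls).
have V'A xi : V' (Lp_proj mA xi) = 0.
  by apply: Lp_norm_eq0; rewrite V'N PA'A (seminorm0 Ls).
have VA xi : V (Lp_proj mA xi) = V xi by rewrite {2}(split xi) linearD VA' addr0.
have V'A' xi : V' (Lp_proj mA' xi) = V' xi by rewrite {2}(split xi) linearD V'A add0r.
exists (V \+ V'); last first.
  move=> xi /=; rewrite linearD; congr (_ + _).
    by apply: Lp_proj_sub (VB xi) => x; left.
  by apply: Lp_proj_sub (V'B xi) => x; right.
split=> [xi|C mC] /=.
  rewrite (Lp_norm_split (VB xi)); last by rewrite -V'B PBB'.
  rewrite VN V'N -(Lp_norm_split (Lp_proj_idem _ _)) ?PAA'//.
  by rewrite -split.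
have [D [mD VD]] := Vb C mC; have [D' [mD' VD']] := V'b C mC.
have BD (xi : L) : Lp_proj mB (Lp_proj mD xi) = Lp_proj mD xi.
  have : (V @` band mC) (Lp_proj mD xi) by rewrite VD; exists xi.
  by move=> [z _ <-].
have B'D (xi : L) : Lp_proj mB' (Lp_proj mD' xi) = Lp_proj mD' xi.
  have : (V' @` band mC) (Lp_proj mD' xi) by rewrite VD'; exists xi.
  by move=> [z _ <-].
have DD' (xi : L) : Lp_proj mD (Lp_proj mD' xi) = 0.
  by rewrite -BD -[Lp_proj mD' xi]B'D (Lp_projC mD mB') PBB'.
have mDD := measurableU _ _ mD mD'.
exists (D `|` D'), mDD; apply/seteqP; split=> [_ [xi Cxi <-]|zeta] /=.
  have VDxi : band mD (V xi) by rewrite -VD; exists xi.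
  have VDxi' : band mD' (V' xi) by rewrite -VD'; exists xi.
  apply/bandP; rewrite linearD; congr (_ + _).
    by move/bandP: VDxi; apply: Lp_proj_sub => x; left.
  by move/bandP: VDxi'; apply: Lp_proj_sub => x; right.
move=> [z _ <-]; rewrite (Lp_projU mDD _ DD').
have : band mD (Lp_proj mD z) by exists z.
rewrite -VD => -[x1 /bandP Cx1 <-].
have : band mD' (Lp_proj mD' z) by exists z.
rewrite -VD' => -[x2 /bandP Cx2 <-].
exists (Lp_proj mA x1 + Lp_proj mA' x2).
  apply/bandP; rewrite linearD /= (Lp_projC mC) Cx1.
  by rewrite (Lp_projC mC mA') Cx2.
by rewrite /= !linearD /= VA VA' V'A V'A' addr0 add0r.
Qed.

(** The operator V1 V0^-1 P_A, through a common model [lam]. Surjectivity of V0 onto L_p(A) is what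
    makes the inverse available. *)
Lemma transport_factor d' (Z : measurableType d') (lam : {measure set Z -> \bar R})
    (A B : set T) (mA : measurable A) (mB : measurable B)
    (V0 V1 : {linear Lp lam p1 -> L}) :
  (forall xi, normL (V0 xi) = Lp_norm xi) -> (forall xi, normL (V1 xi) = Lp_norm xi) ->
  (forall xi, Lp_proj mA (V0 xi) = V0 xi) ->
  (forall eta, Lp_proj mA eta = eta -> exists xi, V0 xi = eta) ->
  (forall (C : set T) (mC : measurable C) (mAC : measurable (A `&` C)),
    exists (D : set Z) (mD : measurable D),
    V0 @` range (Lp_proj mD : Lp lam p1 -> Lp lam p1) = band mAC) ->
  (forall xi, Lp_proj mB (V1 xi) = V1 xi) ->
  (forall (D : set Z) (mD : measurable D), exists (C : set T) (mC : measurable C),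
    V1 @` range (Lp_proj mD : Lp lam p1 -> Lp lam p1) = band mC) ->
  transport mA mB.
Proof.
move=> V0N V1N V0A V0onto V0b V1B V1b.
have V0inj x y : V0 x = V0 y -> x = y.
  move=> xy; apply/eqP; rewrite -subr_eq0; apply/eqP/Lp_norm_eq0.
  by rewrite -V0N linearB/= xy subrr (seminorm0 Ls).
have ex eta : exists xi, V0 xi = Lp_proj mA eta.
  by apply: V0onto; exact: Lp_proj_idem.
pose W0 eta := sval (cid (ex eta)).
have W0E eta : V0 (W0 eta) = Lp_proj mA eta by rewrite /W0; case: cid.
have W0lin : linear W0.
  by move=> c x y; apply: V0inj; rewrite W0E !linearP/= !W0E.
pose W : {linear L -> Lp lam p1} := HB.pack W0 (GRing.isLinear.Build _ _ _ _ W0 W0lin).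
exists (V1 \o W); split=> [xi|xi|C mC] /=.
- by rewrite V1N -V0N W0E.
- exact: V1B.
- have mAC := measurableI _ _ mA mC.
  have [D [mD DE]] := V0b C mC mAC; have [C' [mC' C'E]] := V1b D mD.
  exists C', mC'; rewrite -C'E -(image_comp W V1); congr (_ @` _).
  apply/seteqP; split=> [_ [xi /bandP Cxi <-]|z Dz].
    have : band mAC (Lp_proj mA xi).
      by exists xi => //; rewrite -(Lp_projI mA mC) Cxi.
    by rewrite -DE -W0E => -[z Dz /V0inj zE]; rewrite -[W xi]/(W0 xi) -zE.
  have : (V0 @` range (Lp_proj mD : Lp lam p1 -> Lp lam p1)) (V0 z) by exists z.
  rewrite DE => /bandP h; exists (V0 z).
    by apply/bandP; rewrite -h -(Lp_projI mA mC) (Lp_projC mA) Lp_proj_idem.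
  by apply: V0inj; rewrite W0E V0A.
Qed.

Lemma halving_of_transports (A A' B1 B2 B1' B2' : set T)
    (mA : measurable A) (mA' : measurable A') (mB1 : measurable B1)
    (mB2 : measurable B2) (mB1' : measurable B1') (mB2' : measurable B2') :
  A `&` A' = set0 -> A `|` A' = setT ->
  B1 `<=` A -> B2 `<=` A -> B1' `<=` A' -> B2' `<=` A' ->
  B1 `&` B2 = set0 -> B1' `&` B2' = set0 ->
  transport mA mB1 -> transport mA mB2 -> transport mA' mB1' -> transport mA' mB2' ->
  halving mu p1.
Proof.
move=> AA' AUA' s1 s2 s1' s2' B12 B12' t1 t2 t1' t2'.
have disj (X Y : set T) : X `<=` A -> Y `<=` A' -> X `&` Y = set0.
  move=> XA YA'; apply/seteqP; split=> // x [Xx Yx]; rewrite -AA'.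
  by split; [exact: XA|exact: YA'].
have [S Sb SB] := transport_sum AA' AUA' (disj _ _ s1 s1') t1 t1'.
have [S' S'b S'B] := transport_sum AA' AUA' (disj _ _ s2 s2') t2 t2'.
exists S, S'; split => //.
apply/seteqP; split=> [z [[x _ <-] [y _ xy]]|_ ->] /=; last first.
  by split; exists 0; rewrite ?linear0.
rewrite -SB -xy -S'B; apply: Lp_proj_disj.
apply/seteqP; split=> // x' [[h|h] [k|k]].
- by rewrite -B12.
- by rewrite -(disj _ _ s1 s2').
- by rewrite -(disj _ _ s2 s1').
- by rewrite -B12'.
Qed.

End Transport.

(** * Measures with a countable basis *)

Section EquivalentFiniteMeasure.
Context d (T : measurableType d) (R : realType).
Variables (mu : {sigma_finite_measure set T -> \bar R}).
Variables (F : nat -> set T) (mF : forall k, measurable (F k)).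
Hypothesis Ffin : forall k, (mu (F k) < +oo)%E.
Hypothesis FT : \bigcup_k F k = setT.

(** The weights make the sum of c0 k * mu (F k) at most 1; the summand 1 avoids division by 0. *)
Let c0 (k : nat) : R := 1 / (2 ^ k.+1)%:R / (1 + fine (mu (F k))).
Let c0_gt0 k : 0 < c0 k.
Proof.
by rewrite !divr_gt0// ?ltr0n ?expn_gt0// ltr_pwDl// fine_ge0.
Qed.
Let c (k : nat) : {nonneg R} := NngNum (ltW (c0_gt0 k)).

Definition finite_equiv : set T -> \bar R := mseries (fun k => mscale (c k) (mrestr mu (mF k))) 0.

HB.instance Definition _ := Measure.on finite_equiv.

Let finite_equivE A : finite_equiv A = (\sum_(k <oo) (c0 k)%:E * mu (A `&` F k))%E.
Proof. by []. Qed.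

Let finite_equiv_fin : fin_num_fun finite_equiv.
Proof.
apply: lty_fin_num_fun; apply: (@le_lt_trans _ _ 1%:E); last exact: ltry.
rewrite [leLHS]finite_equivE.
apply: le_trans (epsilon_trick0 xpredT ler01); apply: lee_nneseries => k _.
  by rewrite mule_ge0// lee_fin ltW.
rewrite setTI -(@fineK _ (mu (F k))) ?ge0_fin_numE// -EFinM lee_fin.
rewrite /c0 mulrAC ler_pdivrMr; last by rewrite ltr_pwDl// fine_ge0.
by rewrite ler_pM2l ?divr_gt0// ?ltr0n ?expn_gt0// lerDr.
Qed.

HB.instance Definition _ := Measure_isFinite.Build _ _ _ finite_equiv finite_equiv_fin.

Lemma finite_equiv_eq0 A : measurable A -> finite_equiv A = 0%E <-> mu A = 0%E.
Proof.
move=> mA; rewrite finite_equivE; split=> [h|h].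
  have hk k : mu (A `&` F k) = 0%E.
    have : ((c0 k)%:E * mu (A `&` F k) <= 0)%E.
      have h0 j : (0 <= (c0 j)%:E * mu (A `&` F j))%E by rewrite mule_ge0// lee_fin ltW.
      rewrite -h; apply: le_trans (nneseries_lim_ge k.+1 (fun j _ _ => h0 j)).
      by rewrite big_nat_recr//= leeDr// sume_ge0.
    rewrite pmule_rle0 ?lte_fin// => h1.
    by apply/eqP; rewrite -measure_le0.
  rewrite -[A]setIT -FT setI_bigcupr.
  have mAF k : measurable (A `&` F k) by exact: measurableI.
  have mU : measurable (\bigcup_i (A `&` F i)) by apply: bigcup_measurable => k _.
  apply/negligibleP => //; apply: negligible_bigcup => k.
  by apply/(negligibleP mu (mAF k)); exact: hk.
rewrite eseries0// => k _ _.
by rewrite (subset_measure0 (measurableI _ _ mA (mF k)) mA) ?mule0// => x [].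
Qed.

Lemma finite_density : exists rho : T -> R, [/\ measurable_fun setT rho,
  forall x, 0 < rho x &
  forall A f, measurable A -> measurable_fun setT f -> (forall x, 0 <= f x)%E ->
  (\int[mu]_(x in A) ((rho x)%:E * f x) = \int[finite_equiv]_(x in A) f x)%E].
Proof.
have dom : finite_equiv `<< mu.
  apply/null_content_dominatesP => A mA muA; exact/finite_equiv_eq0.
pose g := Radon_Nikodym_SigmaFinite.f finite_equiv mu.
have g0 := Radon_Nikodym_SigmaFinite.f_ge0 dom.
have gfin := Radon_Nikodym_SigmaFinite.f_fin_num dom.
have mg : measurable_fun setT g.
  exact: measurable_int (Radon_Nikodym_SigmaFinite.f_integrable dom).
have mZ : measurable (g @^-1` [set 0%E]).
  by rewrite -[_ @^-1` _]setTI; exact: mg.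
have muZ : mu (g @^-1` [set 0%E]) = 0%E.
  apply/finite_equiv_eq0 => //; rewrite (Radon_Nikodym_SigmaFinite.f_integral dom)//.
  by rewrite (eq_integral (cst 0%E)) ?integral0// => x /set_mem.
pose Z := g @^-1` [set 0%E].
(* The Radon-Nikodym derivative may vanish on a null set; adding 1 there makes the density positive
   everywhere. *)
pose rho x : R := \1_Z x + fine (g x).
have fg0 x : 0 <= fine (g x) by rewrite fine_ge0// g0.
exists rho; split.
- apply: measurable_funD; first exact: measurable_indic.
  exact: measurableT_comp mg.
- move=> x; rewrite /rho indicE; case: (boolP (x \in Z)) => [_|xZ].
    by rewrite ltr_pwDl.
  rewrite add0r; apply: fine_gt0; rewrite lt0e g0 andbT ltey_eq gfin andbT.
  by apply: contraNneq xZ => gx; exact/mem_set.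
move=> A f mA mf f0.
rewrite -(Radon_Nikodym_SigmaFinite.change_of_variables dom f0 mA (measurable_funTS mf)).
have mrho : measurable_fun setT rho.
  apply: measurable_funD; first exact: measurable_indic.
  exact: measurableT_comp mg.
apply: ae_eq_integral => //.
- apply: measurable_funTS; apply: emeasurable_funM => //.
  exact/measurable_EFinP.
- by apply: measurable_funTS; exact: emeasurable_funM.
exists Z; split => // x /= h; apply: contrapT => xZ; apply: h => _.
rewrite /rho indicE memNset// add0r fineK ?gfin//.
exact: muleC.
Qed.

Lemma equivalent_finite_measure :
  exists (m : {finite_measure set T -> \bar R}) (rho : T -> R),
  [/\ measurable_fun setT rho, forall x, 0 < rho x,
    forall A f, measurable A -> measurable_fun setT f -> (forall x, 0 <= f x)%E ->
      (\int[mu]_(x in A) ((rho x)%:E * f x) = \int[m]_(x in A) f x)%E &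
    forall N, measurable N -> m N = 0%E <-> mu N = 0%E].
Proof.
have [rho [mrho rho0 density]] := finite_density.
by exists finite_equiv, rho; split => // N mN; exact: finite_equiv_eq0.
Qed.

End EquivalentFiniteMeasure.

(** * Coding a sequence of sets by one real function *)

Section GeneratingFunction.
Context d (T : measurableType d) (R : realType) (B : nat -> set T).
Hypothesis mB : forall n, measurable (B n).

(* In base 4, an expansion with digits 0 and 1 is determined by its value. *)
Definition digits (n : nat) (x : T) : \bar R :=
  (\sum_(k <oo) ((4 ^+ k)^-1 * \1_(B (n + k)) x)%:E)%E.

Let term_ge0 n x k : (0 <= ((4 ^+ k)^-1 * \1_(B (n + k)) x)%:E :> \bar R)%E.
Proof. by rewrite lee_fin mulr_ge0// invr_ge0 exprn_ge0. Qed.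

Lemma digits_ge0 n x : (0 <= digits n x)%E.
Proof. by apply: nneseries_ge0 => k _ _. Qed.

(** The comparison of 4^-k with 2^-k is crude but enough: the tail after the leading digit
    contributes at most 2 / 4 < 1, so that digit is read off by comparing with 1. *)
Lemma digits_le2 n x : (digits n x <= 2%:E)%E.
Proof.
have h2 : (0 <= 2 :> R) by [].
apply: le_trans (epsilon_trick0 xpredT h2); apply: lee_nneseries => // k _.
rewrite lee_fin; apply: (@le_trans _ _ (4 ^+ k)^-1).
  by rewrite ler_piMr ?invr_ge0 ?exprn_ge0// indicE; case: (_ \in _).
rewrite natrX exprS invfM mulrA divff ?mul1r// lef_pV2 ?posrE ?exprn_gt0//.
by apply: lerXn2r; rewrite ?nnegrE// ler_nat.
Qed.

Lemma digitsS n x : (digits n x = (\1_(B n) x)%:E + (4^-1)%:E * digits n.+1 x)%E.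
Proof.
rewrite {1}/digits nneseries_recl//; congr (_ + _)%E.
  by rewrite addn0 expr0 invr1 mul1r.
rewrite -nneseriesZl; last by move=> k _; exact: term_ge0.
rewrite -(nneseries_addn 1)//; apply: eq_eseriesr => k _.
by rewrite -EFinM addn1 exprS invfM mulrA addnS addSn.
Qed.

Definition digit_fun n x : R := fine (digits n x).

Lemma digits_fin n x : digits n x \is a fin_num.
Proof. by rewrite ge0_fin_numE ?digits_ge0// (le_lt_trans (digits_le2 n x))// ltry. Qed.

Lemma digit_fun_bnd n x : 0 <= digit_fun n x <= 2.
Proof. by rewrite -!lee_fin fineK ?digits_fin// digits_ge0 digits_le2. Qed.

Lemma digit_funS n x : digit_fun n x = \1_(B n) x + 4^-1 * digit_fun n.+1 x.
Proof.
by rewrite /digit_fun digitsS fineD ?fineM ?digits_fin// fin_numM ?digits_fin.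
Qed.

Lemma measurable_digit_fun n : measurable_fun setT (digit_fun n).
Proof.
apply: measurableT_comp => //; apply: ge0_emeasurable_sum => // k _.
by apply/measurable_EFinP; exact: measurable_funM.
Qed.

Lemma digit_funP n x : B n x <-> 1 <= digit_fun n x.
Proof.
have /andP[h1 h2] := digit_fun_bnd n.+1 x.
rewrite digit_funS indicE; split=> [/mem_set->|]; first by rewrite /=; lra.
by case: (boolP (x \in B n)) => [/set_mem//|_] /=; lra.
Qed.

(** Deletes the leading digit; its iterates make every digit a Borel function of the value. *)
Let shift (y : R) : R := 4 * (y - \1_[set` `[1, +oo[] y).

Lemma digit_fun_shift n x : digit_fun n.+1 x = shift (digit_fun n x).
Proof.
rewrite /shift.
have -> : \1_[set` `[1, +oo[] (digit_fun n x) = \1_(B n) x :> R.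
  rewrite !indicE; congr (_%:R); congr (nat_of_bool _).
  apply/idP/idP => /set_mem h; apply/mem_set; last first.
    by rewrite /= in_itv/= andbT; exact/digit_funP.
  by apply/digit_funP; move: h; rewrite /= in_itv/= andbT.
by rewrite (digit_funS n); lra.
Qed.

Lemma digit_set n : exists2 E : set R, measurable E & forall x, B n x <-> E (digit_fun 0 x).
Proof.
have ms : measurable_fun setT shift.
  apply: measurable_funM => //; apply: measurable_funB => //.
exists ((iter n shift) @^-1` `[1, +oo[).
  elim: n => [|n IHn]; first exact: measurable_itv.
  rewrite -[X in measurable X]setTI.
  rewrite (_ : _ @^-1` _ = shift @^-1` ((iter n shift) @^-1` `[1, +oo[)).
    exact: ms.
  by apply/funext => y; rewrite /= -iterS iterSr.
move=> x; rewrite digit_funP /= in_itv/= andbT.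
suff -> : iter n shift (digit_fun 0 x) = digit_fun n x by [].
by elim: n => // n IHn; rewrite iterS IHn digit_fun_shift.
Qed.

End GeneratingFunction.

(** * A function that generates the measurable sets up to null sets *)

Section Generating.
Context d (T : measurableType d) (R : realType) (mu : {sigma_finite_measure set T -> \bar R}).

Definition generates (f : T -> R) := forall C : set T, measurable C ->
  exists2 E : set R, measurable E & \forall x \ae mu, C x <-> E (f x).

(** For C of finite measure choose basis sets whose symmetric differences with C have summable
    measures. By Borel-Cantelli almost every point lies in finitely many of them, so C is almost
    everywhere the upper limit of the chosen sets. A sigma-finite exhaustion covers the general
    case. *)
Lemma countable_basis_generates : countable_basis mu ->
  exists2 f : T -> R, measurable_fun setT f & generates f.
Proof.
move=> [B [mB hB]]; pose f := digit_fun R B 0.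
exists f; first exact: measurable_digit_fun.
have /choice[D hD] n : exists E : set R, measurable E /\ forall x, B n x <-> E (f x).
  by have [E mE h] := digit_set R B n; exists E.
have [F FT mF] := sigma_finiteT mu.
have fin C : measurable C -> (mu C < +oo)%E ->
    exists2 E : set R, measurable E & \forall x \ae mu, C x <-> E (f x).
  move=> mC Cfin.
  have eps0 j : 0 < 1 / (2 ^ j.+1)%:R :> R by rewrite divr_gt0// ltr0n expn_gt0.
  have /choice[n hn] j := hB C _ mC Cfin (eps0 j).
  pose G j := C `+` B (n j).
  have mG j : measurable (G j) by apply: measurableU; exact: measurableD.
  have G0 : mu (lim_sup_set G) = 0%E.
    apply: lim_sup_set_cvg0 => //.
    apply: (@le_lt_trans _ _ 1%:E); last exact: ltry.
    apply: le_trans (epsilon_trick0 xpredT ler01); apply: lee_nneseries => // j _.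
    exact: (ltW (hn j)).
  exists (lim_sup_set (fun j => D (n j))).
    apply: bigcapT_measurable => j; apply: bigcup_measurable => k _; exact: (hD _).1.
  have mls : measurable (lim_sup_set G).
    by apply: bigcapT_measurable => j; apply: bigcup_measurable => k _.
  exists (lim_sup_set G); split => // x /= nCE.
  apply: contrapT => /existsNP[j /not_implyP[_ nG]]; apply: nCE.
  have CB k : (j <= k)%N -> (C x <-> D (n k) (f x)).
    move=> jk; rewrite -((hD (n k)).2 x).
    have nGk : ~ G k x by move=> Gk; apply: nG; exists k.
    by split=> h; apply: contrapT => h'; apply: nGk; [left|right].
  split=> [Cx m _|/(_ j I)[k /= jk Dk]].
    exists (maxn j m); first by rewrite /= leq_maxr.
    by apply/CB => //; exact: leq_maxl.
  exact/(CB k).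
move=> C mC.
have /choice[E hE] k : exists E : set R, measurable E /\
    \forall x \ae mu, (C `&` F k) x <-> E (f x).
  have [mFk Fk] := mF k.
  have [||E mE h] := fin (C `&` F k); last by exists E.
    exact: measurableI.
  apply: le_lt_trans Fk; apply: le_measure; rewrite ?inE//; exact: measurableI.
exists (\bigcup_k E k); first by apply: bigcup_measurable => k _; exact: (hE k).1.
have := ae_foralln (fun k => (hE k).2); apply: filterS => x h.
split=> [Cx|[k _ /h[]//]].
have : (\bigcup_k F k) x by rewrite -FT.
by move=> [k _ Fk]; exists k => //; apply/h.
Qed.

End Generating.

(** * The distribution function of a diffuse measure *)

Section DistributionFunction.
Context (R : realType) (nu : {finite_measure set R -> \bar R}).
Hypothesis nu1 : forall y, nu [set y] = 0%E.

Definition dfun (y : R) : R := fine (nu `]-oo, y]%classic).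

Let nu_fin (A : set R) : measurable A -> nu A \is a fin_num.
Proof. by move=> mA; exact: fin_num_measure. Qed.

Lemma dfunE y : (dfun y)%:E = nu `]-oo, y]%classic.
Proof. by rewrite fineK// nu_fin. Qed.

Let tot : R := fine (nu setT).

Lemma le_dfun x y : x <= y -> dfun x <= dfun y.
Proof.
move=> xy; rewrite -lee_fin !dfunE le_measure ?inE//.
by move=> z; rewrite /= !in_itv/= => /le_trans; apply.
Qed.

Lemma dfun_ge0 y : 0 <= dfun y.
Proof. by rewrite -lee_fin dfunE. Qed.

Lemma dfun_le_tot y : dfun y <= tot.
Proof. by rewrite -lee_fin dfunE fineK ?nu_fin// le_measure ?inE. Qed.

Lemma measurable_dfun : measurable_fun setT dfun.
Proof. by apply: nondecreasing_measurable => // x y; exact: le_dfun. Qed.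

Lemma nu_open y : nu `]-oo, y[%classic = nu `]-oo, y]%classic.
Proof.
apply/eqP; rewrite eq_le le_measure ?inE//=; last first.
  by move=> z; rewrite /= !in_itv/= => /ltW.
rewrite -(@setUitv1 _ _ -oo%O y true)//.
by rewrite (le_trans (measureU2 _ _ _))//= nu1 adde0.
Qed.

(** Left continuity, where the absence of point masses enters. *)
Lemma dfun_left_le s t : (forall y, y < s -> dfun y <= t) -> dfun s <= t.
Proof.
move=> h; rewrite -lee_fin dfunE -nu_open.
pose A n := `]-oo, s - n.+1%:R^-1]%classic.
have sA : `]-oo, s[%classic = \bigcup_n A n.
  apply/seteqP; split=> [z|z [n _]]; rewrite /A /= !in_itv/=.
    rewrite -subr_gt0 => /ltr_add_invr[n]; rewrite add0r => hn; exists n => //=.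
    by rewrite in_itv/= lerBrDr -lerBrDl ltW.
  move=> /le_lt_trans; apply; rewrite ltrBlDr ltrDl invr_gt0//.
have mA n : measurable (A n) by exact: measurable_itv.
have mU : measurable (\bigcup_n A n) by exact: bigcup_measurable.
have ndA : nondecreasing_seq A.
  move=> m n mn; apply/subsetPset => z; rewrite /A /= !in_itv/= => /le_trans; apply.
  by rewrite lerD2l lerN2 lef_pV2 ?posrE// ler_nat.
rewrite sA; apply: (cvge_to_le (nondecreasing_cvg_mu mA mU ndA)).
apply: nearW => n /=; rewrite -dfunE lee_fin h// ltrBlDr ltrDl invr_gt0//.
Qed.

Lemma dfun_right_ge s t : (forall y, s < y -> t <= dfun y) -> t <= dfun s.
Proof.
move=> h; rewrite -lee_fin dfunE.
pose A n := `]-oo, s + n.+1%:R^-1]%classic.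
have sA : `]-oo, s]%classic = \bigcap_n A n.
  apply/seteqP; split=> [z|z hz]; rewrite /A /= !in_itv/=.
    move=> zs n _ /=; rewrite in_itv/= (le_trans zs)// lerDl invr_ge0//.
  rewrite leNgt; apply/negP; rewrite -subr_gt0 => /ltr_add_invr[n]; rewrite add0r => hn.
  by have := hz n I; rewrite /A /= in_itv/= leNgt -ltrBrDl hn.
have mA n : measurable (A n) by exact: measurable_itv.
have mU : measurable (\bigcap_n A n) by exact: bigcapT_measurable.
have ndA : nonincreasing_seq A.
  move=> m n mn; apply/subsetPset => z; rewrite /A /= !in_itv/= => /le_trans; apply.
  by rewrite lerD2l lef_pV2 ?posrE// ler_nat.
have A0 : (nu (A 0%N) < +oo)%E by rewrite ltey_eq nu_fin.
rewrite sA; apply: (cvge_to_ge (nonincreasing_cvg_mu A0 mA mU ndA)).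
apply: nearW => n /=; rewrite -dfunE lee_fin h// ltrDl invr_gt0//.
Qed.

Lemma dfun_top t : (forall y, dfun y <= t) -> tot <= t.
Proof.
move=> h; rewrite -lee_fin fineK ?nu_fin//.
pose A n := `]-oo, (n%:R : R)]%classic.
have sA : setT = \bigcup_n A n.
  apply/seteqP; split=> // z _; exists (Num.truncn z).+1 => //.
  by rewrite /A /= in_itv/= ltW// Num.Theory.truncnS_gt.
have mA n : measurable (A n) by exact: measurable_itv.
have mU : measurable (\bigcup_n A n) by exact: bigcup_measurable.
have ndA : nondecreasing_seq A.
  move=> m n mn; apply/subsetPset => z; rewrite /A /= !in_itv/= => /le_trans; apply.
  by rewrite ler_nat.
rewrite sA; apply: (cvge_to_le (nondecreasing_cvg_mu mA mU ndA)).
by apply: nearW => n /=; rewrite -dfunE lee_fin h.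
Qed.

Lemma dfun_bot t : (forall y, t <= dfun y) -> t <= 0.
Proof.
move=> h; suff : (t%:E <= nu set0)%E by rewrite measure0 lee_fin.
pose A n := `]-oo, (- n%:R : R)]%classic.
have sA : set0 = \bigcap_n A n.
  apply/seteqP; split=> // z /(_ (Num.truncn (- z)).+1 I).
  by rewrite /A /= in_itv/= lerNr leNgt Num.Theory.truncnS_gt.
have mA n : measurable (A n) by exact: measurable_itv.
have mU : measurable (\bigcap_n A n) by exact: bigcapT_measurable.
have ndA : nonincreasing_seq A.
  move=> m n mn; apply/subsetPset => z; rewrite /A /= !in_itv/= => /le_trans; apply.
  by rewrite lerN2 ler_nat.
have A0 : (nu (A 0%N) < +oo)%E by rewrite ltey_eq nu_fin.
rewrite sA; apply: (cvge_to_ge (nonincreasing_cvg_mu A0 mA mU ndA)).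
by apply: nearW => n /=; rewrite -dfunE lee_fin h.
Qed.

(** By continuity, {F <= t} is a ray that ends at a point s with F(s) = t, apart from the extreme
    cases in which it is everything or empty. So F pushes the measure to the uniform one on [0,
    [tot]]. *)
Lemma nu_dfun_le t : 0 <= t <= tot -> nu (dfun @^-1` `]-oo, t]) = t%:E.
Proof.
move=> /andP[t0 tc].
have [tE|tn] := eqVneq t tot.
  rewrite (_ : _ @^-1` _ = setT); first by rewrite tE fineK ?nu_fin.
  by apply/seteqP; split=> // y _; rewrite /= in_itv/= tE dfun_le_tot.
have tlt : t < tot by rewrite lt_neqAle tn.
pose A := [set y | dfun y <= t].
have [[a Aa]|A0] := pselect (A !=set0); last first.
  (* An empty level set forces t = 0, since F takes values arbitrarily close to 0. *)
  have -> : t = 0.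
    apply/le_anti; rewrite t0 andbT; apply: dfun_bot => y.
    by rewrite leNgt; apply/negP => /ltW ?; apply: A0; exists y.
  transitivity (nu set0); last exact: measure0.
  congr (nu _); apply/seteqP; split=> // y.
  rewrite /= in_itv/= => y0; apply: A0; exists y; rewrite /A /=.
  exact: le_trans y0 t0.
have [b bt] : exists b, t < dfun b.
  apply: contrapT => /forallNP h; move: tlt; rewrite ltNge => /negP; apply.
  by apply: dfun_top => y; rewrite leNgt; apply/negP/h.
have Aub : has_ubound A.
  exists b => y Ay; rewrite leNgt; apply/negP => /ltW/le_dfun h.
  by move: bt; rewrite ltNge (le_trans h).
have As : has_sup A by split => //; exists a.
pose s := sup A.
have lts y : y < s -> dfun y <= t.
  move=> /(sup_gt _)-[|z Az yz]; first by exists a.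
  exact: le_trans (le_dfun (ltW yz)) Az.
have gts y : s < y -> t < dfun y.
  move=> sy; rewrite ltNge; apply/negP => Ay.
  by have := ub_le_sup Aub Ay; rewrite leNgt sy.
have st : dfun s = t.
  apply/le_anti; rewrite dfun_left_le//=.
  by apply: dfun_right_ge => y /gts/ltW.
rewrite -st dfunE; congr (nu _); apply/seteqP; split=> y; rewrite /= !in_itv/=.
  by move=> h; rewrite leNgt; apply/negP => /gts; rewrite -st ltNge h.
exact: le_dfun.
Qed.

(** F need not be injective, but its flat stretch to the right of y is null: it is covered by
    countably many null intervals with rational right ends and at most one further point. *)
Lemma dfun_flat y : \forall z \ae nu, dfun z <= dfun y -> z <= y.
Proof.
pose q (n : nat) : R := if unpickle n is Some r then ratr (r : rat) else 0.
pose G n := if (y < q n) && (dfun (q n) <= dfun y) then `]y, q n]%classic else set0.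
have G0 n : nu.-negligible (G n).
  rewrite /G; case: ifP => [/andP[yq Fq]|_]; last exact: negligible_set0.
  apply/negligibleP => //.
  have : nu `]-oo, q n]%classic = (nu `]-oo, y]%classic + nu `]y, q n]%classic)%E.
    rewrite -measureU//.
      congr (nu _); apply/seteqP; split=> z; rewrite /= !in_itv/=.
        by move=> zq; have [zy|yz] := leP z y; [left|right; apply/andP; split].
      by move=> [/le_trans|/andP[]//]; apply; exact: ltW.
    apply/seteqP; split=> // z []; rewrite /= !in_itv/= => zy /andP[].
    by rewrite ltNge zy.
  rewrite -!dfunE; set x := nu `]y, q n]%classic.
  have xfin : x \is a fin_num by exact: nu_fin.
  have x0 : 0 <= fine x by apply: fine_ge0; exact: measure_ge0.
  rewrite -(fineK xfin) -EFinD => -[e].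
  have fx0 : fine x = 0 by apply/le_anti; rewrite x0 andbT; lra.
  by rewrite -[LHS]/x -[LHS](fineK xfin) fx0.
(* The points of the flat stretch beyond all its rationals; two of them would have a rational in
   between. *)
pose K := [set z | [/\ y < z, dfun z <= dfun y &
  forall n, y < q n -> dfun (q n) <= dfun y -> q n < z]].
have K0 : nu.-negligible K.
  have [[k Kk]|Ke] := pselect (K !=set0); last first.
    rewrite (_ : K = set0); first exact: negligible_set0.
    by apply/seteqP; split=> // z Kz; apply: Ke; exists z.
  exists [set k]; split => // z [yz Fz Kz] /=.
  have {Kk} [yk Fk Kk] := Kk.
  have rat_btw u v : y < u -> u < v -> dfun v <= dfun y ->
      (forall n, y < q n -> dfun (q n) <= dfun y -> q n < u) -> False.
    move=> yu uv Fv hu; have [r] := rat_in_itvoo uv; rewrite in_itv/= => /andP[r1 r2].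
    have qE : q (pickle r) = ratr r by rewrite /q pickleK.
    have := hu (pickle r); rewrite qE (lt_trans yu r1) (le_trans (le_dfun (ltW r2)) Fv).
    by move=> /(_ isT isT); rewrite ltNge ltW.
  by apply/eqP; rewrite eq_le !leNgt; apply/andP; split; apply/negP => h;
    [exact: (rat_btw k z)|exact: (rat_btw z k)].
have := negligibleU K0 (negligible_bigcup G0); apply: negligibleS => z /= /not_implyP[Fz].
move=> /negP; rewrite -ltNge => yz.
have [[n [h1 h2 h3]]|h] := pselect (exists n, [/\ y < q n, dfun (q n) <= dfun y & z <= q n]).
  by right; exists n => //; rewrite /G h1 h2 /= in_itv/= yz.
left; split => // n h1 h2; rewrite ltNge; apply/negP => h3; apply: h.
by exists n.
Qed.

(** Sets that are preimages almost everywhere form a sigma-algebra. The open ray below y belongs to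
    it, because {z < y} and {F(z) <= F(y)} differ by a null set. *)
Lemma dfun_generates (E : set R) : measurable E ->
  exists2 E' : set R, measurable E' & \forall z \ae nu, E z <-> E' (dfun z).
Proof.
pose G := [set E | measurable E /\ exists2 E' : set R, measurable E' &
  \forall z \ae nu, E z <-> E' (dfun z)].
suff GE : (@RGenInftyO.G R).-sigma.-measurable `<=` G.
  by rewrite -RGenInftyO.measurableE in GE; move=> /GE[].
apply: smallest_sub.
  split.
  - by split => //; exists set0 => //; apply: nearW.
  - move=> A [mA [A' mA' h]]; rewrite setTD; split; first exact: measurableC.
    exists (~` A'); first exact: measurableC.
    by apply: filterS h => z h; split=> h1 h2; apply: h1; apply/h.
  - move=> A hA; split; first by apply: bigcup_measurable => k _; have [] := hA k.
    have /choice[A' hA'] k : exists A' : set R, measurable A' /\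
        \forall z \ae nu, A k z <-> A' (dfun z).
      by have [_ [A' mA' h]] := hA k; exists A'.
    exists (\bigcup_k A' k); first by apply: bigcup_measurable => k _; have [] := hA' k.
    have := ae_foralln (fun k => (hA' k).2); apply: filterS => z h.
    by split=> -[k _ hk]; exists k => //; apply/h.
move=> _ [y ->]; split; first exact: measurable_itv.
exists `]-oo, dfun y]%classic; first exact: measurable_itv.
have ny : \forall z \ae nu, z != y.
  by exists [set y]; split => // z /= /negP; rewrite negbK => /eqP.
apply: filterS2 (dfun_flat y) ny => z h zy; rewrite /= !in_itv/=.
split=> [/ltW/le_dfun//|/h zy']; by rewrite lt_neqAle zy.
Qed.

End DistributionFunction.

(** * Image of a measure restricted to a subset *)

Section RestrictedPushforward.
Context d (T : measurableType d) (R : realType) d' (Z : measurableType d').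
Variables (m : {finite_measure set T -> \bar R}).
Variables (Y : set T) (mY : measurable Y) (g : T -> Z) (mg : measurable_fun setT g).

Lemma ge0_integral_mrestr (h : T -> \bar R) : measurable_fun setT h ->
  (forall x, 0 <= h x)%E -> (\int[mrestr m mY]_x h x = \int[m]_(x in Y) h x)%E.
Proof.
move=> mh h0; rewrite -(setUv Y) ge0_integral_setU//=.
- rewrite [X in (_ + X)%E](_ : _ = 0%E) ?adde0.
    by apply: eq_measure_integral => A mA AY; rewrite /= /mrestr setIidl.
  rewrite (eq_measure_integral mzero) ?integral_measure_zero//.
  move=> A mA AY; rewrite /= /mrestr /mzero (_ : _ `&` _ = set0) ?measure0//.
  by apply/seteqP; split=> // x [/AY].
- exact: measurableC.
- exact: measurable_funTS.
- by apply/disj_setPS => x [].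
Qed.

Definition restr_push (m0 : set T -> \bar R) (A : set Z) := m0 (Y `&` g @^-1` A).

Let mpre (A : set Z) : measurable A -> measurable (g @^-1` A).
Proof. by move=> mA; rewrite -[_ @^-1` _]setTI; exact: mg. Qed.

Let restr_push0 : restr_push m set0 = 0%E.
Proof. by rewrite /restr_push preimage_set0 setI0 measure0. Qed.

Let restr_push_ge0 A : (0 <= restr_push m A)%E.
Proof. exact: measure_ge0. Qed.

Let restr_push_sigma_additive : semi_sigma_additive (restr_push m).
Proof.
move=> F mF tF mUF; rewrite /restr_push preimage_bigcup setI_bigcupr.
apply: measure_semi_sigma_additive.
- by move=> n; apply: measurableI => //; exact: mpre.
- apply/trivIsetP => /= i j _ _ ij; rewrite setIACA -preimage_setI.
  by move/trivIsetP : tF => /(_ _ _ _ _ ij) ->//; rewrite preimage_set0 setI0.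
- rewrite -setI_bigcupr -preimage_bigcup.
  by apply: measurableI => //; exact: mpre.
Qed.

Definition restr_push_isMeasure := isMeasure.Build _ _ _ (restr_push m)
  restr_push0 restr_push_ge0 restr_push_sigma_additive.

Lemma restr_push_fin : fin_num_fun (restr_push m).
Proof. by move=> A mA; apply: fin_num_measure; apply: measurableI => //; exact: mpre. Qed.

Lemma ge0_integral_restr_push (lam : {measure set Z -> \bar R}) (h : Z -> \bar R) :
  (forall A, measurable A -> lam A = restr_push m A) ->
  measurable_fun setT h -> (forall z, 0 <= h z)%E ->
  (\int[m]_(x in Y) h (g x) = \int[lam]_z h z)%E.
Proof.
move=> lamE mh h0; rewrite -(@ge0_integral_mrestr (h \o g)); last 2 first.
- exact: measurableT_comp.
- by move=> x; exact: h0.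
apply/esym; have := ge0_integral_pushforward mg (mrestr m mY) (D := setT) (f := h) measurableT mh (fun z _ => h0 z).
rewrite preimage_setT => <-; apply: eq_measure_integral => A mA _.
by rewrite lamE// /restr_push /= /pushforward /= /mrestr setIC.
Qed.

End RestrictedPushforward.

(** * The diffuse and the atomic part *)

Section Factors.
Context d (T : measurableType d) (R : realType) (mu : {measure set T -> \bar R}).

(** The hypotheses of the weighted composition in one predicate: phi identifies the measure algebra
    of A with that of the model [lam], with density rho. *)
Definition factors d' (Z : measurableType d') (lam : {measure set Z -> \bar R})
    (A : set T) (phi : T -> Z) (rho : T -> R) :=
  [/\ measurable_fun setT phi, measurable_fun setT rho, forall x, 0 < rho x,
    forall h : Z -> \bar R, measurable_fun setT h -> (forall z, 0 <= h z)%E ->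
      (\int[mu]_(x in A) ((rho x)%:E * h (phi x)) = \int[lam]_z h z)%E &
    forall C : set T, measurable C -> exists2 B : set Z, measurable B &
      \forall x \ae mu, A x -> (C x <-> B (phi x))].

(** Two sets with the same model are related by inverting one weighted composition and applying the
    other. *)
Lemma factors_transport d' (Z : measurableType d') (lam : {measure set Z -> \bar R})
    (A B : set T) (mA : measurable A) (mB : measurable B) (phi phi' : T -> Z)
    (rho rho' : T -> R) (p : \bar R) (p1 : (1 <= p)%E) :
  factors lam A phi rho -> factors lam B phi' rho' -> transport mu p1 mA mB.
Proof.
move=> [mphi mrho rho0 cv gen] [mphi' mrho' rho0' cv' gen'].
pose V0 : {linear Lp lam p1 -> Lp mu p1} := wcomp mA mphi mrho rho0 cv (p1 := p1).
pose V1 : {linear Lp lam p1 -> Lp mu p1} := wcomp mB mphi' mrho' rho0' cv' (p1 := p1).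
apply: (transport_factor (V0 := V0) (V1 := V1)).
- exact: wcomp_norm.
- exact: wcomp_norm.
- exact: wcomp_band.
- exact: wcomp_onto.
- by move=> C mC mAC; exact: wcomp_preimage_band.
- exact: wcomp_band.
- move=> D mD; have mp := measurableI _ _ mB (measurable_preim mphi' mD).
  by exists (B `&` phi' @^-1` D), mp; exact: wcomp_image_band.
Qed.

Lemma transport0 (p : \bar R) (p1 : (1 <= p)%E) (B : set T) (mB : measurable B) :
  transport mu p1 measurable0 mB.
Proof.
exists \0; split=> [xi|xi|C mC] /=.
- by rewrite (Lp_proj0 measurable0) ?measure0.
- by rewrite linear0.
- exists set0, measurable0; apply/seteqP; split=> [_ [x Cx <-]|_ [z _ <-]].
    by exists 0; rewrite ?linear0.
  exists 0; first by exists 0; rewrite ?linear0.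
  by rewrite (Lp_proj0 measurable0) ?measure0.
Qed.

End Factors.

(** * Halving the diffuse part *)

Section Uniform.
Context d (T : measurableType d) (R : realType).
Variables (mu : {sigma_finite_measure set T -> \bar R}) (m : {finite_measure set T -> \bar R}).
Variable rho : T -> R.
Hypotheses (mrho : measurable_fun setT rho) (rho0 : forall x, 0 < rho x).
Hypothesis density : forall A f, measurable A -> measurable_fun setT f ->
  (forall x, 0 <= f x)%E ->
  (\int[mu]_(x in A) ((rho x)%:E * f x) = \int[m]_(x in A) f x)%E.
Hypothesis null_iff : forall N, measurable N -> m N = 0%E <-> mu N = 0%E.
Variable f : T -> R.
Hypotheses (mf : measurable_fun setT f) (fgen : generates mu f).
Variables (Y : set T) (mY : measurable Y).
Hypothesis diffuse : forall y, m (Y `&` f @^-1` [set y]) = 0%E.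

Definition nuY : set R -> \bar R := restr_push Y f m.
HB.instance Definition _ : isMeasure _ _ _ nuY := restr_push_isMeasure m mY mf.
HB.instance Definition _ := Measure_isFinite.Build _ _ _ nuY (restr_push_fin m mY mf).

Let nu1 y : nuY [set y] = 0%E. Proof. exact: diffuse. Qed.
Let g x := dfun nuY (f x).
Let c : R := fine (m Y).
Let mg : measurable_fun setT g.
Proof. exact: measurableT_comp (measurable_dfun _) mf. Qed.

Let nuT : fine (nuY setT) = c.
Proof. by rewrite /c /nuY /restr_push preimage_setT setIT. Qed.

Let c0 : 0 <= c. Proof. by rewrite fine_ge0. Qed.

(** The distribution function of the uniform measure of mass c on [0, c]. *)
Definition clip (c t : R) : R := Num.max 0 (Num.min t c).

Let mYg t : m (Y `&` [set x | g x <= t]) = (clip c t)%:E.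
Proof.
have E : m (Y `&` [set x | g x <= t]) = nuY (dfun nuY @^-1` `]-oo, t]%classic).
  congr (m _); apply/seteqP; split=> x /= [Yx h]; split=> //; move: h; rewrite /= ?in_itv /=; exact: id.
have [t0|t0] := ltP t 0.
  rewrite (_ : _ `&` _ = set0).
    by rewrite measure0 /clip min_l ?max_l// ?ltW// (lt_le_trans t0).
  apply/seteqP; split=> // x [_ /=]; rewrite leNgt => /negP; apply.
  by apply: (lt_le_trans t0); exact: dfun_ge0.
have [tc|ct] := leP t c.
  by rewrite E nu_dfun_le// ?nuT ?t0// /clip min_l// max_r.
rewrite (_ : _ `&` _ = Y).
  by rewrite /clip min_r ?max_r// ?ltW// fineK// fin_num_measure.
apply/seteqP; split=> [x []//|x Yx]; split => //=.
by rewrite ltW// (le_lt_trans _ ct)// -nuT; exact: dfun_le_tot.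
Qed.

(** Uniform on [0, c], although defined as an image measure; it enters through its values on
    rays. *)
Definition unif : set R -> \bar R := restr_push Y g m.
HB.instance Definition _ : isMeasure _ _ _ unif := restr_push_isMeasure m mY mg.

Let mYle t : measurable (Y `&` [set x | g x <= t]).
Proof.
apply: measurableI => //; rewrite [X in measurable X](_ : _ = g @^-1` `]-oo, t]%classic).
  by rewrite -[_ @^-1` _]setTI; exact: mg.
by apply/seteqP; split=> x; rewrite /= in_itv.
Qed.

Lemma unif_ray t : unif `]t, +oo[%classic = (c - clip c t)%:E.
Proof.
rewrite /unif /restr_push.
have -> : Y `&` g @^-1` `]t, +oo[%classic = Y `\` (Y `&` [set x | g x <= t]).
  apply/seteqP; split=> x /=; rewrite in_itv/= andbT.
    by move=> [Yx tx]; split => // -[_]; rewrite leNgt tx.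
  by move=> [Yx h]; split => //; rewrite ltNge; apply/negP => xt; exact: h.
rewrite measureD//; last by rewrite ltey_eq fin_num_measure.
rewrite setIidr; last by move=> x [].
by rewrite [X in (_ - X)%E]mYg EFinB [X in (_ = X - _)%E]fineK// fin_num_measure.
Qed.

Let mYg_itv s t : s <= t ->
  m (Y `&` [set x | s < g x <= t]) = (clip c t - clip c s)%:E.
Proof.
move=> st.
have -> : Y `&` [set x | s < g x <= t] =
    (Y `&` [set x | g x <= t]) `\` (Y `&` [set x | g x <= s]).
  apply/seteqP; split=> x /=.
    move=> [Yx /andP[sx xt]]; split => // -[_].
    by rewrite leNgt sx.
  move=> [[Yx xt] h]; split => //; rewrite xt andbT ltNge.
  by apply/negP => xs; apply: h.
rewrite measureD//; last by rewrite ltey_eq fin_num_measure.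
rewrite [X in (_ - m X)%E]setIidr; last first.
  by move=> x [Yx xs]; split => //=; exact: le_trans xs st.
by rewrite [X in (X - _)%E]mYg [X in (_ - X)%E]mYg.
Qed.

(** The last hypothesis compares k times the law of al g + be on A with [unif] on rays, and rays
    determine a finite measure. An invertible affine function of g generates as much as g, which
    generates because f does and the distribution function loses only null sets. *)
Lemma unif_factors (A : set T) (k al be : R) : measurable A -> A `<=` Y ->
  0 < k -> al != 0 ->
  (forall t, (k%:E * m (A `&` [set x | (t < al * g x + be)%R]) = (c - clip c t)%:E)%E) ->
  factors mu unif A (fun x => al * g x + be) (fun x => k * rho x).
Proof.
move=> mA AY k0 al0 ray.
set phi := fun x => _.
have mphi : measurable_fun setT phi.
  by apply: measurable_funD => //; exact: measurable_funM.
split => //.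
- exact: measurable_funM.
- by move=> x; rewrite mulr_gt0.
- move=> h mh h0.
  pose kn : {nonneg R} := NngNum (ltW k0).
  have mhp : measurable_fun setT (h \o phi) by exact: measurableT_comp.
  transitivity (\int[mscale kn m]_(x in A) h (phi x))%E.
    rewrite ge0_integral_mscale//; last exact: measurable_funTS.
    rewrite -(density mA mhp)//; last by move=> x; exact: h0.
    rewrite -ge0_integralZl//.
    + by apply: eq_integral => x _; rewrite muleA EFinM.
    + apply: measurable_funTS; apply: emeasurable_funM => //.
      exact/measurable_EFinP.
    + by move=> x _; apply: mule_ge0; [rewrite lee_fin ltW|exact: h0].
  apply: (ge0_integral_restr_push mA mphi) => // B mB.
  pose M : {measure set R -> \bar R} := HB.pack (restr_push A phi (mscale kn m))
    (restr_push_isMeasure (mscale kn m) mA mphi).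
  rewrite -[RHS]/(M B).
  (* Open right rays are stable under intersection and generate the Borel sets; those from -n
     exhaust the line. *)
  apply: (measure_unique (@RGenOInfty.G R) (fun n => `]- n%:R, +oo[%classic)) => //.
  + exact: RGenOInfty.measurableE.
  + move=> _ _ [x ->] [y ->]; exists (Num.max x y).
    by apply/seteqP; split=> z; rewrite /= !in_itv/= !andbT gt_max; [case=> -> ->|move/andP].
  + by move=> n; exists (- n%:R).
  + apply/seteqP; split=> // z _; exists (Num.truncn (- z)).+1 => //.
    by rewrite /= in_itv/= andbT ltrNl Num.Theory.truncnS_gt.
  + move=> _ [t ->]; apply: (eq_trans (unif_ray t)); rewrite -ray; congr (_ * m (_ `&` _))%E.
    by apply/seteqP; split=> x; rewrite /= in_itv/= andbT.
  + move=> n; rewrite ltey_eq; apply/orP; left; exact: (restr_push_fin m mY mg).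
- move=> C mC; have [E mE hE] := fgen mC; have [E' mE' hE'] := dfun_generates nu1 mE.
  (* E' describes the set in terms of g, which the inverse affine map recovers from al g + be. *)
  exists ((fun z => (z - be) / al) @^-1` E').
    rewrite -[_ @^-1` _]setTI.
    suff : measurable_fun setT (fun z : R => (z - be) / al) by exact.
    by apply: measurable_funM => //; exact: measurable_funB.
  have h2 : \forall x \ae mu, Y x -> (E (f x) <-> E' (g x)).
    have [N [mN N0 NP]] := hE'; have mfN : measurable (f @^-1` N).
      by rewrite -[_ @^-1` _]setTI; exact: mf.
    exists (Y `&` f @^-1` N); split; first exact: measurableI.
      by apply/null_iff => //; exact: measurableI.
    by move=> x /= /not_implyP[Yx nE]; split => //; exact: NP.
  apply: filterS2 hE h2 => x h1 h2 Ax.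
  apply: (iff_trans h1); apply: (iff_trans (h2 (AY _ Ax))).
  by rewrite /phi /= addrK mulrAC divff// mul1r.
Qed.

Let clip_lt0 t : t < 0 -> clip c t = 0.
Proof. by move=> t0; rewrite /clip min_l ?max_l ?ltW// (lt_le_trans t0). Qed.

Let clip_in t : 0 <= t <= c -> clip c t = t.
Proof. by move=> /andP[t0 tc]; rewrite /clip min_l// max_r. Qed.

Let clip_gt t : c < t -> clip c t = c.
Proof. by move=> ct; rewrite /clip min_r// ?max_r// ltW. Qed.

Let g_le_c x : g x <= c. Proof. by rewrite -nuT; exact: dfun_le_tot. Qed.

(* [2 g] on the lower half and [2 g - c] on the upper half have the law of [g]. *)
Lemma uniform_halves : exists (B1 B2 : set T) (mB1 : measurable B1) (mB2 : measurable B2),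
  [/\ B1 `<=` Y, B2 `<=` Y, B1 `&` B2 = set0 &
  forall (p : \bar R) (p1 : (1 <= p)%E), transport mu p1 mY mB1 /\ transport mu p1 mY mB2].
Proof.
pose B1 := Y `&` [set x | g x <= c / 2]; pose B2 := Y `&` [set x | c / 2 < g x].
have mB1 : measurable B1.
  apply: measurableI => //; rewrite [X in measurable X](_ : _ = g @^-1` `]-oo, c / 2]%classic).
    by rewrite -[_ @^-1` _]setTI; exact: mg.
  by apply/seteqP; split=> x; rewrite /= in_itv.
have mB2 : measurable B2.
  apply: measurableI => //; rewrite [X in measurable X](_ : _ = g @^-1` `]c / 2, +oo[%classic).
    by rewrite -[_ @^-1` _]setTI; exact: mg.
  by apply/seteqP; split=> x; rewrite /= in_itv/= andbT.
exists B1, B2, mB1, mB2; split.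
- by move=> x [].
- by move=> x [].
- by apply/seteqP; split=> // x [[_ /=]]; rewrite leNgt => /negP + [].
have F0 : factors mu unif Y (fun x => 1 * g x + 0) (fun x => 1 * rho x).
  apply: unif_factors => // t; rewrite mul1e.
  have [tc|ct] := leP t c.
    rewrite (_ : _ `&` _ = Y `&` [set x | t < g x <= c]).
      by rewrite mYg_itv// [clip c c](clip_in _)// c0 lexx.
    apply/seteqP; split=> x /= [Yx h]; split => //.
      by rewrite g_le_c andbT; move: h; rewrite mul1r addr0.
    by move: h => /andP[h _]; rewrite mul1r addr0.
  rewrite (_ : _ `&` _ = set0); last first.
    by apply/seteqP; split=> // x /= [Yx]; have := g_le_c x; lra.
  by rewrite measure0 clip_gt// subrr.
have F1 : factors mu unif B1 (fun x => 2 * g x + 0) (fun x => 2 * rho x).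
  apply: unif_factors => //; first by move=> x [].
  move=> t; have [tc|ct] := leP t c.
    rewrite (_ : _ `&` _ = Y `&` [set x | t / 2 < g x <= c / 2]).
      rewrite mYg_itv; last by lra.
      rewrite (@clip_in (c / 2)); last by have := c0; lra.
      rewrite -EFinM; congr EFin.
      have [t0|t0] := ltP t 0.
        rewrite (@clip_lt0 t)// (@clip_lt0 (t / 2)); lra.
      rewrite (@clip_in t); last by rewrite t0 tc.
      by rewrite (@clip_in (t / 2)); lra.
    by rewrite /B1; apply/seteqP; split=> x /=; [move=> [[Yx ?] ?]|move=> [Yx ?]]; do ?split=> //; lra.
  rewrite (_ : _ `&` _ = set0); last first.
    by rewrite /B1; apply/seteqP; split=> // x /= [[Yx]] /=; lra.
  by rewrite measure0 mule0 clip_gt// subrr.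
have F2 : factors mu unif B2 (fun x => 2 * g x + (- c)) (fun x => 2 * rho x).
  apply: unif_factors => //; first by move=> x [].
  move=> t; have [tc|ct] := leP t c.
    have [t0|t0] := ltP t 0.
      rewrite (_ : _ `&` _ = Y `&` [set x | c / 2 < g x <= c]).
        rewrite mYg_itv; last by have := c0; lra.
        rewrite (@clip_in (c / 2)); last by have := c0; lra.
        rewrite (@clip_in c); last by have := c0; lra.
        rewrite (@clip_lt0 t)//.
        by rewrite -EFinM; congr EFin; lra.
      rewrite /B2; apply/seteqP; split=> x /=; have := g_le_c x; [move=> ? [[Yx ?] ?]|move=> ? [Yx ?]].
        by split => //; lra.
      by split; [split=> //|]; lra.
    rewrite (_ : _ `&` _ = Y `&` [set x | (t + c) / 2 < g x <= c]).
      rewrite mYg_itv; last by have := c0; lra.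
      rewrite (@clip_in ((t + c) / 2)); last by have := c0; lra.
      rewrite (@clip_in c); last by have := c0; lra.
      rewrite (@clip_in t); last by rewrite t0 tc.
      by rewrite -EFinM; congr EFin; lra.
    rewrite /B2; apply/seteqP; split=> x /=; have := g_le_c x; [move=> ? [[Yx ?] ?]|move=> ? [Yx ?]].
      by split => //; lra.
    by split; [split=> //|]; have := c0; lra.
  rewrite (_ : _ `&` _ = set0); last first.
    by rewrite /B2; apply/seteqP; split=> // x /= [[Yx _]]; have := g_le_c x; lra.
  by rewrite measure0 mule0 clip_gt// subrr.
by move=> p p1; split; [exact: factors_transport F0 F1|exact: factors_transport F0 F2].
Qed.

End Uniform.

(** * Atoms as fibers of positive mass *)

Section Atoms.
Context d (T : measurableType d) (R : realType).
Variables (mu : {sigma_finite_measure set T -> \bar R}) (m : {finite_measure set T -> \bar R}).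
Variable rho : T -> R.
Hypotheses (mrho : measurable_fun setT rho) (rho0 : forall x, 0 < rho x).
Hypothesis density : forall A f, measurable A -> measurable_fun setT f ->
  (forall x, 0 <= f x)%E ->
  (\int[mu]_(x in A) ((rho x)%:E * f x) = \int[m]_(x in A) f x)%E.
Hypothesis null_iff : forall N, measurable N -> m N = 0%E <-> mu N = 0%E.
Variable f : T -> R.
Hypotheses (mf : measurable_fun setT f) (fgen : generates mu f).

Let mfib y : measurable (f @^-1` [set y]).
Proof. by rewrite -[_ @^-1` _]setTI; exact: mf. Qed.

Definition heavy : set R := [set y | (0 < m (f @^-1` [set y]))%E].

(** After normalisation f is a random variable, and only countably many values of a random variable
    have positive probability. *)
Lemma countable_heavy : countable heavy.
Proof.
have [m0|m0] := eqVneq (m setT) 0%E.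
  rewrite (_ : heavy = set0) ?countable0//; apply/seteqP; split=> // y /=.
  by apply/negP; rewrite -leNgt -m0; apply: le_measure; rewrite ?inE.
have [t _] : [set: T] !=set0 by apply/set0P; apply: contra_neq m0 => ->; rewrite measure0.
(* The Dirac measure is the fallback of [mnormalize] for mass 0 or oo, both excluded here. *)
pose P : probability T R := mnormalize m (dirac t : probability T R).
pose X : {RV P >-> R} := HB.pack f (isMeasurableFun.Build _ _ _ _ f mf).
apply: sub_countable (pmf_gt0_countable X); apply: subset_card_le => y /= hy.
have mT0 : 0 < fine (m setT).
  by rewrite fine_gt0// lt0e m0 measure_ge0 ltey_eq fin_num_measure.
rewrite /pmf /P /= /mnormalize (negbTE m0)/= ifF; last first.
  by apply/negbTE; rewrite -ltey ltey_eq fin_num_measure.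
rewrite fineM ?fin_num_measure//= mulr_gt0 ?invr_gt0//.
by rewrite fine_gt0// hy ltey_eq fin_num_measure.
Qed.

Lemma measurable_heavy : measurable heavy.
Proof. by apply: countable_measurable countable_heavy => y; exact: measurable_set1. Qed.

(** Up to a null set every measurable set is a preimage under f, hence contains the whole fiber over
    y or misses it. *)
Lemma atom_heavy y : heavy y -> atom mu (f @^-1` [set y]).
Proof.
move=> hy; split => //.
  rewrite lt0e measure_ge0 andbT; apply/eqP => /(null_iff (mfib y)) h.
  by move: hy; rewrite /heavy/= h ltxx.
move=> B mB By; have [E mE [N [mN N0 NP]]] := fgen mB.
have [Ey|nEy] := pselect (E y); [right|left].
  apply: (subset_measure0 _ mN) => //; first exact: measurableD.
  move=> x /= [fx nBx]; apply: NP => /= h; apply: nBx; apply/h.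
  by rewrite fx.
apply: (subset_measure0 _ mN) => // x Bx; apply: NP => /= h; apply: nEy.
by rewrite -(By _ Bx); exact/h.
Qed.

Definition law (Y : set T) (mY : measurable Y) : set R -> \bar R := restr_push Y f m.
HB.instance Definition _ Y (mY : measurable Y) : isMeasure _ _ _ (law mY) :=
  restr_push_isMeasure m mY mf.
HB.instance Definition _ Y (mY : measurable Y) :=
  Measure_isFinite.Build _ _ _ (law mY) (restr_push_fin m mY mf).

(* Otherwise the law of [f] on [A] is diffuse and a level set of its distribution
   function bisects [A]. *)
Lemma heavy_of_atom A : atom mu A -> exists2 y, heavy y & mu (A `+` f @^-1` [set y]) = 0%E.
Proof.
move=> [mA A0 Aat].
have [y hy] : exists y, (0 < m (A `&` f @^-1` [set y]))%E.
  apply: contrapT => /forallNP nh.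
  pose nu : {finite_measure set R -> \bar R} := law mA.
  have nu1 y : nu [set y] = 0%E.
    by apply/eqP; rewrite eq_le measure_ge0 andbT leNgt; apply/negP; exact: nh.
  have nuT : fine (nu setT) = fine (m A).
    by rewrite /nu/= /law /restr_push preimage_setT setIT.
  have c0 : 0 < fine (m A).
    rewrite fine_gt0// ltey_eq fin_num_measure//= andbT lt0e measure_ge0 andbT.
    by apply/eqP => /(null_iff mA) h; move: A0; rewrite lt0e => /andP[/eqP + _]; apply; exact: h.
  have half := @nu_dfun_le R nu nu1 (fine (m A) / 2).
  set S := dfun nu @^-1` _ in half.
  have mS : measurable (A `&` f @^-1` S).
    apply: measurableI => //; apply: measurable_preim => //; rewrite /S.
    by apply: measurable_preim; [exact: measurable_dfun|exact: measurable_itv].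
  have {}half : m (A `&` f @^-1` S) = (fine (m A) / 2)%:E.
    by apply: half; rewrite nuT; lra.
  have pos B : measurable B -> m B = (fine (m A) / 2)%:E -> mu B <> 0%E.
    move=> mB hB /(null_iff mB) h; have : (0 < m B)%E by rewrite hB lte_fin divr_gt0.
    by rewrite lt0e => /andP[/eqP + _]; apply; exact: h.
  have [|] := Aat _ mS (@subIsetl _ _ _); first exact: pos.
  apply: pos; first exact: measurableD.
  rewrite measureD//; last by rewrite ltey_eq fin_num_measure.
  rewrite setIidr; last by move=> x [].
  rewrite [X in (_ - X)%E]half [X in (X - _)%E](_ : _ = (fine (m A))%:E).
    by rewrite -EFinB; congr EFin; lra.
  by rewrite fineK// fin_num_measure.
have hvy : heavy y.
  by apply: (lt_le_trans hy); apply: le_measure; rewrite ?inE//; exact: measurableI.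
exists y => //.
have mAy : measurable (A `&` f @^-1` [set y]) by exact: measurableI.
have nz : mu (A `&` f @^-1` [set y]) <> 0%E.
  by move/(null_iff mAy) => h; move: hy; rewrite h ltxx.
(* Two atoms that meet in positive measure agree up to a null set: neither can be split by the
   intersection. *)
have h1 : mu (A `\` f @^-1` [set y]) = 0%E.
  by have [//|] := Aat _ mAy (@subIsetl _ _ _); rewrite setDIr setDv set0U.
have h2 : mu (f @^-1` [set y] `\` A) = 0%E.
  have [_ _ yat] := atom_heavy hvy.
  by have [//|] := yat _ mAy (@subIsetr _ _ _); rewrite setDIr setDv setU0.
by apply: (eq_trans (measureU0 _ _ h2)) => //; exact: measurableD.
Qed.

(** Atoms with the same heavy value both agree with its fiber up to null sets, so atoms that differ
    have different values. *)
Lemma infinite_heavy (A : nat -> set T) : (forall n, atom mu (A n)) ->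
  (forall k n, k <> n -> mu (A k `+` A n) <> 0%E) -> infinite_set heavy.
Proof.
move=> At Ad.
have /choice[y hy] n : exists y, heavy y /\ mu (A n `+` f @^-1` [set y]) = 0%E.
  by have [y h1 h2] := heavy_of_atom (At n); exists y.
apply/infiniteP/pcard_leP/injfunPex; exists y; first by move=> n _; exact: (hy n).1.
move=> k n _ _ ykn; apply: contrapT => kn; apply: (Ad _ _ kn).
have mA j : measurable (A j) by case: (At j).
have mSD (B C : set T) : measurable B -> measurable C -> measurable (B `+` C).
  by move=> mB mC; apply: measurableU; exact: measurableD.
have mS j z : measurable (A j `+` f @^-1` [set z]) by exact: mSD.
apply: (@subset_measure0 _ _ _ mu _ ((A k `+` f @^-1` [set y k]) `|` (A n `+` f @^-1` [set y n]))).
- exact: mSD.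
- exact: measurableU.
- rewrite ykn => x /= [[Ax nAx]|[Ax nAx]]; have [fx|fx] := pselect (f x = y n).
  + by right; right.
  + by left; left.
  + by left; right.
  + by right; left.
- by apply: (eq_trans (measureU0 _ _ (hy n).2)) => //; exact: (hy k).2.
Qed.

End Atoms.

(** * The atomic part as the natural numbers *)

Section AtomicPart.
Context d (T : measurableType d) (R : realType).
Variables (mu : {sigma_finite_measure set T -> \bar R}) (m : {finite_measure set T -> \bar R}).
Variable rho : T -> R.
Hypotheses (mrho : measurable_fun setT rho) (rho0 : forall x, 0 < rho x).
Hypothesis density : forall A f, measurable A -> measurable_fun setT f ->
  (forall x, 0 <= f x)%E ->
  (\int[mu]_(x in A) ((rho x)%:E * f x) = \int[m]_(x in A) f x)%E.
Variable f : T -> R.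
Hypotheses (mf : measurable_fun setT f) (fgen : generates mu f).

Let mfib y : measurable (f @^-1` [set y]).
Proof. by rewrite -[_ @^-1` _]setTI; exact: mf. Qed.

Variable a : nat -> R.
Hypotheses (ainj : injective a) (aheavy : forall k, heavy m f (a k)).

Definition fibers : set T := \bigcup_k f @^-1` [set a k].

Lemma measurable_fibers : measurable fibers.
Proof. by apply: bigcup_measurable => k _; exact: mfib. Qed.

(* [0] outside the range of [a] *)
Definition index_of (y : R) : nat := xget 0 [set k | y = a k].

Lemma index_ofK k : index_of (a k) = k.
Proof. by rewrite /index_of; case: xgetP => [j _ /ainj ->//|/(_ k)/(_ erefl)]. Qed.

(** A preimage is a countable set, possibly together with the complement of the countable range of
    [a], where the default value 0 is taken. *)
Lemma measurable_index_of : measurable_fun setT index_of.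
Proof.
move=> _ S _; rewrite setTI.
have cm (D : set R) : countable D -> measurable D.
  by apply: countable_measurable => y; exact: measurable_set1.
have -> : index_of @^-1` S = (a @` S) `|` (~` range a `&` [set _ | S 0]).
  apply/seteqP; split=> y /=.
    have [[k _ <-]|nk] := pselect (range a y); first by rewrite index_ofK; left; exists k.
    rewrite /index_of; case: xgetP => [j _ yj|_ S0]; last by right.
    by case: nk; exists j.
  move=> [[k Sk <-]|[nk S0]]; first by rewrite index_ofK.
  by rewrite /index_of; case: xgetP => // j _ yj; case: nk; exists j.
have cimg (D : set nat) : countable (a @` D).
  by apply: (@sub_countable _ _ _ D); [exact: card_image_le|exact: countableP].
apply: measurableU; first by apply: cm; exact: cimg.
apply: measurableI; first by apply: measurableC; apply: cm; exact: cimg.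
have [S0|S0] := pselect (S 0).
  by rewrite [X in measurable X](_ : _ = setT)//; apply/seteqP; split.
by rewrite [X in measurable X](_ : _ = set0)//; apply/seteqP; split.
Qed.

Let w k : R := fine (m (f @^-1` [set a k])).
Let w_gt0 k : 0 < w k.
Proof. by rewrite fine_gt0// (aheavy k) ltey_eq fin_num_measure. Qed.

Let phi x := index_of (f x).
Let mphi : measurable_fun setT phi.
Proof. exact: measurableT_comp measurable_index_of mf. Qed.

(** Dividing the density by the mass w of each fiber gives every index mass 1. The model does not
    depend on the enumeration, so the fibers over a subsequence have the same model as all of
    them. *)
Lemma fibers_factors : factors mu (@counting nat R) fibers phi (fun x => (w (phi x))^-1 * rho x).
Proof.
have mwphi : measurable_fun setT (fun x => (w (phi x))^-1).
  exact: (measurableT_comp (f := fun k : nat => (w k)^-1)).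
split => //.
- exact: measurable_funM.
- by move=> x; rewrite mulr_gt0// invr_gt0.
- move=> h mh h0.
  pose g k := ((w k)^-1%:E * h k)%E.
  have g0 k : (0 <= g k)%E by apply: mule_ge0 => //; rewrite lee_fin invr_ge0 ltW.
  have mg : measurable_fun setT (g \o phi).
    by apply: (measurableT_comp (f := g)).
  transitivity (\int[m]_(x in fibers) (g \o phi) x)%E.
    rewrite -(density measurable_fibers mg)//; last by move=> x; exact: g0.
    by apply: eq_integral => x _; rewrite /g /= EFinM muleCA muleA.
  rewrite ge0_integral_bigcup//; last 3 first.
  + exact: measurable_funTS.
  + by move=> x _; exact: g0.
  + apply/trivIsetP => j k _ _ jk; apply/seteqP; split=> // x /= [-> /ainj].
    exact/eqP.
  rewrite ge0_integral_count//; apply: eq_eseriesr => k _.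
  rewrite (eq_integral (cst (g k))); last first.
    by move=> x /[!inE] /= fx; rewrite /phi fx index_ofK.
  rewrite integral_cst// /g muleAC -[X in (_ * X * _)%E]fineK ?fin_num_measure//.
  by rewrite -EFinM mulVf ?mul1e// gt_eqF.
- move=> C mC; have [E mE hE] := fgen mC; exists (a @^-1` E) => //.
  apply: filterS hE => x hx [k _ fx]; apply: (iff_trans hx).
  by rewrite /phi /= fx index_ofK.
Qed.

End AtomicPart.

(** * Existence of a halving *)

Section Halving.
Context d (T : measurableType d) (R : realType).
Variables (mu : {sigma_finite_measure set T -> \bar R}).

(** If infinitely many atoms exist, the diffuse part may be null; its model then has mass 0 and the
    transports still exist, so a purely atomic X is no separate case. *)
Lemma halving_exists (p : \bar R) (p1 : (1 <= p)%E) :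
  countable_basis mu -> convenient mu -> halving mu p1.
Proof.
move=> cb conv.
have [f mf fgen] := countable_basis_generates cb.
have [F FT hF] := sigma_finiteT mu.
have mF k : measurable (F k) by have [] := hF k.
have Ffin k : (mu (F k) < +oo)%E by have [] := hF k.
have [m [rho [mrho rho0 density null_iff]]] := equivalent_finite_measure mF Ffin (esym FT).
have mfib y : measurable (f @^-1` [set y]) by exact: measurable_preim.
have D := measurable_heavy m mf.
pose Y := f @^-1` (~` heavy m f).
have mY : measurable Y by apply: measurable_preim => //; exact: measurableC.
have diffuse y : m (Y `&` f @^-1` [set y]) = 0%E.
  have [hy|nhy] := pselect (heavy m f y).
    rewrite (_ : _ `&` _ = set0) ?measure0//; apply/seteqP; split=> // x [nx fx].
    by apply: nx; rewrite (fx : f x = y).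
  apply/eqP; rewrite eq_le measure_ge0 andbT.
  apply: (@le_trans _ _ (m (f @^-1` [set y]))).
    by apply: le_measure; rewrite ?inE//; exact: measurableI.
  by rewrite leNgt; apply/negP.
have [B1 [B2 [mB1 [mB2 [B1Y B2Y B12 tB]]]]] :=
  uniform_halves mrho rho0 density null_iff mf fgen mY diffuse.
have [t1 t2] := tB _ p1.
case: conv => [noat|[A [At Ad]]].
  (* A point outside Y would have a heavy value, whose fiber would be an atom. *)
  have YT : Y = setT.
    apply/seteqP; split=> // x _ /= hx.
    exact: (noat _ (atom_heavy null_iff mf fgen hx)).
  apply: (@halving_of_transports _ _ _ _ _ _ Y set0 B1 B2 set0 set0 mY measurable0 mB1 mB2 measurable0 measurable0) => //.
  - by rewrite setI0.
  - by rewrite setU0.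
  - by rewrite setI0.
  - exact: transport0.
  - exact: transport0.
have /eq_card_nat : countable (heavy m f) by exact: countable_heavy.
move=> /(_ (infinite_heavy null_iff mf fgen At Ad)).
rewrite card_eq_sym => /pcard_eqP/bijPex[e [efun einj esurj]].
have ei : injective e by move=> j k; apply: einj; rewrite inE.
have eh k : heavy m f (e k) by exact: efun.
have mfi (b : nat -> R) := measurable_fibers mf b.
pose b1 k := e k.*2; pose b2 k := e k.*2.+1.
have b1i : injective b1 by move=> j k /ei/double_inj.
have b2i : injective b2 by move=> j k /ei [] /double_inj.
have Fe := fibers_factors mrho rho0 density mf fgen ei eh.
have F1 := fibers_factors mrho rho0 density mf fgen b1i (fun k => eh _).
have F2 := fibers_factors mrho rho0 density mf fgen b2i (fun k => eh _).
apply: (@halving_of_transports _ _ _ _ _ _ Y (fibers f e) B1 B2 (fibers f b1) (fibers f b2)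
  mY (mfi e) mB1 mB2 (mfi b1) (mfi b2)) => //.
- by apply/seteqP; split=> // x [nx [k _ fx]]; apply: nx; rewrite (fx : f x = e k).
- apply/seteqP; split=> // x _; have [hx|nhx] := pselect (heavy m f (f x)); last by left.
  by have [k _ ek] := esurj _ hx; right; exists k.
- by move=> x [k _ fx]; exists k.*2.
- by move=> x [k _ fx]; exists k.*2.+1.
- apply/seteqP; split=> // x [[j _ fx] [k _]]; rewrite /= fx => /ei h.
  by have := congr1 odd h; rewrite /= !odd_double.
- exact: factors_transport Fe F1.
- exact: factors_transport Fe F2.
Qed.

End Halving.

Theorem theorem5p13 (R : realType) (d : measure_display) (X : measurableType d)
    (mu : {sigma_finite_measure set X -> \bar R})
    (p : \bar R) (p1 : (1 <= p)%E)
    (i : {linear Lp (mu \x mu)%E p1 -> Lp mu p1})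
    (E F : lmodType R[i])
    (NE : tensor (Lp mu p1) E -> R) (NF : tensor (Lp mu p1) F -> R) :
  (0 < mu [set: X])%E ->
  countable_basis mu ->
  convenient mu ->
  isometric_isomorphism i ->
  is_Lnorm NE ->
  is_Lnorm NF ->
  is_pconvex_tensor_product i NE NF (pLnorm i NE NF)
    (@tens _ E F : {bilinear E -> F -> tensor E F}).
Proof.
move=> _ cb conv iiso NEn NFn.
exact: (pconvex_tensor_product_of_halving iiso NEn NFn (halving_exists p1 cb conv)).
Qed.
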